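(* Let $V:\mathbb{Z}^d\to\mathbb{R}^+\cup\{+\infty\}$ be a strictly convex potential with $V(\vec 0)=0$, and assume $\alpha^*(V)<\infty$. Then for each $\alpha>\alpha^*(V)$ there exists a family of random permutations $(\zeta_\Lambda,\ \Lambda\subseteq\mathbb{Z}^d)$, defined on a common probability space, with $\zeta_\Lambda\in S_\Lambda$ for each $\Lambda$, such that: (i) for every finite $\Lambda$, $\zeta_\Lambda$ is distributed according to $G_\Lambda$ (the specification with identity boundary conditions at temperature $\alpha$); (ii) for each $x\in\mathbb{Z}^d$, $\lim_{\Lambda\nearrow\mathbb{Z}^d}\zeta_\Lambda(x)=\zeta_{\mathbb{Z}^d}(x)$ almost surely; consequently, calling $\mu$ the law of $\zeta_{\mathbb{Z}^d}$, $G_\Lambda\to\mu$ weakly as $\Lambda\nearrow\mathbb{Z}^d$; (iii) $\mu$ is a Gibbs measure at temperature $\alpha$, ergodic (with respect to spatial translations of $\mathbb{Z}^d$), with mean jump $\vec 0$ (the mean displacement $\sigma(x)-x$ under $\mu$ is $\vec0$); (iv) $\mu$ is the unique Gibbs measure for the specifications $G_\Lambda$ that is supported on the set of finite-cycle permutations of $\mathbb{Z}^d$.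
   Context: $S$ is the set of bijections $\sigma:\mathbb{Z}^d\to\mathbb{Z}^d$ with the product topology (generated by the sets $\{\sigma:\sigma(x)=y\}$) and Borel $\sigma$-algebra. For $\xi\in S$ and finite $\Lambda\subset\mathbb{Z}^d$, $S_{\Lambda|\xi}=\{\sigma\in S:\sigma(x)=\xi(x)\ \forall x\notin\Lambda\}$, and $S_\Lambda=S_{\Lambda|\mathrm{I}}$ with $\mathrm{I}$ the identity (for $\Lambda=\mathbb{Z}^d$, $S_{\mathbb{Z}^d}=S$). The Hamiltonian is $H_\Lambda(\sigma)=\sum_{x\in\Lambda}V(\sigma(x)-x)$, and for $\alpha>0$ the specification is $G_{\Lambda|\xi}(\sigma)=Z_{\Lambda|\xi}^{-1}\exp(-\alpha H_\Lambda(\sigma))$ for $\sigma\in S_{\Lambda|\xi}$, with $Z_{\Lambda|\xi}$ the normalizing constant; $G_\Lambda:=G_{\Lambda|\mathrm{I}}$. A probability measure $\mu$ on $S$ is a Gibbs measure at temperature $\alpha$ if for every finite $\Lambda$ and $\mu$-a.e. $\xi$, $\mu(\cdot\mid\sigma(x)=\xi(x),x\in\Lambda^c)=G_{\Lambda|\xi}$. A finite cycle of length $n\ge2$ on distinct sites $x_1,\dots,x_n$ is the permutation $\gamma$ with $\gamma(x_i)=x_{i+1}$ (indices mod $n$) and $\gamma(x)=x$ otherwise; its support is $\{\gamma\}=\{x_1,\dots,x_n\}$ and $|\gamma|=n$; infinite cycles are defined analogously with a doubly infinite sequence of distinct sites. Every permutation is a composition of disjoint cycles; it is finite-cycle if all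 these cycles are finite. $\Gamma$ is the set of finite cycles. The weight of $\gamma\in\Gamma$ is $w(\gamma)=\exp\{-\alpha\sum_{x\in\{\gamma\}}V(\gamma(x)-x)\}$, $\beta(V,\alpha)=\sum_{\gamma\in\Gamma,\ \vec0\in\{\gamma\}}|\gamma|\,w(\gamma)$, and $\alpha^*(V)=\inf\{\alpha:\beta(V,\alpha)<1\}$ (with $\alpha^*=\infty$ if $\beta(V,\alpha)=\infty$ for all $\alpha$). *)

(* Defs.v *)
From HB Require Import structures.
From mathcomp Require Import all_boot all_order all_algebra.
From mathcomp Require Import finmap.
From mathcomp Require Import all_classical all_reals all_analysis.
Import Order.TTheory GRing.Theory Num.Theory.

Set Implicit Arguments.
Unset Strict Implicit.
Unset Printing Implicit Defensive.

Local Open Scope classical_set_scope.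
Local Open Scope ring_scope.

Definition site (d : nat) := 'rV[int]_d.

(* Ambient configuration space: all maps Z^d -> Z^d.  The permutation space S
   is the (measurable) subset of bijections. *)
Definition config (d : nat) := site d -> site d.
HB.instance Definition _ d := Choice.on (config d).
HB.instance Definition _ d := isPointed.Build (config d) idfun.

(* Cylinder sets {sigma | sigma x = y}; they generate the Borel sigma-algebra
   of the product topology. *)
Definition cylinders (d : nat) : set (set (config d)) :=
  [set A | exists x y : site d, A = [set s : config d | s x = y]].

Definition Omega (d : nat) := g_sigma_algebraType (@cylinders d).

Definition outcyl (d : nat) (L : {fset site d}) : set (set (Omega d)) :=
  [set A | exists x y : site d, x \notin L /\ A = [set s : Omega d | s x = y]].

Definition Sperm (d : nat) : set (Omega d) := [set s | bijective s].

Definition SLx (d : nat) (L : {fset site d}) (xi : site d -> site d) : set (Omega d) :=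
  [set s | bijective s /\ forall x, x \notin L -> s x = xi x].

(* exp(-a h) for h in [0,+oo] (with exp(-a * +oo) = 0) *)
Definition expw (R : realType) (a : R) (h : \bar R) : R :=
  if h is r%:E then expR (- (a * r)) else 0.

Definition Ham (R : realType) (d : nat) (V : site d -> \bar R)
  (L : {fset site d}) (s : site d -> site d) : \bar R :=
  (\sum_(x <- enum_fset L) V (s x - x)%R)%E.

Definition wH (R : realType) (d : nat) (V : site d -> \bar R) (a : R)
  (L : {fset site d}) (s : site d -> site d) : R :=
  expw a (Ham V L s).

Definition Zpart (R : realType) (d : nat) (V : site d -> \bar R) (a : R)
  (L : {fset site d}) (xi : site d -> site d) : R :=
  \sum_(s \in SLx L xi) wH V a L s.

Definition Gspec (R : realType) (d : nat) (V : site d -> \bar R) (a : R)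
  (L : {fset site d}) (xi : site d -> site d) (A : set (Omega d)) : R :=
  (\sum_(s \in SLx L xi `&` A) wH V a L s) / Zpart V a L xi.

Definition Gint (R : realType) (d : nat) (V : site d -> \bar R) (a : R)
  (L : {fset site d}) (f : Omega d -> R) : R :=
  \sum_(s \in SLx L idfun) f s * Gspec V a L idfun [set s].

(* Gibbs measure (DLR condition): for every finite Lambda and event A,
   xi |-> G_{Lambda|xi}(A) is a version of the conditional probability
   mu(A | F_{Lambda^c}) *)
Definition Gibbs (R : realType) (d : nat) (V : site d -> \bar R) (a : R)
  (mu : probability (Omega d) R) : Prop :=
  mu (@Sperm d) = 1%E /\
  forall (L : {fset site d}) (A : set (Omega d)), measurable A ->
    (forall U : set R, measurable U ->
        <<s outcyl L >> ((fun xi => Gspec V a L xi A) @^-1` U)) /\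
    (forall B : set (Omega d), <<s outcyl L >> B ->
        mu (A `&` B) = (\int[mu]_(xi in B) (Gspec V a L xi A)%:E)%E).

Definition shift (d : nat) (z : site d) (s : Omega d) : Omega d :=
  fun x => s (x - z) + z.

Definition ergodic (R : realType) (d : nat) (mu : probability (Omega d) R) : Prop :=
  (forall (z : site d) (A : set (Omega d)), measurable A ->
      mu (shift z @^-1` A) = mu A) /\
  (forall A : set (Omega d), measurable A ->
      (forall z : site d, shift z @^-1` A = A) -> mu A = 0%E \/ mu A = 1%E).

Definition finite_cycle (d : nat) (s : Omega d) : Prop :=
  forall x, exists n : nat, (0 < n)%N /\ iter n s x = x.

Definition cycle_of (d : nat) (xs : seq (site d)) : site d -> site d :=
  fun x => if x \in xs then nth x xs ((index x xs).+1 %% size xs) else x.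

Definition Gamma0 (d : nat) : set (site d -> site d) :=
  [set g | exists xs : seq (site d),
      [/\ uniq xs, (2 <= size xs)%N, 0 \in xs & g = cycle_of xs]].

Definition supp (d : nat) (g : site d -> site d) : set (site d) :=
  [set x | g x != x].

Definition beta (R : realType) (d : nat) (V : site d -> \bar R) (a : R) : \bar R :=
  (\esum_(g in @Gamma0 d)
     ((\esum_(x in supp g) (1 : \bar R)) *
      (expw a (\big[adde/0%E]_(x \in supp g) V (g x - x)%R))%:E))%E.

Definition alpha_star (R : realType) (d : nat) (V : site d -> \bar R) : \bar R :=
  ereal_inf [set a%:E | a in [set a : R | 0 < a /\ (beta V a < 1)%E]].

Definition strictly_convex_pot (R : realType) (d : nat) (V : site d -> \bar R) : Prop :=
  exists f : 'rV[R]_d -> \bar R,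
    [/\ forall x : site d, V x = f (map_mx (fun z : int => z%:~R) x),
        forall u : 'rV[R]_d, f u != -oo%E,
        forall (u v : 'rV[R]_d) (t : R), 0 <= t <= 1 ->
          (f (t *: u + (1 - t) *: v)%R <= t%:E * f u + (1 - t)%:E * f v)%E &
        forall (u v : 'rV[R]_d) (t : R), u != v -> 0 < t < 1 -> (f u < +oo)%E -> (f v < +oo)%E ->
          (f (t *: u + (1 - t) *: v)%R < t%:E * f u + (1 - t)%:E * f v)%E].

(* continuity on S for the product topology (Z^d discrete) *)
Definition contS (R : realType) (d : nat) (f : Omega d -> R) : Prop :=
  forall s : Omega d, bijective s -> forall e : R, 0 < e ->
    exists F : {fset site d}, forall s' : Omega d, bijective s' ->
      (forall x, x \in F -> s' x = s x) -> `|f s' - f s| < e.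

(* Main.v *)
(* Write Z(L) for the partition function of the permutations of a finite set L and
   r(L, A) = Z(L \ A) / Z(L).  Splitting off the cycle through x gives
   1 / r(L, {x}) = 1 + sum of w(c) r(L \ {x}, c \ {x}) over the cycles c through x in L, a
   recursion that contracts because beta < 1.  Hence r(L, A) depends on L only near A, up to
   a small error, and converges to some rho(A) as L grows to Z^d.  If t permutes A, the finite
   volume probability of the pattern "s = t on A" is w(t) r(L, A), and large cycles are
   uniformly unlikely, so these patterns determine a limit law carried by the finite-cycle
   permutations.  Enumerating the patterns and taking quantiles of one uniform variable
   realizes all the finite volume laws so that almost surely each pattern indicator is
   eventually constant.

   The limit law gives the pattern (A, t) the weight w(t) rho(A).  Patterns generate the
   sigma-algebra on finite-cycle configurations, so the Gibbs property is a resampling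
   identity for patterns, and ergodicity follows from rho(A u (B + z)) -> rho(A) rho(B).  For
   uniqueness, condition a Gibbs measure on the largest invariant subset D of a finite set
   being a given set: this event is measurable outside D, and there the conditional
   probability of (A, t) is w(t) r(D, A).  Strict convexity bounds a jump by the length plus
   the energy of its cycle, which makes jumps integrable; the law is invariant under
   recentering at the image of a site, and averaging along cycles gives mean jump 0. *)
Require Import Defs.
From HB Require Import structures.
From mathcomp Require Import all_boot all_order all_algebra.
From mathcomp Require Import finmap.
From mathcomp Require Import all_classical all_reals all_analysis.
From mathcomp Require Import measurable_realfun lra zify.
Import Order.TTheory GRing.Theory Num.Theory.
Import numFieldNormedType.Exports.
Set Implicit Arguments.
Unset Strict Implicit.
Unset Printing Implicit Defensive.
Local Open Scope classical_set_scope.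
Local Open Scope ring_scope.

(** * Permutations of finite sets: agreement, gluing, orbits *)

Section FinitePermutations.
Variable d : nat.
Local Notation E := (site d).
Implicit Types (L A B : {fset E}) (s t : Omega d) (x y : E).

(** Convergence is demanded along the net of all finite volumes, so convergence in law is not enough
    and passing to a subsequence is not allowed. Quantiles of one [u] succeed because longer codes
    refine shorter ones: in every large volume the first n bits depend on [u] only through level-n
    distribution functions, which converge, and only countably many [u] have to be discarded for all
    volumes at once.

    The factor |gamma| in [beta] is the price of the contraction: the ratio attached to a cycle is a
    product of fewer than |gamma| one-point ratios, each bringing its own error.

    Under a general Gibbs measure cycles may cross the boundary of any fixed volume. Replacing the
    volume by its largest invariant subset restores identity boundary conditions, and this subset is
    large with high probability when all cycles are finite.

    [V] need be neither even nor finite, hence the symmetrization f(w) + f(-w) and the passage to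
    the span of its domain. Integrability of jumps uses a second parameter a0 < a with beta(a0) < 1:
    if H is the energy of the cycle, the spare factor exp(-(a - a0) H) absorbs the length of the
    jump. *)

Definition agree A s t : bool := all (fun x => s x == t x) (enum_fset A).

Lemma agreeP A s t : reflect (forall x, x \in A -> s x = t x) (agree A s t).
Proof.
apply: (iffP allP) => [h x xA|h x xA]; first by apply/eqP/h.
by apply/eqP/h.
Qed.

Lemma agreexx A s : agree A s s.
Proof. exact/agreeP. Qed.

Lemma agree_sym A s t : agree A s t = agree A t s.
Proof. by apply/agreeP/agreeP => h x /h. Qed.

Lemma agree_trans A s t u : agree A s t -> agree A t u -> agree A s u.
Proof. by move=> /agreeP h1 /agreeP h2; apply/agreeP => x xA; rewrite h1// h2. Qed.

Lemma agreeS A B s t : (A `<=` B)%fset -> agree B s t -> agree A s t.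
Proof. by move=> /fsubsetP AB /agreeP h; apply/agreeP => x /AB/h. Qed.

Lemma agreeU A B s t : agree (A `|` B)%fset s t = agree A s t && agree B s t.
Proof.
apply/agreeP/andP => [h|[/agreeP h1 /agreeP h2] x].
  by split; apply/agreeP => x xA; apply: h; rewrite in_fsetU xA ?orbT.
by rewrite in_fsetU => /orP[/h1|/h2].
Qed.

Lemma SLx_id_stable L s x : SLx L idfun s -> (s x \in L) = (x \in L).
Proof.
move=> [/bij_inj si h]; apply/idP/idP; apply: contraTT => xL; rewrite ?h//.
suff e : s x = x by rewrite -e.
by apply: si; rewrite (h _ xL).
Qed.

Definition glue L (f : E -> E) (g : E -> E) : Omega d := fun x => if x \in L then f x else g x.

Lemma finite_SLx_id L : finite_set (SLx L idfun).
Proof.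
pose ext (t : {ffun L -> L}) : Omega d :=
  fun x => if insub x is Some y then val (t y) else x.
apply: (@sub_finite_set _ _ (ext @` setT)); last exact/finite_image/finite_finset.
move=> s hs; pose f (y : L) : L := insubd y (s (val y)).
exists (finfun f) => //; apply/funext => x; rewrite /ext.
case: insubP => [y _ yx|xL].
  rewrite ffunE /f val_insubd -yx (SLx_id_stable _ hs).
  by rewrite (valP y).
by case: hs => _ ->.
Qed.

Definition SL L : {fset Omega d} := fset_set (SLx L idfun).

Lemma SLP L s : s \in SL L <-> bijective s /\ forall x, x \notin L -> s x = x.
Proof.
by rewrite /SL in_fset_set ?inE//; exact: finite_SLx_id.
Qed.

Lemma SL_bij L s : s \in SL L -> bijective s. Proof. by case/SLP. Qed.

Lemma SL_inj L s : s \in SL L -> injective s. Proof. by move/SL_bij/bij_inj. Qed.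

Lemma SL_out L s x : s \in SL L -> x \notin L -> s x = x.
Proof. by case/SLP => _ h /h. Qed.

Lemma SL_stable L s x : s \in SL L -> (s x \in L) = (x \in L).
Proof. by rewrite /SL in_fset_set ?inE; [exact: SLx_id_stable|exact: finite_SLx_id]. Qed.

Lemma SL_id L : (idfun : Omega d) \in SL L.
Proof. by apply/SLP; split=> //; exists idfun. Qed.

Lemma SL_comp L s t : s \in SL L -> t \in SL L -> (s \o t : Omega d) \in SL L.
Proof.
move=> sL tL; apply/SLP; split; first exact: (bij_comp (SL_bij sL) (SL_bij tL)).
by move=> x xL /=; rewrite (SL_out tL)// (SL_out sL).
Qed.

Lemma SLS A L : (A `<=` L)%fset -> {subset SL A <= SL L}.
Proof.
move=> /fsubsetP AL s /SLP[bs h]; apply/SLP; split => // x xL; apply: h.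
by apply: contra xL; exact: AL.
Qed.

Lemma SL_inv L s : s \in SL L -> exists2 t, t \in SL L & cancel s t /\ cancel t s.
Proof.
move=> sL; have /SLP[[t st ts] h] := sL; exists t => //; apply/SLP; split.
  by exists s.
by move=> x xL; apply: (SL_inj sL); rewrite ts h.
Qed.

Lemma eq_SL A s t : s \in SL A -> t \in SL A -> agree A s t -> s = t.
Proof.
move=> sA tA /agreeP h; apply/funext => x.
by have [/h//|xA] := boolP (x \in A); rewrite (SL_out sA) ?(SL_out tA).
Qed.

(** Pigeonhole in the finite set [A]. Nothing is assumed outside [A], so this applies to arbitrary
    configurations that satisfy a pattern. *)
Lemma stable_surj A s : {in A &, injective s} -> (forall x, x \in A -> s x \in A) ->
  forall y, y \in A -> exists2 x, x \in A & y = s x.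
Proof.
move=> si sA y yA.
suff : y \in [fset s x | x in A]%fset by case/imfsetP => x /= xA ->; exists x.
suff -> : [fset s x | x in A]%fset = A by [].
apply/eqP; rewrite eqEfcard; apply/andP; split.
  by apply/fsubsetP => z /imfsetP[x /= xA ->]; exact: sA.
by rewrite card_in_imfset.
Qed.

Lemma inj_surj_bij (T U : Type) (f : T -> U) :
  injective f -> (forall b : U, exists a : T, b = f a) -> bijective f.
Proof.
move=> fi fs; have [g hg] := choice fs.
by exists g => [a|b]; [apply: fi|]; rewrite -hg.
Qed.

Lemma glue_SL A s : {in A &, injective s} -> (forall x, x \in A -> s x \in A) ->
  glue A s idfun \in SL A.
Proof.
move=> si sA; apply/SLP; split; last by move=> x /negbTE xA; rewrite /glue xA.
apply: inj_surj_bij => [x y|y]; rewrite /glue.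
  case: ifPn => xA; case: ifPn => yA //= e; first exact: si.
  - by rewrite -e sA in yA.
  - by rewrite e sA in xA.
have [yA|yA] := boolP (y \in A); last by exists y; rewrite (negbTE yA).
by have [x xA ->] := stable_surj si sA yA; exists x; rewrite xA.
Qed.

Lemma agree_glue A s t : agree A (glue A s t) s.
Proof. by apply/agreeP => x xA; rewrite /glue xA. Qed.

Lemma agree_SL_inj A s t : t \in SL A -> agree A s t -> {in A &, injective s}.
Proof.
by move=> tA /agreeP h x y xA yA; rewrite !h//; exact: (SL_inj tA).
Qed.

Lemma agree_SL_stable A s t : t \in SL A -> agree A s t -> forall x, x \in A -> s x \in A.
Proof. by move=> tA /agreeP h x xA; rewrite h// (SL_stable _ tA). Qed.

Lemma agree_SL_stableN A s t x : injective s -> t \in SL A -> agree A s t ->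
  (s x \in A) = (x \in A).
Proof.
move=> si tA h; apply/idP/idP; last exact: agree_SL_stable h x.
move=> sxA; have [y yA] := stable_surj (agree_SL_inj tA h) (agree_SL_stable tA h) sxA.
by move=> /si ->.
Qed.

Lemma glueK_SL A L s t : (A `<=` L)%fset -> t \in SL A -> s \in SL L -> agree A s t ->
  glue A idfun s \in SL (L `\` A)%fset.
Proof.
move=> AL tA sL h; apply/SLP; split.
  apply: inj_surj_bij => [x y|y]; rewrite /glue.
    case: ifPn => xA; case: ifPn => yA //=.
    - by move=> e; rewrite e (agree_SL_stableN _ (SL_inj sL) tA h) (negbTE yA) in xA.
    - by move=> e; rewrite -e (agree_SL_stableN _ (SL_inj sL) tA h) (negbTE xA) in yA.
    - exact: (SL_inj sL).
  have [yA|yA] := boolP (y \in A); first by exists y; rewrite yA.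
  have [s' s'L [_ sK]] := SL_inv sL; exists (s' y).
  by rewrite -(agree_SL_stableN _ (SL_inj sL) tA h) sK (negbTE yA).
move=> x; rewrite in_fsetD negb_and negbK /glue => /orP[->//|xL].
by case: ifPn => // _; rewrite (SL_out sL).
Qed.

Lemma comp_glueK A L s t : (A `<=` L)%fset -> t \in SL A -> s \in SL L -> agree A s t ->
  (glue A idfun s \o t : Omega d) = s.
Proof.
move=> AL tA sL /agreeP h; apply/funext => x; rewrite /= /glue (SL_stable _ tA).
by case: ifPn => xA; [rewrite h | rewrite (SL_out tA)].
Qed.

(** Undoing [t] on [A] leaves an arbitrary permutation of the remaining sites; the inverse operation
    is composition with [t] on the right. *)
Lemma SL_agree_image A L t : (A `<=` L)%fset -> t \in SL A ->
  [fset s in SL L | agree A s t]%fset =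
  [fset ((s : Omega d) \o t : Omega d) | s in SL (L `\` A)%fset]%fset.
Proof.
move=> AL tA; apply/fsetP => s; rewrite !inE; apply/idP/imfsetP => /=.
  move=> /andP[sL h]; exists (glue A idfun s); first exact: glueK_SL h.
  by rewrite (comp_glueK AL tA sL h).
move=> [s' s'D ->]; apply/andP; split.
  by apply: SL_comp; [apply: SLS s'D; exact: fsubsetDl|exact: SLS tA].
apply/agreeP => x xA /=; rewrite (SL_out s'D)// in_fsetD negb_and negbK.
by rewrite (SL_stable _ tA) xA.
Qed.

(** Forward iterates suffice: an injective map of a finite invariant set returns to its starting
    point, so they exhaust the cycle. [orb] is meaningful only for finite orbits. *)
Definition orbS s x : set E := [set iter n s x | n in [set: nat]].
Definition orb s x : {fset E} := fset_set (orbS s x).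

Lemma iter_in A s x n : (forall y, y \in A -> s y \in A) -> x \in A -> iter n s x \in A.
Proof. by move=> h xA; elim: n => //= n; exact: h. Qed.

Lemma orbS_finite A s x : (forall y, y \in A -> s y \in A) -> x \in A ->
  finite_set (orbS s x).
Proof.
move=> h xA; apply: (@sub_finite_set _ _ [set` A]) => [y [n _ <-]|]; last exact: finite_fset.
exact: iter_in.
Qed.

Lemma orbP A s x y : (forall y, y \in A -> s y \in A) -> x \in A ->
  reflect (exists n, y = iter n s x) (y \in orb s x).
Proof.
move=> h xA; rewrite in_fset_set; last exact: orbS_finite h xA.
by apply: (iffP idP); rewrite inE => -[n]; [move=> _ <-; exists n|move->; exists n].
Qed.

Lemma orb_stable A s x : (forall y, y \in A -> s y \in A) -> x \in A ->
  forall y, y \in orb s x -> s y \in orb s x.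
Proof.
by move=> h xA y /(orbP _ h xA)[n ->]; apply/(orbP _ h xA); exists n.+1.
Qed.

Lemma orb_self A s x : (forall y, y \in A -> s y \in A) -> x \in A -> x \in orb s x.
Proof. by move=> h xA; apply/(orbP _ h xA); exists 0. Qed.

Lemma orb_sub A s x : (forall y, y \in A -> s y \in A) -> x \in A -> (orb s x `<=` A)%fset.
Proof. by move=> h xA; apply/fsubsetP => y /(orbP _ h xA)[n ->]; exact: iter_in. Qed.

Lemma orb_agree A s t x : t \in SL A -> agree A s t -> x \in A -> orb s x = orb t x.
Proof.
move=> tA h xA; rewrite /orb; congr fset_set; rewrite /orbS.
have e n : iter n s x = iter n t x.
  elim: n => //= n ->; move/agreeP: h; apply; apply: iter_in xA => y.
  by rewrite (SL_stable _ tA).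
by apply: eq_imagel => n _; rewrite e.
Qed.

Lemma restr_orb_SL s x A : injective s -> (forall y, y \in A -> s y \in A) -> x \in A ->
  glue (orb s x) s idfun \in SL (orb s x).
Proof.
move=> si h xA; apply: glue_SL; last exact: orb_stable h xA.
by move=> y z _ _; exact: si.
Qed.

Lemma orb_glue s x A : injective s -> (forall y, y \in A -> s y \in A) -> x \in A ->
  orb (glue (orb s x) s idfun) x = orb s x.
Proof.
move=> si h xA; apply/esym/(orb_agree (restr_orb_SL si h xA)).
  by rewrite agree_sym agree_glue.
exact: orb_self h xA.
Qed.

End FinitePermutations.

(** * Weights, partition functions and their factorization *)

Section PartitionFunction.
Variables (R : realType) (d : nat) (v : site d -> R).
Hypotheses (v_ge0 : forall x, 0 <= v x) (v_le1 : forall x, v x <= 1) (v0 : v 0 = 1).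
Local Notation E := (site d).
Implicit Types (L A B : {fset E}) (s t : Omega d) (x y : E).

Definition wt L s : R := \prod_(x <- enum_fset L) v (s x - x).
Definition Z L : R := \sum_(s <- SL L) wt L s.
(** Total weight of the permutations of [A] that consist of a single cycle through [x] covering [A];
    the fixed point [A = {x}] is included and has weight 1 ([cyc1]). *)
Definition cyc x A : R := \sum_(t <- SL A | orb t x == A) wt A t.

Lemma wt_ge0 L s : 0 <= wt L s. Proof. exact: prodr_ge0. Qed.

Lemma wt_le1 L s : wt L s <= 1.
Proof. by rewrite /wt; apply: prodr_ile1 => x _; rewrite v_ge0 v_le1. Qed.

Lemma wt_id L : wt L idfun = 1.
Proof. by rewrite /wt big1// => x _; rewrite subrr v0. Qed.

Lemma eq_wt L s t : agree L s t -> wt L s = wt L t.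
Proof. by move=> /agreeP h; rewrite /wt; apply: eq_big_seq => x /h ->. Qed.

Lemma wtU A L s : (A `<=` L)%fset -> wt L s = wt A s * wt (L `\` A)%fset s.
Proof.
move=> AL; rewrite /wt (big_fsetID _ [in A])/=; congr (_ * _).
  by apply: eq_fbigl => x; rewrite !inE andbC; apply/andb_idr/fsubsetP.
by apply: eq_fbigl => x; rewrite !inE andbC.
Qed.

Lemma Z_ge1 L : 1 <= Z L.
Proof.
rewrite /Z (big_fsetD1 _ (SL_id L))/= wt_id lerDl.
by apply: sumr_ge0 => s _; exact: wt_ge0.
Qed.

Lemma Z_gt0 L : 0 < Z L. Proof. exact: lt_le_trans (Z_ge1 L). Qed.

(** By [SL_agree_image] the sum runs over [s \o t] with [s] permuting [L] minus [A]. Such a product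
    has the values of [t] on [A] and those of [s] elsewhere, so its weight splits. *)
Lemma sum_SL_agree A L t : (A `<=` L)%fset -> t \in SL A ->
  \sum_(s <- SL L | agree A s t) wt L s = wt A t * Z (L `\` A)%fset.
Proof.
move=> AL tA.
have -> : \sum_(s <- SL L | agree A s t) wt L s =
    \sum_(s <- [fset s in SL L | agree A s t]%fset) wt L s.
  by rewrite [LHS]big_fset_condE; apply: eq_fbigl => s; rewrite !inE.
rewrite (SL_agree_image AL tA) big_imfset/=; last first.
  by move=> s s' _ _ e; have [t' _ [_ tK]] := SL_inv tA;
     apply/funext => x; rewrite -(tK x); exact: (congr1 (fun f => f (t' x)) e).
rewrite mulr_sumr; apply: eq_big_seq => s sD.
rewrite (wtU _ AL); congr (_ * _).
  apply: eq_wt; apply/agreeP => x xA /=; rewrite (SL_out sD)//.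
  by rewrite in_fsetD (SL_stable _ tA) xA.
apply: eq_wt; apply/agreeP => x; rewrite in_fsetD => /andP[xA _] /=.
by rewrite (SL_out tA).
Qed.

(** The permutations of [A] are those of [L] that fix the other sites, and [v 0 = 1] makes fixed
    sites free: they form one nonnegative part of the sum [Z L]. *)
Lemma Z_mono A L : (A `<=` L)%fset -> Z A <= Z L.
Proof.
move=> AL; have := @sum_SL_agree (L `\` A)%fset L idfun (fsubsetDl _ _) (SL_id _).
rewrite wt_id mul1r fsetDK// => <-.
rewrite [leRHS](bigID (fun s => agree (L `\` A)%fset s idfun))/= lerDl.
by apply: sumr_ge0 => s _; exact: wt_ge0.
Qed.

Lemma cyc_ge0 x A : 0 <= cyc x A.
Proof. by apply: sumr_ge0 => t _; exact: wt_ge0. Qed.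

(* Every finite permutation is split into its cycle through [x] and the rest; the same
   splitting restricted to the cycles satisfying [P]. *)
Lemma sum_SL_orb (P : pred {fset E}) L x : x \in L ->
  \sum_(s <- SL L | P (orb s x)) wt L s =
  \sum_(A <- fpowerset L | (x \in A) && P A) cyc x A * Z (L `\` A)%fset.
Proof.
move=> xL.
have -> : \sum_(A <- fpowerset L | (x \in A) && P A) cyc x A * Z (L `\` A)%fset =
  \sum_(A <- fpowerset L | (x \in A) && P A) \sum_(t <- SL A | orb t x == A)
    \sum_(s <- SL L | agree A s t) wt L s.
  rewrite big_seq_cond [RHS]big_seq_cond; apply: eq_bigr => A /andP[].
  rewrite fpowersetE => AL _.
  rewrite mulr_suml big_seq_cond [RHS]big_seq_cond; apply: eq_bigr => t /andP[tA _].
  by rewrite sum_SL_agree.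
rewrite [LHS]big_mkcond [LHS]big_seq; apply/esym.
transitivity (\sum_(A <- fpowerset L | (x \in A) && P A) \sum_(s <- SL L)
    \sum_(t <- SL A | orb t x == A) if agree A s t then wt L s else 0).
  apply: eq_bigr => A _; rewrite exchange_big/=.
  by apply: eq_bigr => t _; rewrite big_mkcond.
rewrite exchange_big/= big_seq; apply: eq_bigr => s sL.
have sst : forall y, y \in L -> s y \in L by move=> y; rewrite (SL_stable _ sL).
have oL := orb_sub sst xL; have xo := orb_self sst xL.
set t0 := glue (orb s x) s idfun.
have t0S : t0 \in SL (orb s x) := restr_orb_SL (SL_inj sL) sst xL.
(* Once the sums are exchanged, each [s] is counted by exactly one pair: the orbit of [x] and the
   restriction of [s] to it. *)
have key A t : x \in A -> t \in SL A -> orb t x == A -> agree A s t ->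
    A = orb s x /\ t = t0.
  move=> xA tA /eqP oA h; have e : A = orb s x by rewrite (orb_agree tA h xA).
  split=> //; apply: (eq_SL tA); first by rewrite e.
  by rewrite agree_sym in h; apply: (agree_trans h); rewrite agree_sym e agree_glue.
case: ifPn => Po.
  have oP : orb s x \in fpowerset L by rewrite fpowersetE.
  rewrite big_mkcond (big_fsetD1 _ oP)/= xo Po/= big_mkcond (big_fsetD1 _ t0S)/=.
  rewrite (orb_glue (SL_inj sL) sst xL) eqxx agree_sym agree_glue.
  rewrite big1_seq ?addr0; last first.
    move=> t /=; rewrite !inE => /andP[tt0 tS]; case: ifPn => // /key h.
    by case: ifPn => // /(h xo tS)[_] et; rewrite et eqxx in tt0.
  rewrite big1_seq ?addr0// => A /=; rewrite !inE => /andP[Ao AL].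
  case: ifPn => // /andP[xA _]; rewrite big1_seq// => t /andP[ot tS].
  by case: ifPn => // /(key _ _ xA tS ot)[eA _]; rewrite eA eqxx in Ao.
rewrite big1_seq// => A /andP[/andP[xA PA] AL]; rewrite big1_seq// => t /andP[ot tS].
by case: ifPn => // /(key _ _ xA tS ot)[eA _]; rewrite -eA PA in Po.
Qed.

Lemma cyc1 x : cyc x [fset x]%fset = 1.
Proof.
have h : SL [fset x]%fset = [fset (idfun : Omega d)]%fset.
  apply/fsetP => s; rewrite !inE; apply/idP/eqP => [sS|->]; last exact: SL_id.
  apply: (eq_SL sS (SL_id _)); apply/agreeP => y; rewrite inE => /eqP -> /=.
  by have := SL_stable x sS; rewrite !inE eqxx => /eqP.
have xx : forall y, y \in [fset x]%fset -> (idfun : Omega d) y \in [fset x]%fset by [].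
have ox : orb idfun x = [fset x]%fset.
  apply/eqP; rewrite eqEfsubset (orb_sub xx) ?inE//= fsub1set.
  by apply: (orb_self xx); rewrite inE.
by rewrite /cyc h big_mkcond big_seq_fset1 ox eqxx wt_id.
Qed.

End PartitionFunction.

(** * Limits along finite sets increasing to the whole space *)

Section Exhaustion.
Variable E : choiceType.

Definition fset_up : set_system {fset E} :=
  filter_from setT (fun L0 => [set L | (L0 `<=` L)%fset]).

Global Instance fset_up_filter : ProperFilter fset_up.
Proof.
apply: filter_from_proper; last by move=> L _; exists L => /=; exact: fsubset_refl.
apply: filter_from_filter; first by exists fset0.
move=> A B _ _; exists (A `|` B)%fset => // L /=.
by rewrite fsubUset => /andP[].
Qed.

Lemma near_fset_up (P : set {fset E}) :
  (\forall L \near fset_up, P L) <-> exists L0, forall L, (L0 `<=` L)%fset -> P L.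
Proof.
split; first by move=> [L0 _ h]; exists L0.
by move=> [L0 h]; exists L0.
Qed.

Lemma fset_up_mem (x : E) : \forall L \near fset_up, x \in L.
Proof. by apply/near_fset_up; exists [fset x]%fset => L; rewrite fsub1set. Qed.

Lemma fset_up_sub (A : {fset E}) : \forall L \near fset_up, (A `<=` L)%fset.
Proof. by apply/near_fset_up; exists A. Qed.

Lemma cauchy_fset_up (R : realType) (f : {fset E} -> R) :
  (forall e : R, 0 < e -> exists L0, forall L L', (L0 `<=` L)%fset -> (L0 `<=` L')%fset ->
     `|f L - f L'| <= e) ->
  cvg (f @ fset_up).
Proof.
move=> h; apply/cauchy_cvgP/cauchy_exP => e e0.
have [L0 hL0] := h (e / 2) (divr_gt0 e0 (ltr0n _ 2)).
exists (f L0); exists L0 => // L /= L0L; rewrite -ball_normE/=.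
apply: le_lt_trans (hL0 _ _ (fsubset_refl _) L0L) _; lra.
Qed.

End Exhaustion.

(** * Contraction of the one-point ratios and existence of [rho] *)

Section RatioContraction.
Variables (R : realType) (d : nat) (v : site d -> R).
Hypotheses (v_ge0 : forall x, 0 <= v x) (v_le1 : forall x, v x <= 1) (v0 : v 0 = 1).
Local Notation E := (site d).
Implicit Types (L M A B K U : {fset E}) (s t : Omega d) (x y : E).
Local Notation Z := (Z v).
Local Notation cyc := (cyc v).

Definition ratio L A : R := Z (L `\` A)%fset / Z L.

Lemma ratio_ge0 L A : 0 <= ratio L A.
Proof. by rewrite /ratio divr_ge0// ltW// Z_gt0. Qed.

Lemma ratio_le1 L A : ratio L A <= 1.
Proof. by rewrite /ratio ler_pdivrMr ?Z_gt0// mul1r Z_mono// fsubsetDl. Qed.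

Lemma ratioU L A B : ratio L (A `|` B)%fset = ratio L A * ratio (L `\` A)%fset B.
Proof.
by rewrite /ratio -fsetDDl [RHS]mulrC mulrA divfK ?lt0r_neq0 ?Z_gt0.
Qed.

Lemma ratio0 L : ratio L fset0 = 1.
Proof. by rewrite /ratio fsetD0 divff// lt0r_neq0 ?Z_gt0. Qed.

(** The fixed point is set apart: it supplies the constant 1 in the recursion, and only longer
    cycles enter [cycsum]. *)
Definition nontriv x A : bool := (x \in A) && (A != [fset x]%fset).

Definition cycsum L x : R :=
  \sum_(A <- fpowerset L | nontriv x A) cyc x A * (Z (L `\` A)%fset / Z (L `\ x)%fset).

Lemma cycsum_ge0 L x : 0 <= cycsum L x.
Proof.
apply: sumr_ge0 => A _; rewrite mulr_ge0 ?cyc_ge0// divr_ge0// ltW// Z_gt0//.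
Qed.

Lemma ratio1E L x : x \in L -> ratio L [fset x]%fset = (1 + cycsum L x)^-1.
Proof.
move=> xL; have Z0 := Z_gt0 v_ge0 v0 (L `\ x)%fset; have ZL := Z_gt0 v_ge0 v0 L.
suff -> : 1 + cycsum L x = Z L / Z (L `\ x)%fset by rewrite invf_div.
have := @sum_SL_orb R d v xpredT L x xL.
rewrite [RHS](eq_bigl (fun A => x \in A)) => [|A]; last by rewrite andbT.
have x1 : [fset x]%fset \in fpowerset L by rewrite fpowersetE fsub1set.
rewrite -/(Z L) big_mkcond (big_fsetD1 _ x1)/= fset11 cyc1// mul1r => ->.
rewrite mulrDl divff ?lt0r_neq0//; congr (_ + _).
rewrite /cycsum big_mkcond (big_fsetD1 _ x1)/= /nontriv eqxx andbF add0r.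
rewrite mulr_suml; apply: eq_big_seq => A; rewrite in_fsetD1 => /andP[-> _].
by rewrite andbT; case: ifP; rewrite ?mul0r// mulrA.
Qed.

(** The difference is (b - a) / ((1 + a)(1 + b)), with a denominator at least 1. So inverting
    [1 + cycsum] does not expand errors. *)
Lemma inv1p_dist (a b : R) : 0 <= a -> 0 <= b -> `|(1 + a)^-1 - (1 + b)^-1| <= `|a - b|.
Proof.
move=> a0 b0; have a1 : 1 + a != 0 by lra.
have b1 : 1 + b != 0 by lra.
have -> : (1 + a)^-1 - (1 + b)^-1 = (b - a) * ((1 + a) * (1 + b))^-1.
  have ha : (1 + a) * (1 + a)^-1 = 1 by rewrite divff.
  have hb : (1 + b) * (1 + b)^-1 = 1 by rewrite divff.
  rewrite invfM; set u := (1 + a)^-1 in ha *; set w := (1 + b)^-1 in hb *.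
  transitivity (((1 + b) * w) * u - ((1 + a) * u) * w); first by rewrite ha hb !mul1r.
  lra.
rewrite normrM distrC ler_piMr// ger0_norm ?invr_ge0 ?mulr_ge0 ?addr_ge0//.
by rewrite invf_le1 ?mulr_gt0 ?ltr_wpDr//; nra.
Qed.

(** [K] is a set of displacements rather than of sites, so that one window serves every [x]. *)
Definition same_near K L M x : Prop := forall k, k \in K -> (x + k \in L) = (x + k \in M).

(** [ratioU] turns [ratio L A] into a product of one-point ratios in [[0, 1]], taken in volumes from
    which sites are removed one at a time. Exchanging the factors one by one costs [e] each; the
    same sites are removed from [L] and [M], so the two volumes stay equal near the remaining
    ones. *)
Lemma ratio_telescope K (e : R) : 0 <= e ->
  (forall L M x, x \in L -> x \in M -> same_near K L M x ->
     `|ratio L [fset x]%fset - ratio M [fset x]%fset| <= e) ->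
  forall A L M, (A `<=` L)%fset -> (A `<=` M)%fset -> {in A, forall x, same_near K L M x} ->
     `|ratio L A - ratio M A| <= #|` A|%:R * e.
Proof.
move=> e0 h A; move: {2}(#|` A|) (leqnn #|` A|) => n; elim: n A => [|n IH] A.
  rewrite leqn0 cardfs_eq0 => /eqP -> L M _ _ _.
  by rewrite !ratio0 subrr normr0 cardfs0 mul0r.
move=> An L M AL AM hA.
have [->|/fset0Pn[x xA]] := eqVneq A fset0.
  by rewrite !ratio0 subrr normr0 cardfs0 mul0r.
have xL : x \in L by apply/(fsubsetP AL).
have xM : x \in M by apply/(fsubsetP AM).
rewrite -(fsetD1K xA) !ratioU cardfsU1 in_fsetD1 eqxx/= natrD mulrDl mul1r.
set a := ratio L _; set a' := ratio M _; set r := ratio _ _; set r' := ratio _ _.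
have -> : a * r - a' * r' = (a - a') * r + a' * (r - r') by rewrite mulrBl mulrBr; lra.
apply: (le_trans (ler_normD _ _)); rewrite (normrM (a - a')) (normrM a'); apply: lerD.
  rewrite (le_trans _ (h L M x xL xM (hA _ xA)))// ler_piMr//.
  by rewrite ger0_norm ?ratio_ge0 ?ratio_le1.
have a'1 : `|a'| <= 1 by rewrite ger0_norm ?ratio_ge0 ?ratio_le1.
apply: (@le_trans _ _ `|r - r'|); first by rewrite ler_piMl.
apply: IH.
- by move: An; rewrite (cardfsD1 x) xA add1n ltnS.
- by apply: fsetSD.
- by apply: fsetSD.
- move=> y; rewrite in_fsetD1 => /andP[_ yA] k kK.
  by rewrite !in_fsetD1 (hA y yA k kK).
Qed.

Variable b : R.
Hypotheses (b_ge0 : 0 <= b) (b_lt1 : b < 1).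
Hypothesis cyc_bound : forall x U,
  \sum_(A <- fpowerset U | nontriv x A) #|` A|%:R * cyc x A <= b.
Definition within x K A : bool := all (fun y => y - x \in K) (enum_fset A).
Hypothesis cyc_tail : forall e : R, 0 < e -> exists K, forall x U,
  \sum_(A <- fpowerset U | nontriv x A && ~~ within x K A) cyc x A <= e.

Lemma withinP x K A : reflect (forall y, y \in A -> y - x \in K) (within x K A).
Proof. exact: allP. Qed.

(** Besides the sums, [K] itself is kept: two volumes must contain the same cycles inside the window
    even if [K'] lacks 0, as in the base case where it is empty. *)
Definition fsum K K' : {fset E} := ([fset (x + y)%R | x in K, y in K'] `|` K)%fset.

Lemma fsumP K K' x y : x \in K -> y \in K' -> x + y \in fsum K K'.
Proof.
by move=> xK yK; rewrite in_fsetU; apply/orP; left; apply/imfset2P; exists x => //; exists y.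
Qed.

(** Extension by 0 to sets not inside [L], so that the cycle sums for two volumes can be compared
    term by term over subsets of their union. *)
Definition cycrat L x A : R :=
  if (A `<=` L)%fset then Z (L `\` A)%fset / Z (L `\ x)%fset else 0.

Lemma cycsumE L U x : (L `<=` U)%fset ->
  cycsum L x = \sum_(A <- fpowerset U | nontriv x A) cyc x A * cycrat L x A.
Proof.
move=> LU; rewrite /cycsum.
transitivity (\sum_(A <- fpowerset L | nontriv x A) cyc x A * cycrat L x A).
  rewrite big_seq_cond [RHS]big_seq_cond; apply: eq_bigr => A /andP[].
  by rewrite fpowersetE /cycrat => ->.
rewrite big_mkcond [RHS]big_mkcond/=; apply: big_fset_incl; first by rewrite fpowersetS.
move=> A _; rewrite fpowersetE /cycrat => /negbTE ->.
by rewrite mulr0 if_same.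
Qed.

Lemma cycrat_01 L x A : x \in A -> 0 <= cycrat L x A <= 1.
Proof.
move=> xA; rewrite /cycrat; case: ifP => AL; last by rewrite lexx ler01.
apply/andP; split; first by rewrite divr_ge0// ltW// Z_gt0.
rewrite ler_pdivrMr ?Z_gt0// mul1r Z_mono//.
by apply: fsetDS; rewrite fsub1set.
Qed.

(** The cycle lies inside the window, so it fits in [L] exactly when it fits in [M]. Both terms are
    then ratios for [A] minus [x] in the volume minus [x], and telescoping applies. *)
Lemma cycrat_close K K' (e : R) x A L M : 0 <= e ->
  (forall L M x, x \in L -> x \in M -> same_near K' L M x ->
     `|ratio L [fset x]%fset - ratio M [fset x]%fset| <= e) ->
  nontriv x A -> within x K A -> same_near (fsum K K') L M x ->
  `|cycrat L x A - cycrat M x A| <= #|` A|%:R * e.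
Proof.
move=> e0 h /andP[xA _] /withinP AK hn.
have hA y : y \in A -> (y \in L) = (y \in M).
  move=> yA; have := hn (y - x); rewrite [x + _]addrC subrK; apply.
  by rewrite in_fsetU AK ?orbT.
have -> : cycrat M x A = if (A `<=` L)%fset then Z (M `\` A)%fset / Z (M `\ x)%fset else 0.
  rewrite /cycrat; suff -> : (A `<=` M)%fset = (A `<=` L)%fset by [].
  by apply/fsubsetP/fsubsetP => s y yA; have := s y yA; rewrite hA.
rewrite /cycrat; case: ifP => AL; last by rewrite subrr normr0 mulr_ge0.
have xL : x \in L := fsubsetP AL x xA.
have xM : x \in M by rewrite -hA.
have rE N : ratio (N `\ x)%fset (A `\ x)%fset = Z (N `\` A)%fset / Z (N `\ x)%fset.
  by rewrite /ratio fsetDDl fsetD1K.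
rewrite -!rE.
apply: (@le_trans _ _ (#|` (A `\ x)%fset|%:R * e)).
  apply: (ratio_telescope e0 h).
  - exact: fsetSD.
  - by apply: fsetSD; apply/fsubsetP => y yA; rewrite -hA// (fsubsetP AL).
  - move=> y; rewrite in_fsetD1 => /andP[_ yA] k kK; rewrite !in_fsetD1.
    have := hn ((y - x) + k); rewrite addrA [x + _]addrC subrK => ->//.
    by apply: fsumP => //; exact: AK.
by rewrite ler_wpM2r// ler_nat fsubset_leq_card// fsubD1set.
Qed.

Lemma cycsum_dist K K' (e e1 : R) x L M : 0 <= e ->
  (forall L M x, x \in L -> x \in M -> same_near K' L M x ->
     `|ratio L [fset x]%fset - ratio M [fset x]%fset| <= e) ->
  (forall x U, \sum_(A <- fpowerset U | nontriv x A && ~~ within x K A) cyc x A <= e1) ->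
  same_near (fsum K K') L M x ->
  `|cycsum L x - cycsum M x| <= b * e + e1.
Proof.
move=> e0 h hK hn; set U := (L `|` M)%fset.
rewrite (@cycsumE L U) ?fsubsetUl// (@cycsumE M U) ?fsubsetUr// -sumrB.
apply: (le_trans (ler_norm_sum _ _ _)).
apply: (@le_trans _ _ (\sum_(A <- fpowerset U | nontriv x A)
   (#|` A|%:R * cyc x A * e + if ~~ within x K A then cyc x A else 0))).
  apply: ler_sum => A nA; rewrite -mulrBr normrM ger0_norm ?cyc_ge0//.
  have [xA _] := andP nA.
  case: ifPn => [_|/negPn wA].
    apply: (@le_trans _ _ (cyc x A)); last by rewrite lerDr !mulr_ge0 ?cyc_ge0.
    rewrite ler_piMr ?cyc_ge0//.
    by have := cycrat_01 L xA; have := cycrat_01 M xA; rewrite ler_norml; lra.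
  rewrite addr0 [_%:R * _]mulrC -mulrA ler_wpM2l ?cyc_ge0//.
  exact: (cycrat_close e0 h nA wA hn).
rewrite big_split/= -mulr_suml; apply: lerD; first by rewrite ler_wpM2r.
by rewrite -big_mkcondr/=.
Qed.

(* The recursion for the one-point ratios contracts by the factor [b < 1], up to the
   weight of the cycles leaving a finite window. *)
Lemma ratio1_close (e : R) : 0 < e -> exists K, forall L M x, x \in L -> x \in M ->
  same_near K L M x -> `|ratio L [fset x]%fset - ratio M [fset x]%fset| <= e.
Proof.
(* The tail is chosen so that [e / 2] is the fixed point of the error recursion: b (b^n + e/2) + (1
   - b) e/2 = b^(n+1) + e/2. *)
move=> e0; have e1 : 0 < (1 - b) * (e / 2) by rewrite mulr_gt0 ?subr_gt0 ?divr_gt0.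
have [K hK] := cyc_tail e1.
suff claim n : exists K', forall L M x, x \in L -> x \in M ->
    same_near K' L M x ->
    `|ratio L [fset x]%fset - ratio M [fset x]%fset| <= b ^+ n + e / 2.
  have bn1 : `|b| < 1 by rewrite ger0_norm.
  have /cvgrPdist_le/(_ (e / 2)) := cvg_expr bn1.
  rewrite divr_gt0// => /(_ isT)[n _ /(_ n (leqnn n))/=].
  rewrite sub0r normrN ger0_norm ?exprn_ge0// => bn.
  have [K' hK'] := claim n; exists K' => L M x xL xM hn.
  by apply: (le_trans (hK' _ _ _ xL xM hn)); lra.
elim: n => [|n [K' hK']].
  exists fset0 => L M x _ _ _; rewrite expr0.
  have := ratio_ge0 L [fset x]%fset; have := ratio_le1 L [fset x]%fset.
  have := ratio_ge0 M [fset x]%fset; have := ratio_le1 M [fset x]%fset.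
  by rewrite ler_norml; lra.
exists (fsum K K') => L M x xL xM hn.
rewrite !ratio1E//; apply: (le_trans (inv1p_dist _ _)); rewrite ?cycsum_ge0//.
have be : 0 <= b ^+ n + e / 2 by rewrite addr_ge0 ?exprn_ge0 ?divr_ge0// ltW.
apply: (le_trans (cycsum_dist be hK' hK hn)).
by rewrite exprS; lra.
Qed.

Lemma ratio_close A (e : R) : 0 < e -> exists K, forall L M, (A `<=` L)%fset -> (A `<=` M)%fset ->
  {in A, forall x, same_near K L M x} -> `|ratio L A - ratio M A| <= e.
Proof.
move=> e0; have e1 : 0 < e / (#|` A|%:R + 1) by rewrite divr_gt0// ltr_wpDl.
have [K hK] := ratio1_close e1; exists K => L M AL AM hn.
apply: (le_trans (ratio_telescope (ltW e1) hK AL AM hn)).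
rewrite mulrA ler_pdivrMr; last by rewrite ltr_wpDl.
by rewrite mulrC ler_wpM2l ?ltW// ltrDl.
Qed.

Lemma ratio_cvg A : cvg (ratio L A @[L --> @fset_up E]).
Proof.
apply: cauchy_fset_up => e e0; have [K hK] := ratio_close A e0.
exists (A `|` [fset (x + k)%R | x in A, k in K])%fset => L M.
rewrite !fsubUset => /andP[AL KL] /andP[AM KM]; apply: hK => // x xA k kK.
have xk : x + k \in [fset (x + k)%R | x in A, k in K]%fset.
  by apply/imfset2P; exists x => //; exists k.
by rewrite (fsubsetP KL)// (fsubsetP KM).
Qed.

Definition rho A : R := lim (ratio L A @[L --> @fset_up E]).

Lemma cvg_ratio A : ratio L A @[L --> @fset_up E] --> rho A.
Proof. exact: ratio_cvg. Qed.

End RatioContraction.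

(** * Translations of sets, permutations and weights *)

Section Translations.
Variable d : nat.
Local Notation shift := (@Defs.shift d).
Local Notation E := (site d).
Implicit Types (L A B : {fset E}) (s t : Omega d) (x y z : E).

Definition tr z A : {fset E} := [fset (y + z)%R | y in A]%fset.

Lemma in_tr z A y : (y \in tr z A) = (y - z \in A).
Proof.
apply/imfsetP/idP => [[w /= wA ->]|yA]; first by rewrite addrK.
by exists (y - z) => //; rewrite subrK.
Qed.

Lemma trK z : cancel (tr z) (tr (- z)).
Proof. by move=> A; apply/fsetP => y; rewrite !in_tr opprK addrK. Qed.

Lemma trNK z : cancel (tr (- z)) (tr z).
Proof. by move=> A; apply/fsetP => y; rewrite !in_tr opprK subrK. Qed.

Lemma tr_inj z : injective (tr z). Proof. exact: can_inj (trK z). Qed.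

Lemma card_tr z A : #|` tr z A| = #|` A|.
Proof. by rewrite card_imfset//; exact: addIr. Qed.

Lemma tr1 z x : tr z [fset x]%fset = [fset (x + z)%R]%fset.
Proof. by apply/fsetP => y; rewrite in_tr !inE subr_eq. Qed.

Lemma tr_sub z A B : (tr z A `<=` tr z B)%fset = (A `<=` B)%fset.
Proof.
apply/fsubsetP/fsubsetP => h y; last by rewrite !in_tr; exact: h.
by have := h (y + z); rewrite !in_tr addrK.
Qed.

Lemma trD z A B : tr z (A `\` B)%fset = (tr z A `\` tr z B)%fset.
Proof. by apply/fsetP => y; rewrite !(in_tr, in_fsetD). Qed.

Lemma shiftK z : cancel (shift z) (shift (- z)).
Proof. by move=> s; apply/funext => x; rewrite /shift opprK !addrK. Qed.

Lemma shiftNK z : cancel (shift (- z)) (shift z).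
Proof. by move=> s; apply/funext => x; rewrite /shift opprK !subrK. Qed.

Lemma shift_SL z A t : t \in SL A -> shift z t \in SL (tr z A).
Proof.
move=> tA; have [t' t'A [tK t'K]] := SL_inv tA; apply/SLP; split.
  by exists (shift z t') => x; rewrite /shift addrK ?tK ?t'K subrK.
by move=> x; rewrite in_tr /shift => xA; rewrite (SL_out tA)// subrK.
Qed.

Lemma agree_shift z A s t : agree (tr z A) (shift z s) (shift z t) = agree A s t.
Proof.
apply/agreeP/agreeP => h x; last by rewrite in_tr /shift => /h ->.
by have := h (x + z); rewrite in_tr /shift addrK => /[apply] /addIr.
Qed.

Lemma iter_shift z s x n : iter n (shift z s) (x + z) = iter n s x + z.
Proof. by elim: n => //= n ->; rewrite /shift addrK. Qed.

Lemma orb_shift z A t x : t \in SL A -> x \in A -> orb (shift z t) (x + z) = tr z (orb t x).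
Proof.
move=> tA xA; have st y : y \in A -> t y \in A by rewrite (SL_stable _ tA).
have st' y : y \in tr z A -> shift z t y \in tr z A.
  by rewrite (SL_stable _ (shift_SL z tA)).
have xA' : x + z \in tr z A by rewrite in_tr addrK.
apply/fsetP => y; rewrite in_tr; apply/(orbP _ st' xA')/(orbP _ st xA) => -[n].
  by rewrite iter_shift => ->; exists n; rewrite addrK.
by move=> e; exists n; rewrite iter_shift -e subrK.
Qed.

Lemma SL_tr z A : SL (tr z A) = [fset shift z t | t in SL A]%fset.
Proof.
apply/fsetP => s; apply/idP/imfsetP => [sA|[t /= tA ->]]; last exact: shift_SL.
exists (shift (- z) s); rewrite ?shiftNK//=.
by rewrite -(trK z A); exact: shift_SL.
Qed.

Variables (R : realType) (v : E -> R).

Lemma wt_shift z A s : wt v (tr z A) (shift z s) = wt v A s.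
Proof.
rewrite /wt big_imfset/=; last by move=> x y _ _; exact: addIr.
by apply: eq_bigr => x _; rewrite /shift addrK opprD addrACA subrr addr0.
Qed.

Lemma Z_tr z A : Z v (tr z A) = Z v A.
Proof.
rewrite /Z SL_tr big_imfset/=; last by move=> s t _ _; apply: can_inj (shiftK z) s t.
by apply: eq_bigr => s _; exact: wt_shift.
Qed.

End Translations.

(** * Single-cycle permutations and their description by lists *)

Section CyclicPermutations.
Variable d : nat.
Local Notation E := (site d).
Implicit Types (L A B U : {fset E}) (s t : Omega d) (x y z : E).

Lemma orb_traject A t x : t \in SL A -> x \in A -> orb t x = A -> exists n,
  [/\ (0 < n)%N, uniq (traject t x n), A =i traject t x n & iter n t x = x].
Proof.
move=> tA xA oA; have st y : y \in A -> t y \in A by rewrite (SL_stable _ tA).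
have ex : exists n, looping t x n.
  exists #|` A|; apply/negPn/negP; rewrite -looping_uniq => u.
  have /(uniq_leq_size u) : {subset traject t x #|` A|.+1 <= A}.
    by move=> y /trajectP[k _ ->]; exact: iter_in.
  by rewrite size_traject ltnn.
have [n ln nmin] := find_ex_minn ex.
have n0 : (0 < n)%N by case: n ln {nmin} => //; rewrite /looping.
have u : uniq (traject t x n).
  case: n n0 ln nmin => // n _ _ nmin; rewrite looping_uniq.
  by apply/negP => /nmin; rewrite ltnn.
exists n; split => //.
  move=> y; rewrite -oA; apply/(orbP _ st xA)/idP => [[k ->]|].
    by move/loopingP: ln; apply.
  by case/trajectP => k _ ->; exists k.
(* The first return is to [x] itself: a return to a later point would give, after cancelling [t], a
   shorter loop. *)
have /trajectP[[|k] kn e] : iter n t x \in traject t x n by exact: ln.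
  exact: e.
case: n n0 ln nmin u kn e => // n _ ln nmin u kn /= /(SL_inj tA) e.
have : looping t x n by apply/trajectP; exists k.
by move/nmin; rewrite ltnn.
Qed.

Lemma orb_cycle_of A t x : t \in SL A -> x \in A -> orb t x = A -> A != [fset x]%fset ->
  exists xs, [/\ uniq xs, (2 <= size xs)%N, x \in xs & t = cycle_of xs].
Proof.
move=> tA xA oA A1; have [n [n0 u An tn]] := orb_traject tA xA oA.
exists (traject t x n); split => //; last first.
- apply/funext => y; rewrite /cycle_of size_traject; case: ifPn => yn; last first.
    by rewrite (SL_out tA)// An.
  case/trajectP : (yn) => k kn ->.
  have -> : index (iter k t x) (traject t x n) = k.
    by rewrite -{1}(nth_traject t kn x) index_uniq ?size_traject.
  have := kn; rewrite leq_eqVlt => /orP[/eqP e|k1n].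
    by rewrite -e modnn /= -iterS e.
  by rewrite modn_small// (set_nth_default x) ?size_traject// nth_traject.
- by rewrite -An.
rewrite size_traject; case: n n0 u An tn => [//|[|//]] _ _ An _.
by case/eqP: A1; apply/fsetP => y; rewrite An !inE.
Qed.

Lemma supp_orb A t x : t \in SL A -> x \in A -> orb t x = A -> A != [fset x]%fset ->
  supp t = [set` A].
Proof.
move=> tA xA oA A1; have st y : y \in A -> t y \in A by rewrite (SL_stable _ tA).
apply/seteqP; split => y /=; rewrite /supp/=.
  by apply: contraNT => yA; rewrite (SL_out tA).
rewrite -{1}oA => /(orbP _ st xA)[k ->]; apply: contra A1 => /eqP.
rewrite -iterS iterSr => e; apply/eqP.
have tx : t x = x by elim: k e => // k IH /= /(SL_inj tA).
apply/fsetP => y'; rewrite -oA !inE; apply/(orbP _ st xA)/eqP => [[n ->]|->]; last by exists 0.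
by elim: n => //= n ->.
Qed.

(** A cyclic permutation determines its support as the orbit of [x], so a sum over pairs [(A, t)] is
    a sum over [t] alone. This is the form in which it can be compared with [beta]. *)
Lemma sum_cyc_pairs (R : realType) (P : pred {fset E}) x U (F : Omega d -> R) :
  \sum_(A <- fpowerset U | P A) \sum_(t <- SL A | orb t x == A) F t =
  \sum_(t <- SL U | [&& P (orb t x), (orb t x `<=` U)%fset & t \in SL (orb t x)]) F t.
Proof.
transitivity (\sum_(A <- fpowerset U | P A)
    \sum_(t <- SL U) if (t \in SL A) && (orb t x == A) then F t else 0).
  rewrite big_seq_cond [RHS]big_seq_cond; apply: eq_bigr => A /andP[].
  rewrite fpowersetE => AU _; rewrite big_mkcond/=.
  rewrite -(@big_fset_incl _ _ _ _ (SL A) (SL U)) => [||t _ tA].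
  - by apply: eq_big_seq => t ->.
  - by apply/fsubsetP; exact: SLS.
  - by rewrite (negbTE tA).
rewrite exchange_big/= [RHS]big_mkcond/=; apply: eq_bigr => t _.
case: ifPn => [/and3P[Po oU to]|h].
  have oP : orb t x \in fpowerset U by rewrite fpowersetE.
  rewrite big_mkcond (big_fsetD1 _ oP)/= Po to eqxx/= big1_seq ?addr0// => A.
  rewrite in_fsetD1 => /andP[_ /andP[Ao _]]; case: ifP => // _.
  by rewrite [orb t x == A]eq_sym (negbTE Ao) andbF.
rewrite big1_seq// => A /andP[PA]; rewrite fpowersetE => AU; case: ifP => // /andP[tA /eqP oA].
by move: h; rewrite oA PA AU tA.
Qed.

End CyclicPermutations.

(** * Cycle sums bounded by [beta] *)

Section Beta.
Variables (R : realType) (d : nat) (V : site d -> \bar R) (a : R).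
Hypotheses (V_ge0 : forall x, (0 <= V x)%E) (V0 : V 0 = 0%E) (a_gt0 : 0 < a).
Local Notation shift := (@Defs.shift d).
Local Notation E := (site d).
Implicit Types (L A B U : {fset E}) (s t : Omega d) (x y z : E).

Lemma expw_ge0 (h : \bar R) : 0 <= expw a h.
Proof. by case: h => [r||] //=; exact: expR_ge0. Qed.

Lemma expw_le1 (h : \bar R) : (0 <= h)%E -> expw a h <= 1.
Proof.
case: h => [r|_|//] /=; last exact: ler01.
by rewrite lee_fin => r0; rewrite expR_le1 oppr_le0 mulr_ge0// ltW.
Qed.

Lemma expwD (h k : \bar R) : (0 <= h)%E -> (0 <= k)%E -> expw a (h + k)%E = expw a h * expw a k.
Proof.
by case: h k => [r||] [q||]//= _ _; rewrite ?mulr0 ?mul0r// -expRD mulrDr opprD.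
Qed.

Lemma expw_sum (I : Type) (r : seq I) (h : I -> \bar R) : (forall i, (0 <= h i)%E) ->
  expw a (\sum_(i <- r) h i)%E = \prod_(i <- r) expw a (h i).
Proof.
move=> h0; elim: r => [|i r IH]; first by rewrite !big_nil/= mulr0 oppr0 expR0.
by rewrite !big_cons expwD ?IH// sume_ge0.
Qed.

Definition bw x : R := expw a (V x).

Lemma bw_ge0 x : 0 <= bw x. Proof. exact: expw_ge0. Qed.
Lemma bw_le1 x : bw x <= 1. Proof. exact: expw_le1. Qed.
Lemma bw0 : bw 0 = 1. Proof. by rewrite /bw V0/= mulr0 oppr0 expR0. Qed.

Lemma wHE L s : wH V a L s = wt bw L s.
Proof. by rewrite /wH /Ham expw_sum. Qed.

Definition cycle_term (g : E -> E) : \bar R :=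
  ((\esum_(x in supp g) (1 : \bar R)) *
   (expw a (\big[adde/0%E]_(x \in supp g) V (g x - x)%R))%:E)%E.

Lemma cycle_termE A t : supp t = [set` A] -> cycle_term t = (#|` A|%:R * wt bw A t)%:E.
Proof.
move=> h; rewrite /cycle_term h esum_fset//; rewrite fsbig_finite// set_fsetK.
have -> : \big[adde/0%E]_(x \in [set` A]) V (t x - x) = (\sum_(x <- A) V (t x - x)%R)%E.
  transitivity (\sum_(x \in [set` A]) V (t x - x)%R)%E; first by [].
  by rewrite fsbig_finite// set_fsetK.
rewrite sumEFin -EFinM expw_sum//; congr ((_ * _)%:E).
by rewrite card_fset_sum1 natr_sum.
Qed.

Lemma cycle_term_ge0 g : (0 <= cycle_term g)%E.
Proof. by rewrite mule_ge0// ?esum_ge0// lee_fin expw_ge0. Qed.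

Lemma betaE : beta V a = @esum R (Omega d) (@Gamma0 d) cycle_term.
Proof. by []. Qed.

Lemma sum_le_beta (X : {fset Omega d}) : (forall g, g \in X -> Gamma0 g) ->
  (\sum_(g <- X) cycle_term g <= beta V a)%E.
Proof.
move=> XG; rewrite betaE; apply: esum_ge; exists [set` X].
  by split=> // g /=; exact: XG.
by rewrite fsbig_finite// set_fsetK.
Qed.

(** A finite [X] comes within [e] of the supremum defining [beta]. A finite family disjoint from [X]
    can be added to it without exceeding [beta], so its own sum is at most [e]. *)
Lemma beta_tail (e : R) : (beta V a < +oo)%E -> 0 < e -> exists X : {fset Omega d},
  (forall g, g \in X -> Gamma0 g) /\
  forall Y : {fset Omega d}, (forall g, g \in Y -> Gamma0 g /\ g \notin X) ->
    (\sum_(g <- Y) cycle_term g <= e%:E)%E.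
Proof.
move=> boo e0; have bfin : beta V a \is a fin_num.
  rewrite ge0_fin_numE// betaE esum_ge0// => g _; exact: cycle_term_ge0.
have [_ [X [Xf XG] <-]] := ub_ereal_sup_adherent e0 bfin.
rewrite -/(esum _ _) -betaE fsbig_finite// => hX.
exists (fset_set X); split => [g|Y hY]; first by rewrite in_fset_set// inE => /XG.
have XfG (g : Omega d) : g \in fset_set X -> Gamma0 g by rewrite in_fset_set// inE => /XG.
have := @sum_le_beta (Y `|` fset_set X)%fset.
rewrite (big_fsetID _ [in Y])/=.
have -> : [fset g in (Y `|` fset_set X)%fset | g \in Y]%fset = Y.
  by apply/fsetP => g; rewrite !inE andb_orl andbb; case: (g \in Y); rewrite ?andbF.
have -> : [fset g in (Y `|` fset_set X)%fset | g \notin Y]%fset = fset_set X.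
  apply/fsetP => g; rewrite !inE; case gY : (g \in Y) => //=; last by rewrite andbT.
  by apply/esym/negbTE; have [_] := hY g gY.
have YXG (g : Omega d) : g \in (Y `|` fset_set X)%fset -> Gamma0 g.
  by rewrite in_fsetU => /orP[/hY[]//|/XfG].
move=> /(_ YXG) h; have SXfin : (\sum_(g <- fset_set X) cycle_term g)%E \is a fin_num.
  rewrite ge0_fin_numE; last by apply: sume_ge0 => g _; exact: cycle_term_ge0.
  exact: le_lt_trans (sum_le_beta XfG) boo.
rewrite -(leeD2rE _ _ SXfin); apply: (le_trans h).
by rewrite addeC -leeBlDr//; exact: ltW.
Qed.

(** [beta] only lists cycles through the origin; cycles through [x] are brought there by
    translation, which preserves their weight. *)
Lemma Gamma0_shift A t x : t \in SL A -> nontriv x A -> orb t x = A ->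
  Gamma0 (shift (- x) t) /\ supp (shift (- x) t) = [set` tr (- x) A].
Proof.
move=> tA /andP[xA A1] oA.
have xA0 : 0 \in tr (- x) A by rewrite in_tr opprK add0r.
have t0 : shift (- x) t \in SL (tr (- x) A) by exact: shift_SL.
have o0 : orb (shift (- x) t) 0 = tr (- x) A.
  by rewrite -{1}(subrr x) (orb_shift _ tA xA) oA.
have A10 : tr (- x) A != [fset 0]%fset.
  apply: contra A1 => /eqP e; apply/eqP/(@tr_inj _ (- x)).
  by rewrite e tr1 subrr.
split; last exact: supp_orb t0 xA0 o0 A10.
by have [xs [? ? ? ->]] := orb_cycle_of t0 xA0 o0 A10; exists xs.
Qed.

Definition cycles_in (P : pred {fset E}) x U : {fset Omega d} :=
  [fset t in SL U | [&& nontriv x (orb t x) && P (orb t x), (orb t x `<=` U)%fset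
                      & t \in SL (orb t x)]]%fset.

Lemma cycles_inP P x U t : t \in cycles_in P x U ->
  [/\ nontriv x (orb t x), P (orb t x), (orb t x `<=` U)%fset & t \in SL (orb t x)].
Proof. by rewrite !inE => /andP[_ /and3P[/andP[]]]. Qed.

Lemma sum_cycles_in (P : pred {fset E}) (F : {fset E} -> Omega d -> R) x U :
  \sum_(A <- fpowerset U | nontriv x A && P A) \sum_(t <- SL A | orb t x == A) F A t =
  \sum_(t <- cycles_in P x U) F (orb t x) t.
Proof.
rewrite /cycles_in big_fset/= -(sum_cyc_pairs (fun A => nontriv x A && P A)).
by apply: eq_bigr => A _; apply: eq_bigr => t /eqP ->.
Qed.

Definition rooted_cycles P x U : {fset Omega d} :=
  [fset shift (- x) t | t in cycles_in P x U]%fset.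

(** Translation by [- x] is injective on configurations, so the cycle sum at any site equals a
    finite subsum of [beta]. This is the source of uniformity in [x] and [U]. *)
Lemma sum_rooted_cycles P x U :
  (\sum_(A <- fpowerset U | nontriv x A && P A) #|` A|%:R * cyc bw x A)%:E =
  (\sum_(g <- rooted_cycles P x U) cycle_term g)%E.
Proof.
rewrite /rooted_cycles big_imfset/=; last by move=> s t _ _; apply: can_inj (shiftK (- x)) s t.
under eq_bigr => A _ do rewrite /cyc mulr_sumr.
rewrite (sum_cycles_in P (fun A t => #|` A|%:R * wt bw A t)) -sumEFin.
apply: eq_big_seq => t /cycles_inP[nA _ _ tA].
by have [_ /cycle_termE ->] := Gamma0_shift tA nA erefl; rewrite card_tr wt_shift.
Qed.

Lemma rooted_cyclesP P x U g : g \in rooted_cycles P x U ->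
  exists A, [/\ nontriv x A, P A, Gamma0 g & supp g = [set` tr (- x) A]].
Proof.
move=> /imfsetP[t /= /cycles_inP[nA PA _ tA] ->].
by have [? ?] := Gamma0_shift tA nA erefl; exists (orb t x).
Qed.

Lemma cyc_bound_beta x U : (beta V a < +oo)%E ->
  \sum_(A <- fpowerset U | nontriv x A) #|` A|%:R * cyc bw x A <= fine (beta V a).
Proof.
move=> boo; have bfin : beta V a \is a fin_num.
  rewrite ge0_fin_numE// betaE esum_ge0// => g _; exact: cycle_term_ge0.
rewrite -lee_fin fineK//.
rewrite (eq_bigl (fun A => nontriv x A && xpredT A)) => [|A]; last by rewrite andbT.
rewrite sum_rooted_cycles; apply: sum_le_beta => g /rooted_cyclesP.
by move=> [A []].
Qed.

Lemma finite_supp_Gamma0 (g : Omega d) : Gamma0 g -> finite_set (supp g).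
Proof.
move=> [xs [_ _ _ ->]]; apply: (@sub_finite_set _ _ [set` xs]) => // x.
by rewrite /supp/= /cycle_of; case: ifP => //; rewrite eqxx.
Qed.

Lemma cyc_tail_beta (e : R) : (beta V a < +oo)%E -> 0 < e -> exists K, forall x U,
  \sum_(A <- fpowerset U | nontriv x A && ~~ within x K A) cyc bw x A <= e.
Proof.
move=> boo e0; have [X [XG hX]] := beta_tail boo e0.
exists (\bigcup_(g <- X) fset_set (supp g))%fset => x U.
set K := (\bigcup_(g <- X) _)%fset.
apply: (@le_trans _ _ (\sum_(A <- fpowerset U | nontriv x A && ~~ within x K A)
    #|` A|%:R * cyc bw x A)).
  apply: ler_sum => A /andP[/andP[xA _] _]; rewrite ler_peMl ?cyc_ge0//; first exact: bw_ge0.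
  by rewrite (ler_nat _ 1) cardfs_gt0; apply/fset0Pn; exists x.
rewrite -lee_fin (sum_rooted_cycles (fun A => ~~ within x K A)); apply: hX => g.
move=> /rooted_cyclesP[A [nA wA Gg sg]]; split=> //.
apply: contra wA => gX; apply/allP => y yA; apply/bigfcupP; exists g; rewrite ?gX//.
rewrite in_fset_set; last exact: finite_supp_Gamma0.
by rewrite inE sg/= in_tr opprK subrK.
Qed.

End Beta.

(** * A cofinal sequence of finite sets, which reduces net statements to countable ones *)

Section Windows.
Variable E : countType.
Implicit Types (L A : {fset E}).

Definition win (n : nat) : {fset E} := [fset x in pmap (@choice.pickle_inv E) (iota 0 n)]%fset.

Lemma mem_win x n : (x \in win n) = (choice.pickle x < n)%N.
Proof.
rewrite !inE mem_pmap; apply/mapP/idP => [[k]|h].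
  rewrite mem_iota/= add0n => kn e.
  by have := choice.pickle_invK (T := E) k; case: (choice.pickle_inv k) e => //= _ [->] ->.
by exists (choice.pickle x); rewrite ?mem_iota// choice.pickleK_inv.
Qed.

Lemma win_mono m n : (m <= n)%N -> (win m `<=` win n)%fset.
Proof. by move=> mn; apply/fsubsetP => x; rewrite !mem_win => h; exact: leq_trans mn. Qed.

Lemma win_sup A : exists n, (A `<=` win n)%fset.
Proof.
exists (\max_(x <- enum_fset A) (choice.pickle x).+1)%N; apply/fsubsetP => x xA.
by rewrite mem_win; apply: leq_bigmax_seq.
Qed.

Lemma near_win (P : set {fset E}) :
  (\forall L \near @fset_up E, P L) <-> exists n, forall L, (win n `<=` L)%fset -> P L.
Proof.
rewrite near_fset_up; split=> [[A h]|[n h]]; last by exists (win n).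
by have [n An] := win_sup A; exists n => L nL; apply: h; exact: fsubset_trans nL.
Qed.

End Windows.

(** * Events of probability one, and the uniform law on the unit interval *)

Section FullEvents.
Variables (dT : measure_display) (T : measurableType dT) (R : realType) (P : probability T R).
Implicit Types C D : set T.

Lemma prob_setC_full D : measurable D -> P D = 1%E -> P (~` D) = 0%E.
Proof. by move=> mD D1; rewrite probability_setC// D1 subee. Qed.

Lemma prob_setI_full C D : measurable C -> measurable D -> P D = 1%E -> P (C `&` D) = P C.
Proof.
move=> mC mD D1; have mDc := measurableC mD.
rewrite -[in RHS](setIT C) -(setUv D) setIUr measureU//; last 3 first.
- exact: measurableI.
- exact: measurableI.
- by rewrite setIACA setICr setI0.
rewrite [X in (_ = _ + X)%E](_ : _ = 0%E) ?adde0//; apply/eqP; rewrite eq_le measure_ge0 andbT.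
by rewrite -(prob_setC_full mD D1) le_measure ?inE//; exact: measurableI.
Qed.

End FullEvents.

Section UniformInterval.
Variable R : realType.

Definition unif : probability _ R := uniform_prob (@ltr01 R).

Lemma unif_itv (x y : R) : 0 <= x -> x <= y -> y <= 1 -> unif `[x, y[%classic = (y - x)%:E.
Proof.
move=> x0 xy y1; rewrite /unif/= /uniform_prob.
transitivity (\int[lebesgue_measure]_(z in `[x, y[%classic) (cst 1%E z : \bar R))%E.
  apply: eq_integral => z; rewrite inE/= in_itv/= /uniform_pdf => /andP[xz zy].
  by rewrite subr0 invr1 (le_trans x0 xz) (ltW (lt_le_trans zy y1)).
rewrite integral_cst//= mul1e lebesgue_measure_itv/= lte_fin.
by case: ltP => // yx; rewrite (_ : y = x) ?subrr//; apply/eqP; rewrite eq_le xy yx.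
Qed.

Lemma unif_set1 (x : R) : unif [set x] = 0%E.
Proof. exact: integral_set1. Qed.

Lemma unif_setI_itv01 (A : set R) : measurable A -> unif (A `&` `[0, 1[%classic) = unif A.
Proof.
move=> mA; have m01 : measurable (`[0, 1[%classic : set R) by [].
by apply: prob_setI_full; rewrite ?unif_itv// subr0.
Qed.

End UniformInterval.

(** * Measurability of limits along the net of finite sets *)

Section NetMeasurability.
Variables (dT : measure_display) (T : measurableType dT).

Lemma measurable_forall (I : countType) (F : I -> set T) : (forall i, measurable (F i)) ->
  measurable [set u | forall i, F i u].
Proof.
move=> mF; rewrite (_ : [set _ | _] = ~` \bigcup_i ~` F i).
  apply: measurableC; apply: countable_bigcupT_measurable => // i.
  exact: measurableC.
rewrite setC_bigcup; apply/seteqP; split=> u /= h i; first by move=> _; rewrite setCK.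
by have := h i Logic.I; rewrite setCK.
Qed.

Lemma measurable_exists (I : countType) (F : I -> set T) : (forall i, measurable (F i)) ->
  measurable [set u | exists i, F i u].
Proof.
move=> mF; rewrite (_ : [set _ | _] = \bigcup_i F i).
  exact: countable_bigcupT_measurable.
by apply/seteqP; split=> u /= [i]; [exists i|move=> _ ?; exists i].
Qed.

Lemma measurable_prop (P : Prop) : measurable [set _ : T | P].
Proof.
have [p|np] := pselect P.
  by rewrite (_ : [set _ | _] = setT)//; apply/seteqP; split.
by rewrite (_ : [set _ | _] = set0)//; apply/seteqP; split.
Qed.

Lemma measurable_and (P : Prop) (C : set T) : measurable C -> measurable [set u | P /\ C u].
Proof. by move=> mC; apply: measurableI => //; exact: measurable_prop. Qed.

Lemma measurable_imply (P : Prop) (C : set T) : (P -> measurable C) -> measurable [set u | P -> C u].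
Proof.
have [p /(_ p) mC|np _] := pselect P.
  by rewrite (_ : [set _ | _] = C)//; apply/seteqP; split=> u /=; [apply|].
by rewrite (_ : [set _ | _] = setT)//; apply/seteqP; split=> // u _ /np.
Qed.

Variable (E : countType).

Lemma measurable_upper (D : {fset E} -> set T) n : (forall L, measurable (D L)) ->
  measurable [set u | forall L, (win E n `<=` L)%fset -> D L u].
Proof.
move=> mD; apply: (@measurable_forall _ (fun L => [set u | (win E n `<=` L)%fset -> D L u])) => L.
by apply: measurable_imply.
Qed.

Lemma near_fset_bigcup (D : {fset E} -> set T) :
  [set u | \forall L \near @fset_up E, D L u] =
  \bigcup_n [set u | forall L, (win E n `<=` L)%fset -> D L u].
Proof.
apply/seteqP; split=> u /=; first by move/near_win => [n h]; exists n.
by move=> [n _ h]; apply/near_win; exists n.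
Qed.

Lemma measurable_near (D : {fset E} -> set T) : (forall L, measurable (D L)) ->
  measurable [set u | \forall L \near @fset_up E, D L u].
Proof.
move=> mD; rewrite near_fset_bigcup; apply: bigcupT_measurable => n.
exact: measurable_upper.
Qed.

(* Fatou's lemma along the net of finite sets. *)
Lemma measure_near_le (R : realType) (P : probability T R) (D : {fset E} -> set T) (e : \bar R) :
  (forall L, measurable (D L)) ->
  (\forall L \near @fset_up E, (P (D L) <= e)%E) ->
  (P [set u | \forall L \near @fset_up E, D L u] <= e)%E.
Proof.
move=> mD; rewrite near_fset_bigcup => /near_win[m hm].
have h : (fun n => P [set u | forall L, (win E n `<=` L)%fset -> D L u]) @ \oo -->
   P (\bigcup_n [set u | forall L, (win E n `<=` L)%fset -> D L u]).
  apply: nondecreasing_cvg_mu.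
  - by move=> n; exact: measurable_upper.
  - by apply: bigcupT_measurable => n; exact: measurable_upper.
  - move=> n n' nn'; apply/subsetPset => u /= hu L n'L; apply: hu.
    exact: fsubset_trans (win_mono _ nn') n'L.
rewrite -(cvg_lim _ h)//; apply: lime_le; first by apply/cvg_ex; eexists; exact: h.
apply: nearW => n; set L := win E (maxn n m).
apply: (@le_trans _ _ (P (D L))); last by apply: hm; apply: win_mono; exact: leq_maxr.
apply: le_measure; rewrite ?inE//; first exact: measurable_upper.
by move=> u /=; apply; apply: win_mono; exact: leq_maxl.
Qed.

End NetMeasurability.

(** * Finite volume laws and patterns *)

Section FiniteVolume.
Variables (R : realType) (d : nat) (v : site d -> R).
Hypotheses (v_ge0 : forall x, 0 <= v x) (v0 : v 0 = 1).
Local Notation E := (site d).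
Implicit Types (L A B U : {fset E}) (s t : Omega d) (x y z : E) (C D : set (Omega d)) (u : R).

Definition gp L C : R := (\sum_(s <- SL L | s \in C) wt v L s) / Z v L.

Lemma gp_ge0 L C : 0 <= gp L C.
Proof. by rewrite divr_ge0 ?(ltW (Z_gt0 _ _ _))// sumr_ge0// => s _; exact: wt_ge0. Qed.

Lemma gpT L : gp L setT = 1.
Proof.
rewrite /gp (eq_bigl xpredT) => [|s]; last by rewrite in_setT.
by rewrite divff// lt0r_neq0 ?Z_gt0.
Qed.

Lemma eq_gp L C D : (forall s, s \in SL L -> C s <-> D s) -> gp L C = gp L D.
Proof.
move=> h; rewrite /gp; congr (_ / _); rewrite big_seq_cond [RHS]big_seq_cond.
by apply: eq_bigl => s; case sL : (s \in SL L) => //=; apply/idP/idP; rewrite !inE => /h; apply.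
Qed.

Lemma gpID D L C : gp L C = gp L (C `&` D) + gp L (C `\` D).
Proof.
rewrite /gp -mulrDl; congr (_ / _); rewrite (bigID (fun s => s \in D))/=; congr (_ + _).
  by apply: eq_bigl => s; rewrite in_setI.
by apply: eq_bigl => s; rewrite in_setD.
Qed.

Lemma le_gp L C D : (forall s, s \in SL L -> C s -> D s) -> gp L C <= gp L D.
Proof.
move=> h; rewrite (gpID C L D) [X in X + _](_ : _ = gp L C); last first.
  by apply: eq_gp => s sL; split=> [[]//|Cs]; split=> //; exact: h.
by rewrite lerDl gp_ge0.
Qed.

Lemma gp_le1 L C : gp L C <= 1.
Proof. by rewrite -(gpT L); exact: le_gp. Qed.

Lemma gp0 L C : (forall s, s \in SL L -> ~ C s) -> gp L C = 0.
Proof.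
move=> h; rewrite /gp big_seq_cond big1 ?mul0r// => s /andP[sL].
by rewrite inE => /(h _ sL).
Qed.

Lemma gpU L C D : (forall s, s \in SL L -> C s -> ~ D s) -> gp L (C `|` D) = gp L C + gp L D.
Proof.
move=> h; rewrite (gpID C); congr (_ + _); apply: eq_gp => s sL; split.
- by case.
- by move=> Cs; split; [left|].
- by case=> -[].
- by move=> Ds; split; [right|move=> /(h _ sL); exact].
Qed.

Definition pset A t : set (Omega d) := [set s | agree A s t].

Lemma gp_pset L A t : (A `<=` L)%fset -> t \in SL A -> gp L (pset A t) = wt v A t * ratio v L A.
Proof.
move=> AL tA; rewrite /gp /ratio mulrA -sum_SL_agree//; congr (_ / _).
by apply: eq_bigl => s; apply/idP/idP; rewrite inE.
Qed.

Lemma gp1 L s : s \in SL L -> gp L [set s] = wt v L s / Z v L.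
Proof.
move=> sL; rewrite /gp; congr (_ / _).
rewrite big_mkcond (big_fsetD1 _ sL)/= in_set1 eqxx big1_seq ?addr0// => t.
by rewrite in_fsetD1 => /andP[_ /andP[ts _]]; rewrite in_set1 (negbTE ts).
Qed.

(** Stability of the union is clear; the point is injectivity of [s] on it. If [s x = s y] with [x]
    in [A] and [y] in [B], the common value lies in the intersection, which [s] maps onto itself;
    injectivity on [B] then puts [y] in [A]. *)
Lemma inter_pset A B s t (u : Omega d) : t \in SL A -> u \in SL B -> agree A s t -> agree B s u ->
  glue (A `|` B)%fset s idfun \in SL (A `|` B)%fset /\
  pset A t `&` pset B u = pset (A `|` B)%fset (glue (A `|` B)%fset s idfun).
Proof.
move=> tA uB sA sB; split.
  have stA := agree_SL_stable tA sA; have stB := agree_SL_stable uB sB.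
  have iA := agree_SL_inj tA sA; have iB := agree_SL_inj uB sB.
  have key A' B' x y : {in A' &, injective s} -> {in B' &, injective s} ->
      (forall x, x \in A' -> s x \in A') -> (forall x, x \in B' -> s x \in B') ->
      x \in A' -> y \in B' -> s x = s y -> y \in A'.
    move=> jA jB tA' tB' xA yB e.
    have h1 : {in (A' `&` B')%fset &, injective s}.
      by move=> z z'; rewrite !in_fsetI => /andP[zA _] /andP[zA' _]; exact: jA.
    have h2 z : z \in (A' `&` B')%fset -> s z \in (A' `&` B')%fset.
      by rewrite !in_fsetI => /andP[/tA' -> /tB' ->].
    have [|z zAB e'] := @stable_surj _ _ s h1 h2 (s y).
      by rewrite in_fsetI -{1}e tA'// tB'.
    move: zAB; rewrite in_fsetI => /andP[zA zB].
    by rewrite (jB y z yB zB e').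
  apply: glue_SL => [x y|x]; rewrite !in_fsetU => /orP[xA|xB].
  - case/orP => [yA|yB e]; first exact: iA.
    exact: (iA _ _ xA (key _ _ _ _ iA iB stA stB xA yB e) e).
  - case/orP => [yA e|yB]; last exact: iB.
    exact: (iB _ _ xB (key _ _ _ _ iB iA stB stA xB yA e) e).
  - by rewrite stA.
  - by rewrite stB ?orbT.
apply/seteqP; split=> s'; rewrite /pset/= agreeU.
  move=> [h1 h2]; apply/andP; split.
    apply: (agree_trans h1); rewrite agree_sym; apply: agree_trans sA.
    by apply: agreeS (agree_glue _ _ _); exact: fsubsetUl.
  apply: (agree_trans h2); rewrite agree_sym; apply: agree_trans sB.
  by apply: agreeS (agree_glue _ _ _); exact: fsubsetUr.
move=> /andP[h1 h2]; split.
  apply: (agree_trans h1); apply: agree_trans sA.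
  by apply: agreeS (agree_glue _ _ _); exact: fsubsetUl.
apply: (agree_trans h2); apply: agree_trans sB.
by apply: agreeS (agree_glue _ _ _); exact: fsubsetUr.
Qed.

(** * Enumeration of the patterns and binary codes *)

Definition pat (k : nat) : {fset E} * Omega d :=
  if choice.unpickle k is Some (A, i) then (A, nth idfun (enum_fset (SL A)) i) else (fset0, idfun).

(** The default values are legitimate patterns too, so every index can be used without a side
    condition. *)
Lemma patP k : (pat k).2 \in SL (pat k).1.
Proof.
rewrite /pat; case: (choice.unpickle k) => [[A i]|]/=; last exact: SL_id.
have [ilt|ige] := ltnP i (size (enum_fset (SL A))); first exact: mem_nth.
by rewrite nth_default//; exact: SL_id.
Qed.

Lemma pat_surj A t : t \in SL A -> exists k, pat k = (A, t).
Proof.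
move=> tA; exists (choice.pickle (A, index t (enum_fset (SL A)))).
by rewrite /pat choice.pickleK nth_index.
Qed.

Definition bit k s : bool := agree (pat k).1 s (pat k).2.

(* Records in binary which of the first [n] patterns [s] satisfies; longer codes refine
   shorter ones. *)
Fixpoint code n s : nat := if n is n'.+1 then ((code n' s).*2 + bit n' s)%N else 0.

Lemma code_lt n s : (code n s < 2 ^ n)%N.
Proof. by elim: n => //= n IH; rewrite expnS; case: (bit n s) => /=; lia. Qed.

Lemma code_half n s : (code n.+1 s)./2 = code n s.
Proof. by rewrite /= addnC half_bit_double. Qed.

Lemma code_odd n s : odd (code n.+1 s) = bit n s.
Proof. by rewrite /= oddD odd_double/=; case: (bit n s). Qed.

Lemma code_div n p s : code n s = (code (n + p) s %/ 2 ^ p)%N.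
Proof.
elim: p => [|p IH]; first by rewrite addn0 divn1.
by rewrite addnS expnS divnMA divn2 code_half.
Qed.

Lemma code_bit n s s' k : code n s = code n s' -> (k < n)%N -> bit k s = bit k s'.
Proof.
elim: n => // n IH e; rewrite ltnS leq_eqVlt => /orP[/eqP ->|].
  by rewrite -!code_odd e.
by apply: IH; rewrite -(code_half n s) -(code_half n s') e.
Qed.

(** A permutation of [L] is itself a pattern on [L]; once all of these have been enumerated, the
    code tells them apart. *)
Lemma code_sep L : exists N, forall n, (N <= n)%N -> {in SL L &, injective (code n)}.
Proof.
exists (\max_(s <- SL L) (choice.pickle (L, index s (enum_fset (SL L)))).+1) => n hn s s' sL s'L e.
have kn : (choice.pickle (L, index s (enum_fset (SL L))) < n)%N.
  by apply: leq_trans hn; apply: leq_bigmax_seq.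
have := code_bit e kn; rewrite /bit /pat choice.pickleK nth_index//= agreexx => /esym h.
by apply/esym/(eq_SL s'L sL).
Qed.

Variable b : R.
Hypotheses (b_ge0 : 0 <= b) (b_lt1 : b < 1).
Hypothesis cyc_bound : forall x U,
  \sum_(A <- fpowerset U | nontriv x A) #|` A|%:R * cyc v x A <= b.
Hypothesis cyc_tail : forall e : R, 0 < e -> exists K, forall x U,
  \sum_(A <- fpowerset U | nontriv x A && ~~ within x K A) cyc v x A <= e.

Local Notation rho := (rho v).

Lemma cvg_gp_pset A t : t \in SL A -> gp L (pset A t) @[L --> @fset_up E] --> wt v A t * rho A.
Proof.
move=> tA; have h := cvg_ratio (A := A) v_ge0 v0 b_ge0 b_lt1 cyc_bound cyc_tail.
have hc : wt v A t * ratio v L A @[L --> @fset_up E] --> wt v A t * rho A.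
  by apply: cvgM h; exact: cvg_cst.
apply: cvg_trans hc; apply: near_eq_cvg.
by apply: filterS (fset_up_sub A) => L AL /=; rewrite gp_pset.
Qed.

(** The last bit is handled by inclusion and exclusion. If it is 1, pattern [n] is intersected with
    [pset A t], giving a pattern or nothing; if it is 0, that case is subtracted. The induction
    therefore needs an arbitrary pattern [A], [t]. *)
Lemma is_cvg_gp_code n m A t : t \in SL A ->
  cvg (gp L (pset A t `&` [set s | code n s = m]) @[L --> @fset_up E]).
Proof.
elim: n m A t => [|n IH] m A t tA.
  have [->|m0] := eqVneq m 0.
    rewrite (_ : _ `&` _ = pset A t); last by apply/seteqP; split=> s //= [].
    by apply/cvg_ex; eexists; exact: cvg_gp_pset.
  rewrite (_ : _ `&` _ = set0); last first.
    by apply/seteqP; split=> s //= [_ /esym/eqP]; rewrite (negbTE m0).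
  rewrite (_ : (fun L => _) = cst 0); first exact: is_cvg_cst.
  by apply/funext => L; apply: gp0 => s _ [].
have cvgI : cvg (gp L (pset A t `&` pset (pat n).1 (pat n).2 `&` [set s | code n s = m./2])
    @[L --> @fset_up E]).
  have [[s [sA sB]]|/forallNP h] := pselect (exists s, agree A s t /\ bit n s).
    by have [uU ->] := inter_pset tA (patP n) sA sB; exact: IH.
  rewrite (_ : (fun L => _) = cst 0); first exact: is_cvg_cst.
  by apply/funext => L; rewrite gp0// => s _ [[sA sB] _]; apply: (h s).
have e (s : Omega d) : code n.+1 s = m <-> code n s = m./2 /\ bit n s = odd m.
  split=> [<-|[h1 h2]]; first by rewrite code_half code_odd.
  by rewrite -[LHS]odd_double_half -[RHS]odd_double_half code_half code_odd h1 h2.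
case om : (odd m).
  rewrite (_ : _ `&` _ = pset A t `&` pset (pat n).1 (pat n).2 `&` [set s | code n s = m./2])//.
  apply/seteqP; split=> s /=; first by move=> [h /e[h1]]; rewrite om.
  by move=> [[h1 h2] h3]; split=> //; apply/e; rewrite om.
rewrite (_ : (fun L => _) = (fun L => gp L (pset A t `&` [set s | code n s = m./2])
   - gp L (pset A t `&` pset (pat n).1 (pat n).2 `&` [set s | code n s = m./2]))).
  by apply: is_cvgB; [exact: IH|exact: cvgI].
apply/funext => L; rewrite (gpID (pset (pat n).1 (pat n).2) L (_ `&` [set s | code n s = _])).
rewrite setIAC [X in _ = X - _]addrC addrK; congr gp; apply/seteqP; split=> s /=.
  by move=> [h /e[h1 h2]]; split=> // h3; move: h2; rewrite om /bit => /negP.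
move=> [[h1 h2] h3]; split=> //; apply/e; split=> //; rewrite om.
by apply/negbTE/negP => h4; apply: h3.
Qed.

(** * Distribution functions of the codes and the quantile coupling *)

Definition codecdf n m L : R := gp L [set s | (code n s < m)%N].

Lemma codecdfS n m L : codecdf n m.+1 L = codecdf n m L + gp L [set s | code n s = m].
Proof.
rewrite /codecdf -gpU => [|s _ /= h1 h2]; last by rewrite h2 ltnn in h1.
congr gp; apply/seteqP; split=> s /=.
  by rewrite ltnS leq_eqVlt => /orP[/eqP ->|->]; [right|left].
by case=> [/ltnW|->].
Qed.

Lemma is_cvg_codecdf n m : cvg (codecdf n m L @[L --> @fset_up E]).
Proof.
elim: m => [|m IH].
  rewrite (_ : (fun L => _) = cst 0); first exact: is_cvg_cst.
  by apply/funext => L; rewrite /codecdf gp0//.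
rewrite (_ : (fun L => _) = (fun L => codecdf n m L + gp L [set s | code n s = m])).
  apply: is_cvgD; first exact: IH.
  have := @is_cvg_gp_code n m fset0 idfun (SL_id _).
  rewrite (_ : (fun L => _) = (fun L => gp L [set s | code n s = m]))//.
  apply/funext => L; congr gp; apply/seteqP; split=> s //=; by case.
by apply/funext => L; rewrite codecdfS.
Qed.

Lemma codecdf0 n L : codecdf n 0 L = 0. Proof. by rewrite /codecdf gp0. Qed.

Lemma codecdf1 n L : codecdf n (2 ^ n) L = 1.
Proof. by rewrite -(gpT L); apply: eq_gp => s _; split=> // _; exact: code_lt. Qed.

Lemma codecdf_le n m m' L : (m <= m')%N -> codecdf n m L <= codecdf n m' L.
Proof. by move=> mm'; apply: le_gp => s _ /= h; exact: leq_trans mm'. Qed.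

(** Refinement in terms of distribution functions: a level [n] interval is a union of deeper
    intervals with the same endpoints, whatever the depth used for [L]. *)
Lemma codecdf_level n p m L : codecdf (n + p) (m * 2 ^ p) L = codecdf n m L.
Proof.
by apply: eq_gp => s _ /=; rewrite (code_div n p s) ltn_divLR// expn_gt0.
Qed.

(** Depth at which [u] is decoded in [L]: deep enough for the code to separate the permutations of
    [L], and at least the size of [L], so that every fixed level is eventually exceeded along the
    net. *)
Definition lev L : nat := maxn (sval (cid (code_sep L))) #|` L|.

Lemma code_lev_inj L : {in SL L &, injective (code (lev L))}.
Proof. by rewrite /lev; case: cid => N /= h; apply: h; exact: leq_maxl. Qed.

Definition cellof L u s : bool :=
  codecdf (lev L) (code (lev L) s) L <= u < codecdf (lev L) (code (lev L) s).+1 L.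

(* The quantile transform of [u] for the finite volume law listed in the order of the codes. *)
Definition zeta L u : Omega d := head idfun [seq s <- enum_fset (SL L) | cellof L u s].

Lemma zeta_SL L u : zeta L u \in SL L.
Proof.
rewrite /zeta; case E : [seq s <- _ | _] => [|s r]/=; first exact: SL_id.
have : s \in [seq s <- enum_fset (SL L) | cellof L u s] by rewrite E mem_head.
by rewrite mem_filter => /andP[].
Qed.

Lemma zetaP L u : 0 <= u < 1 -> cellof L u (zeta L u).
Proof.
move=> /andP[u0 u1].
have ex : exists j, u < codecdf (lev L) j L by exists (2 ^ lev L)%N; rewrite codecdf1.
have [j uj jmin] := find_ex_minn ex.
have j0 : (0 < j)%N by case: j uj {jmin} => //; rewrite codecdf0// ltNge u0.
case: j j0 uj jmin => // m _ um mmin.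
have mu : codecdf (lev L) m L <= u.
  by rewrite leNgt; apply/negP => /mmin; rewrite ltnn.
have [s sL e] : exists2 s, s \in SL L & code (lev L) s = m.
  apply: contrapT => h; move: um; rewrite codecdfS// gp0 ?addr0 ?ltNge ?mu//.
  by move=> s sL e; apply: h; exists s.
have sc : s \in [seq s <- enum_fset (SL L) | cellof L u s].
  by rewrite mem_filter /cellof e mu um.
rewrite /zeta; case E : [seq s <- _ | _] => [|s' r]/=; first by rewrite E in sc.
have : s' \in [seq s <- enum_fset (SL L) | cellof L u s] by rewrite E mem_head.
by rewrite mem_filter => /andP[].
Qed.

Lemma zeta_eq L u s : 0 <= u < 1 -> s \in SL L -> (zeta L u == s) = cellof L u s.
Proof.
move=> u01 sL; apply/eqP/idP => [<-|]; first exact: zetaP.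
have /andP[h1 h2] := zetaP L u01; move=> /andP[h3 h4].
apply: (code_lev_inj (zeta_SL L u) sL); apply/eqP; rewrite eqn_leq.
apply/andP; split; rewrite leqNgt; apply/negP => /(codecdf_le) h.
  by have := lt_le_trans h4 (le_trans (h _ _) h1); rewrite ltxx.
by have := lt_le_trans h2 (le_trans (h _ _) h3); rewrite ltxx.
Qed.

(** Because the cells are ordered by code and deeper codes refine level [n], the law of the level
    [n] code is realized by comparing [u] with its own distribution function; the depth [lev L]
    disappears. *)
Lemma zeta_code_lt L u n m : 0 <= u < 1 -> (n <= lev L)%N ->
  (code n (zeta L u) < m)%N = (u < codecdf n m L).
Proof.
move=> u01 nL; rewrite -(codecdf_level n (lev L - n)) subnKC//.
rewrite (code_div n (lev L - n)) ltn_divLR ?expn_gt0// subnKC//.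
have /andP[h1 h2] := zetaP L u01; apply/idP/idP => h.
  by apply: (lt_le_trans h2); apply: codecdf_le.
rewrite ltnNge; apply/negP => /(codecdf_le) => /(_ (lev L) L) h'.
by have := lt_le_trans h (le_trans h' h1); rewrite ltxx.
Qed.

Lemma zeta_out L u : ~~ (0 <= u < 1) -> zeta L u = idfun.
Proof.
move=> u01; rewrite /zeta; have -> // : [seq s <- enum_fset (SL L) | cellof L u s] = [::].
apply/eqP; rewrite -[_ == _]negbK -has_filter; apply/hasPn => s sL.
apply: contra u01 => /andP[h1 h2]; apply/andP; split.
  by apply: le_trans h1; exact: gp_ge0.
by apply: (lt_le_trans h2); exact: gp_le1.
Qed.

Definition cell L s : set R :=
  `[codecdf (lev L) (code (lev L) s) L, codecdf (lev L) (code (lev L) s).+1 L[%classic.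

Lemma zeta_preimage1 L s : s \in SL L ->
  zeta L @^-1` [set s] `&` `[0, 1[%classic = cell L s.
Proof.
move=> sL; apply/seteqP; split=> u /=; rewrite /cell/= !in_itv/=.
  by move=> [e u01]; have := zetaP L u01; rewrite e.
move=> h; suff u01 : 0 <= u < 1 by split=> //; apply/eqP; rewrite zeta_eq.
move: h => /andP[h1 h2]; apply/andP; split; first by apply: le_trans h1; exact: gp_ge0.
by apply: (lt_le_trans h2); exact: gp_le1.
Qed.

Lemma measurable_zeta1 L s : s \in SL L -> measurable (zeta L @^-1` [set s] : set R).
Proof.
move=> sL; rewrite -(setIT (_ @^-1` _)) -(setUv (`[0, 1[%classic : set R)) setIUr zeta_preimage1//.
apply: measurableU; first exact: measurable_itv.
have [->|sid] := eqVneq s idfun.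
  rewrite setIC (_ : _ `&` _ = ~` `[0, 1[%classic); first exact: measurableC.
  apply/seteqP; split=> u /=; first by case.
  by move=> h; split=> //; apply: zeta_out; apply/negP; move: h; rewrite in_itv.
rewrite (_ : _ `&` _ = set0)//; apply/seteqP; split=> u //=; rewrite in_itv/=.
by move=> [e /negP/zeta_out e2]; move: sid; rewrite -e e2 eqxx.
Qed.

Lemma zeta_preimageE L C :
  zeta L @^-1` C = \bigcup_(s in [set` SL L] `&` C) (zeta L @^-1` [set s]).
Proof.
apply/seteqP; split=> u /=; last by move=> [s [_ Cs]] /= ->.
by move=> h; exists (zeta L u) => //; split=> //; exact: zeta_SL.
Qed.

Lemma measurable_zeta L C : measurable (zeta L @^-1` C : set R).
Proof.
rewrite zeta_preimageE; apply: fin_bigcup_measurable.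
  by apply: finite_setIl; exact: finite_fset.
by move=> s [sL _]; exact: measurable_zeta1.
Qed.

Lemma unif_zeta1 L s : s \in SL L -> unif R (zeta L @^-1` [set s]) = (gp L [set s])%:E.
Proof.
move=> sL; rewrite -unif_setI_itv01; last exact: measurable_zeta1.
rewrite zeta_preimage1// unif_itv; last 3 first.
- exact: gp_ge0.
- exact: codecdf_le.
- exact: gp_le1.
congr EFin; rewrite codecdfS// addrC addKr.
by apply: eq_gp => t tL /=; split=> [/code_lev_inj->//|->].
Qed.

Lemma unif_zeta L C : unif R (zeta L @^-1` C) = (gp L C)%:E.
Proof.
have fC : finite_set ([set` SL L] `&` C) by apply: finite_setIl; exact: finite_fset.
rewrite zeta_preimageE measure_fin_bigcup//=; last 2 first.
- by move=> s s' _ _ [u [/= <-]].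
- by move=> s [sL _]; exact: measurable_zeta1.
rewrite fsbig_finite//=.
transitivity (\sum_(s <- fset_set ([set` SL L] `&` C)) (gp L [set s])%:E)%E.
  apply: eq_big_seq => s; rewrite in_fset_set// inE => -[sL _]; exact: unif_zeta1.
rewrite sumEFin; congr EFin.
have -> : fset_set ([set` SL L] `&` C) = [fset s in SL L | s \in C]%fset.
  by apply/fsetP => s; rewrite in_fset_set// in_setI mem_setE !inE.
rewrite /gp [X in _ = X / _]big_fset_condE mulr_suml.
by apply: eq_big_seq => s; rewrite !inE => /andP[sL _]; exact: gp1.
Qed.

Hypothesis d_gt0 : (0 < d)%N.

Lemma fset_large n : exists L : {fset E}, (n <= #|` L|)%N.
Proof.
pose f (k : nat) : E := const_mx k%:Z.
have fi : injective f.
  move=> k l /matrixP/(_ ord0 (Ordinal d_gt0)); rewrite !mxE => e.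
  by case: e.
exists [fset x in map f (iota 0 n)]%fset; rewrite card_fseq undup_id.
  by rewrite size_map size_iota.
by rewrite map_inj_uniq// iota_uniq.
Qed.

Lemma lev_large n : \forall L \near @fset_up E, (n <= lev L)%N.
Proof.
have [L0 nL0] := fset_large n; apply: filterS (fset_up_sub L0) => L /fsubset_leq_card h.
by rewrite /lev leq_max (leq_trans nL0 h) orbT.
Qed.

Definition cdflim n m : R := lim (codecdf n m L @[L --> @fset_up E]).

Lemma cvg_codecdf n m : codecdf n m L @[L --> @fset_up E] --> cdflim n m.
Proof. exact: is_cvg_codecdf. Qed.

(* Outside the countable set of limit endpoints [u] lies in the interior of a limit cell,
   hence in the corresponding cell of every large [L]. *)
Lemma zeta_code_cvg u n : 0 <= u < 1 -> (forall m, u <> cdflim n m) ->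
  exists m, \forall L \near @fset_up E, code n (zeta L u) = m.
Proof.
move=> u01 hu; have [u0 u1] := andP u01.
have l1 : cdflim n (2 ^ n)%N = 1.
  rewrite /cdflim (_ : (fun L => _) = cst 1); first exact: (cvg_lim (@Rhausdorff R) (cvg_cst _)).
  by apply/funext => L; rewrite codecdf1.
have l0 : cdflim n 0 = 0.
  rewrite /cdflim (_ : (fun L => _) = cst 0); first exact: (cvg_lim (@Rhausdorff R) (cvg_cst _)).
  by apply/funext => L; rewrite codecdf0.
have ex : exists j, u < cdflim n j by exists (2 ^ n)%N; rewrite l1.
have [j uj jmin] := find_ex_minn ex.
case: j uj jmin => [|m um mmin]; first by rewrite l0 ltNge u0.
have mu : cdflim n m < u.
  rewrite lt_neqAle; apply/andP; split; first by apply/eqP => /esym; exact: hu.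
  by rewrite leNgt; apply/negP => /mmin; rewrite ltnn.
exists m; have c1 := cvgr_gt _ (@cvg_codecdf n m.+1) _ um.
have c2 := cvgr_lt _ (@cvg_codecdf n m) _ mu.
near=> L.
have nL : (n <= lev L)%N by near: L; exact: lev_large.
have h1 : u < codecdf n m.+1 L by near: L; exact: c1.
have h2 : codecdf n m L < u by near: L; exact: c2.
apply/eqP; rewrite eqn_leq -ltnS zeta_code_lt// h1/= leqNgt zeta_code_lt// -leNgt.
exact: ltW.
Unshelve. all: by end_near.
Qed.

(** * Almost sure stabilization of the coupling *)

Definition regular u : Prop := 0 <= u < 1 /\ forall n m, u <> cdflim n m.

Lemma regular_bit u k : regular u ->
  (\forall L \near @fset_up E, bit k (zeta L u)) \/ (\forall L \near @fset_up E, ~~ bit k (zeta L u)).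
Proof.
move=> [u01 hu]; have [m hm] := zeta_code_cvg (n := k.+1) u01 (hu _).
case om : (odd m); [left|right]; apply: filterS hm => L e.
  by rewrite -code_odd e.
by rewrite -code_odd e om.
Qed.

Lemma regular_bits u (J : seq nat) : regular u ->
  (forall k, k \in J -> ~ \forall L \near @fset_up E, bit k (zeta L u)) ->
  \forall L \near @fset_up E, ~~ has (fun k => bit k (zeta L u)) J.
Proof.
move=> ru; elim: J => [_|k J IH hJ]; first exact: nearW.
have h1 : \forall L \near @fset_up E, ~~ bit k (zeta L u).
  by have [/(hJ k (mem_head _ _))|] := regular_bit k ru.
have h2 : \forall L \near @fset_up E, ~~ has (fun k => bit k (zeta L u)) J.
  by apply: IH => j jJ; apply: hJ; rewrite inE jJ orbT.
near=> L; rewrite /= negb_or; apply/andP; split; near: L; [exact: h1|exact: h2].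
Unshelve. all: by end_near.
Qed.

(** [J] lists the patterns on subsets of the window around [x] that contain [x]. If the orbit of [x]
    stays in the window, the pattern formed by this orbit is one of them. *)
Lemma orb_pats x K : exists J : seq nat, (forall k, k \in J -> x \in (pat k).1) /\
  forall L s, s \in SL L -> x \in L -> within x K (orb s x) -> has (fun k => bit k s) J.
Proof.
exists [seq choice.pickle (A, i) | A <- [seq A <- enum_fset (fpowerset (tr x K)) | x \in A],
                                    i <- iota 0 (size (enum_fset (SL A)))].
split=> [k /allpairsPdep[A [i [+ _ ->]]]|L s sL xL /withinP wo].
  by rewrite mem_filter /pat choice.pickleK => /andP[].
have sst y : y \in L -> s y \in L by rewrite (SL_stable _ sL).
have gS := restr_orb_SL (SL_inj sL) sst xL.
apply/hasP; exists (choice.pickle (orb s x, index (glue (orb s x) s idfun) (enum_fset (SL (orb s x))))).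
  apply/allpairsPdep; exists (orb s x); eexists; split; last reflexivity.
    rewrite mem_filter (orb_self sst xL)/= fpowersetE.
    by apply/fsubsetP => y /wo; rewrite in_tr.
  by rewrite mem_iota/= add0n index_mem.
by rewrite /bit /pat choice.pickleK/= nth_index// agree_sym agree_glue.
Qed.

(** [sum_SL_orb] writes the probability as a sum of [cyc x A] times [Z] of the complement of [A]
    over [Z L], and this quotient is at most 1. Adding 0 to the window makes fixed points count as
    inside. *)
Lemma gp_orb_tail (e : R) : 0 < e -> exists K, forall x L, x \in L ->
  gp L [set s | ~~ within x K (orb s x)] <= e.
Proof.
move=> e0; have [K hK] := cyc_tail e0; exists (0 |` K)%fset => x L xL.
have wK A : within x K A -> within x (0 |` K)%fset A.
  by move=> /withinP h; apply/withinP => y /h yK; rewrite in_fset1U yK orbT.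
rewrite /gp (eq_bigl (fun s => ~~ within x (0 |` K)%fset (orb s x))) => [|s]; last first.
  by apply/idP/idP; rewrite inE.
rewrite (sum_SL_orb v (fun A => ~~ within x (0 |` K)%fset A) xL) ler_pdivrMr ?Z_gt0//.
apply: (@le_trans _ _ ((\sum_(A <- fpowerset L | nontriv x A && ~~ within x K A) cyc v x A) * Z v L)).
  rewrite mulr_suml big_mkcond [leRHS]big_mkcond; apply: ler_sum => A _.
  case: ifPn => [/andP[xA wA]|_]; last first.
    by case: ifP => // _; rewrite mulr_ge0 ?cyc_ge0// ltW// Z_gt0.
  rewrite /nontriv xA/= (contra (@wK A) wA) andbT ifT.
    by rewrite ler_wpM2l ?cyc_ge0// Z_mono// fsubsetDl.
  apply: contra wA => /eqP ->; apply/withinP => y; rewrite inE => /eqP ->.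
  by rewrite subrr fset1U1.
by rewrite ler_wpM2r// ltW// Z_gt0.
Qed.

Definition live u k : Prop := \forall L \near @fset_up E, bit k (zeta L u).
Definition good u : Prop := forall x, exists k, x \in (pat k).1 /\ live u k.

Lemma measurable_live k : measurable ([set u | live u k] : set R).
Proof.
apply: measurable_near => L.
exact: (measurable_zeta L [set s | bit k s]).
Qed.

Lemma measurable_good : measurable ([set u | good u] : set R).
Proof.
apply: (@measurable_forall _ _ _ (fun x => [set u | exists k, x \in (pat k).1 /\ live u k])) => x.
apply: (@measurable_exists _ _ _ (fun k => [set u | x \in (pat k).1 /\ live u k])) => k.
by apply: measurable_and; exact: measurable_live.
Qed.

Lemma measurable_regular : measurable ([set u | regular u] : set R).
Proof.
rewrite (_ : [set _ | _] = `[0, 1[%classic `&` [set u | forall n m, u <> cdflim n m]).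
  apply: measurableI => //.
  apply: (@measurable_forall _ _ _ (fun n => [set u | forall m, u <> cdflim n m])) => n.
  apply: (@measurable_forall _ _ _ (fun m => [set u | u <> cdflim n m])) => m.
  by rewrite (_ : [set _ | _] = ~` [set cdflim n m])//; exact: measurableC.
by apply/seteqP; split=> u /=; rewrite in_itv/=.
Qed.

Lemma unif_regular : unif R [set u | regular u] = 1%E.
Proof.
have mC : measurable (~` [set u | regular u]) by apply: measurableC; exact: measurable_regular.
suff h : unif R (~` [set u | regular u]) = 0%E.
  by rewrite -[X in unif R X]setCK probability_setC// h sube0.
rewrite -unif_setI_itv01//; apply/eqP; rewrite eq_le measure_ge0 andbT.
apply: (@le_trans _ _ (unif R (\bigcup_n \bigcup_m [set cdflim n m]))).
  apply: le_measure; rewrite ?inE.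
  - exact: measurableI.
  - by apply: bigcupT_measurable => n; apply: bigcupT_measurable => m.
  - move=> u /= [nr]; rewrite in_itv/= => u01; apply: contrapT => h; apply: nr; split=> // n m e.
    by apply: h; exists n => //; exists m.
have sub (F : nat -> set R) : (forall n, measurable (F n)) -> (forall n, unif R (F n) = 0%E) ->
    unif R (\bigcup_n F n) = 0%E.
  move=> mF F0; apply/negligibleP; first exact: bigcupT_measurable.
  by apply: negligible_bigcup => n; apply/negligibleP; [exact: mF|exact: F0].
rewrite sub//; first by move=> n; apply: bigcupT_measurable.
by move=> n; rewrite sub// => m; exact: unif_set1.
Qed.

(** For a regular [u] each pattern indicator settles. If no pattern at [x] is live, the finitely
    many patterns of a window are eventually all false, so the orbit of [x] eventually leaves the
    window; Fatou's lemma along the net bounds this by [e]. *)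
Lemma unif_bad x : unif R [set u | forall k, x \in (pat k).1 -> ~ live u k] = 0%E.
Proof.
set B := [set u | _].
have mB : measurable B.
  apply: (@measurable_forall _ _ _ (fun k => [set u | x \in (pat k).1 -> ~ live u k])) => k.
  by apply: measurable_imply => _; apply: measurableC; exact: measurable_live.
apply/eqP; rewrite eq_le measure_ge0 andbT; apply/lee_addgt0Pr => e e0; rewrite add0e.
have [K hK] := gp_orb_tail e0.
have [J [hJ1 hJ2]] := orb_pats x K.
rewrite -(setIT B) -(setUv [set u | regular u]) setIUr.
have mr := measurable_regular.
have r0 : unif R (B `&` ~` [set u | regular u]) = 0%E.
  apply/eqP; rewrite eq_le measure_ge0 andbT.
  apply: (@le_trans _ _ (unif R (~` [set u | regular u]))).
    apply: le_measure; rewrite ?inE//; last exact: measurableC.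
    by apply: measurableI => //; exact: measurableC.
  by rewrite probability_setC// unif_regular subee.
apply: (le_trans (measureU2 _ _ _)); first exact: measurableI.
  by apply: measurableI => //; exact: measurableC.
rewrite [X in (_ + X)%E]r0 adde0.
pose D L := zeta L @^-1` [set s | ~~ has (fun k => bit k s) J] : set R.
apply: (@le_trans _ _ (unif R [set u | \forall L \near @fset_up E, D L u])).
  apply: le_measure; rewrite ?inE; [exact: measurableI| |].
    by apply: measurable_near => L; exact: measurable_zeta.
  move=> u [Bu ru]; apply: (regular_bits ru).
  by move=> k /hJ1 /Bu.
apply: measure_near_le; first by move=> L; exact: measurable_zeta.
apply: filterS (fset_up_mem x) => L xL; rewrite /D unif_zeta// lee_fin.
apply: le_trans (hK x L xL); apply: le_gp => // s sL /=; apply: contra => w.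
exact: (hJ2 L).
Qed.

Lemma unif_good : unif R (~` [set u | good u]) = 0%E.
Proof.
pose F n : set (measurableTypeR R) := if @choice.unpickle E n is Some x
  then [set u | forall k, x \in (pat k).1 -> ~ live u k] else set0.
apply/negligibleP; first by apply: measurableC; exact: measurable_good.
apply: (@negligibleS _ _ _ _ (\bigcup_n F n)).
  move=> u /= gu; apply: contrapT => h; apply: gu => x; apply: contrapT => hx; apply: h.
  exists (choice.pickle x) => //; rewrite /F choice.pickleK => k xk lk.
  by apply: hx; exists k.
apply: negligible_bigcup => n; rewrite /F; case: choice.unpickle => [x|]; last exact: negligible_set0.
apply/negligibleP; last exact: unif_bad.
apply: (@measurable_forall _ _ _ (fun k => [set u | x \in (pat k).1 -> ~ live u k])) => k.
by apply: measurable_imply => _; apply: measurableC; exact: measurable_live.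
Qed.

(** * The limit permutation and its law *)

Definition liveidx u x : nat := xget 0 [set k | x \in (pat k).1 /\ live u k].

(** Any live pattern at [x] yields the same value, namely the eventual one. The identity on the null
    set of bad [u] makes the result a finite-cycle permutation for every [u]. *)
Definition zetaZ (u : measurableTypeR R) : Omega d :=
  if `[< good u >] then fun x => (pat (liveidx u x)).2 x else idfun.

Lemma liveidxP u x : good u -> x \in (pat (liveidx u x)).1 /\ live u (liveidx u x).
Proof. by move=> gu; have [k hk] := gu x; rewrite /liveidx; case: xgetP => [k' _ h|/(_ k)]. Qed.

Lemma zetaZ_near u x : good u -> \forall L \near @fset_up E, zeta L u x = zetaZ u x.
Proof.
move=> gu; have [xk lk] := liveidxP x gu; apply: filterS lk => L /agreeP h.
by rewrite /zetaZ asboolT// h.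
Qed.

Lemma zetaZ_near_agree u A : good u -> \forall L \near @fset_up E, agree A (zeta L u) (zetaZ u).
Proof.
move=> gu; rewrite /agree; elim: (enum_fset A) => [|x r IH] /=; first exact: nearW.
near=> L; apply/andP; split; near: L; last exact: IH.
by apply: filterS (zetaZ_near x gu) => L ->.
Unshelve. all: by end_near.
Qed.

Lemma live_agree u k : good u -> live u k -> agree (pat k).1 (zetaZ u) (pat k).2.
Proof.
move=> gu lk; have h1 := zetaZ_near_agree (pat k).1 gu.
have /near_fset_up[L0 /(_ L0 (fsubset_refl _))] : \forall L \near @fset_up E,
    agree (pat k).1 (zetaZ u) (pat k).2; last by [].
near=> L; apply: (@agree_trans _ _ _ (zeta L u)); last by near: L; exact: lk.
by rewrite agree_sym; near: L; exact: h1.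
Unshelve. all: by end_near.
Qed.

Lemma SL_finite_cycle A t x : t \in SL A -> x \in A -> exists n, (0 < n)%N /\ iter n t x = x.
Proof.
move=> tA xA; have st y : y \in A -> t y \in A by rewrite (SL_stable _ tA).
have gS := restr_orb_SL (SL_inj tA) st xA; have xo := orb_self st xA.
have [n [n0 _ _ e]] := orb_traject gS xo (orb_glue (SL_inj tA) st xA).
exists n; split=> //; rewrite -[RHS]e.
have h : forall m, iter m t x = iter m (glue (orb t x) t idfun) x.
  elim=> //= m IH; rewrite -IH /glue (_ : iter m t x \in orb t x)//.
  by apply/(orbP _ st xA); exists m.
exact: h.
Qed.

Lemma agree_iter A s t x n : t \in SL A -> agree A s t -> x \in A -> iter n s x = iter n t x.
Proof.
move=> tA /agreeP h xA; elim: n => //= n ->; apply: h.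
by apply: iter_in xA => y; rewrite (SL_stable _ tA).
Qed.

(* The configurations all of whose sites lie in finite invariant sets. *)
Definition fincyc s : Prop := forall x, exists k, x \in (pat k).1 /\ bit k s.

Lemma fincyc_inj s : fincyc s -> injective s.
Proof.
move=> fs x y e; have [k [xk sk]] := fs x; have [l [yl sl]] := fs y.
have [gS e2] := inter_pset (patP k) (patP l) sk sl.
have : (pset (pat k).1 (pat k).2 `&` pset (pat l).1 (pat l).2) s by [].
rewrite e2 => /(agree_SL_inj gS); apply=> //.
  by rewrite in_fsetU xk.
by rewrite in_fsetU yl orbT.
Qed.

Lemma fincyc_bij s : fincyc s -> bijective s.
Proof.
move=> fs; apply: inj_surj_bij; first exact: fincyc_inj.
move=> y; have [k [yk sk]] := fs y.
have [x _ ->] := stable_surj (agree_SL_inj (patP k) sk) (agree_SL_stable (patP k) sk) yk.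
by exists x.
Qed.

(** Neither side assumes bijectivity. Conversely from a return time, the trajectory is a finite set
    that [s] maps onto itself, since it closes up at [x]; counting gives injectivity there, hence a
    pattern. *)
Lemma fincycP s : fincyc s <-> finite_cycle s.
Proof.
split=> [fs x|fs x].
  have [k [xk sk]] := fs x; have [n [n0 e]] := SL_finite_cycle (patP k) xk.
  by exists n; split=> //; rewrite (agree_iter n (patP k) sk xk).
have [n [n0 e]] := fs x; pose A : {fset E} := [fset y in traject s x n]%fset.
have xA : x \in A by rewrite !inE; apply/trajectP; exists 0.
have sA y : y \in A -> s y \in A.
  rewrite !inE => /trajectP[i iN ->]; rewrite -iterS; apply/trajectP.
  have [iN'|nI] := ltnP i.+1 n; first by exists i.+1.
  by exists 0 => //; have <- : n = i.+1 by apply/eqP; rewrite eqn_leq iN nI.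
have sur y : y \in A -> exists2 z, z \in A & y = s z.
  rewrite !inE => /trajectP[[|i] iN ->].
    exists (iter n.-1 s x); last by rewrite -iterS prednK// e.
    by rewrite !inE; apply/trajectP; exists n.-1; rewrite // prednK.
  by exists (iter i s x); rewrite // !inE; apply/trajectP; exists i => //; exact: ltnW.
have sI : {in A &, injective s}.
  apply/card_in_imfsetP; suff -> : (s @` A)%fset = A by [].
  apply/fsetP => y; apply/imfsetP/idP => [[z /= zA ->]|/sur[z zA ->]]; first exact: sA.
  by exists z.
have [k pk] := pat_surj (glue_SL sI sA).
by exists k; rewrite /bit pk/= agree_sym agree_glue.
Qed.

Lemma zetaZ_fincyc u : fincyc (zetaZ u).
Proof.
have [gu|gu] := pselect (good u).
  move=> x; have [xk lk] := liveidxP x gu; exists (liveidx u x); split=> //.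
  exact: live_agree.
rewrite /zetaZ asboolF// => x; have [k pk] := pat_surj (SL_id [fset x]%fset).
by exists k; rewrite /bit pk agreexx inE.
Qed.

Lemma zetaZ_bij u : bijective (zetaZ u).
Proof. exact: fincyc_bij (zetaZ_fincyc u). Qed.

Lemma measurable_fun_Omega (dT : measure_display) (T : measurableType dT) (f : T -> Omega d) :
  (forall x y, measurable [set w | f w x = y]) -> measurable_fun setT f.
Proof.
move=> mf; apply: (@measurability _ _ _ _ setT f (@cylinders d)) => //.
move=> _ [_ [x [y ->]] <-]; rewrite setTI.
exact: mf.
Qed.

Lemma measurable_fun_zeta L : measurable_fun setT (zeta L : measurableTypeR R -> Omega d).
Proof. by move=> _ C _; rewrite setTI; exact: measurable_zeta. Qed.

Lemma measurable_fun_zetaZ : measurable_fun setT (zetaZ : measurableTypeR R -> Omega d).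
Proof.
apply: measurable_fun_Omega => x y.
rewrite (_ : [set _ | _] =
  ([set u | good u] `&` [set u | \forall L \near @fset_up E, zeta L u x = y]) `|`
  (~` [set u | good u] `&` [set u | x = y])).
  have mg := measurable_good; apply: measurableU; apply: measurableI => //.
  - apply: measurable_near => L.
    exact: (measurable_zeta L [set s | s x = y]).
  - exact: measurableC.
  - exact: measurable_prop.
apply/seteqP; split=> u /=.
  have [gu|gu] := pselect (good u).
    move=> e; left; split=> //; apply: filterS (zetaZ_near x gu) => L ->.
    exact: e.
  by rewrite /zetaZ asboolF// => e; right.
move=> [[gu h]|[gu e]]; last by rewrite /zetaZ asboolF.
have /near_fset_up[L0 /(_ L0 (fsubset_refl _))] : \forall L \near @fset_up E, zetaZ u x = y; last by [].
near=> L; transitivity (zeta L u x); last by near: L; exact: h.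
by apply/esym; near: L; exact: zetaZ_near.
Unshelve. all: by end_near.
Qed.

Definition zetaZ_mfun : {mfun measurableTypeR R >-> Omega d} :=
  @mfun_Sub _ _ (measurableTypeR R) (Omega d) zetaZ (mem_set measurable_fun_zetaZ).

Definition mu : probability (Omega d) R := distribution (unif R) zetaZ_mfun.

Lemma muE C : mu C = unif R (zetaZ @^-1` C). Proof. by []. Qed.

Lemma ae_good : {ae unif R, forall u, good u}.
Proof.
apply/negligibleP; first by apply: measurableC; exact: measurable_good.
exact: unif_good.
Qed.

(** * Weak convergence of the finite volume laws *)

Local Notation T := (measurableTypeR R).

Lemma integral_zeta (f : Omega d -> R) L :
  (\int[unif R]_(u in [set: T]) (f (zeta L u))%:E = (\sum_(s <- SL L) f s * gp L [set s])%:E)%E.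
Proof.
have mz s : measurable (zeta L @^-1` [set s] : set T) by exact: measurable_zeta.
have iz s : (unif R).-integrable [set: T] (fun u => (\1_(zeta L @^-1` [set s]) u)%:E).
  exact: integrable_indic.
transitivity (\int[unif R]_(u in [set: T])
    \sum_(s <- SL L) ((f s)%:E * (\1_(zeta L @^-1` [set s]) u)%:E))%E.
  apply: eq_integral => u _; have zL := zeta_SL L u.
  rewrite (big_fsetD1 _ zL)/= indicE mem_set//= mule1 big1_seq ?adde0// => s.
  rewrite in_fsetD1 => /andP[_ /andP[sz _]]; rewrite indicE memNset ?mule0//= => e.
  by rewrite e eqxx in sz.
rewrite integral_sum//; last by move=> s; apply: integrableZl.
rewrite -sumEFin; apply: eq_bigr => s _.
by rewrite integralZl// integral_indic// setIT EFinM; congr (_ * _)%E; exact: unif_zeta.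
Qed.

Lemma measurable_comp_zetaZ (f : Omega d -> R) : measurable_fun setT f ->
  measurable_fun setT (fun u : T => (f (zetaZ u))%:E).
Proof.
by move=> mf; apply/measurable_EFinP; apply: measurableT_comp mf measurable_fun_zetaZ.
Qed.

Lemma integral_mu (f : Omega d -> R) (M : R) : measurable_fun setT f ->
  (forall s, bijective s -> `|f s| <= M) ->
  (\int[mu]_s (f s)%:E = \int[unif R]_(u in [set: T]) (f (zetaZ u))%:E)%E.
Proof.
move=> mf fM; rewrite integral_distribution//.
  by apply/measurable_EFinP.
apply: (@le_integrable _ _ _ _ setT measurableT _ (EFin \o cst M)).
- exact: measurable_comp_zetaZ.
- move=> u _ /=; rewrite lee_fin; apply: le_trans (ler_norm M).
  by apply: fM; exact: zetaZ_bij.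
- exact: finite_measure_integrable_cst.
Qed.

(* Net convergence is tested on cofinal sequences, where dominated convergence applies. *)
Lemma fset_up_cvg_seq (F : {fset E} -> R) (l : R) :
  (forall Ls : nat -> {fset E}, (forall n, (win E n `<=` Ls n)%fset) ->
     F (Ls n) @[n --> \oo] --> l) ->
  F L @[L --> @fset_up E] --> l.
Proof.
move=> h; apply/cvgrPdist_le => e e0; apply: contrapT => hn.
have key n : exists L, (win E n `<=` L)%fset /\ ~ `|l - F L| <= e.
  apply: contrapT => hk; apply: hn; apply/near_win; exists n => L nL.
  by apply: contrapT => hl; apply: hk; exists L.
have [Ls hLs] := choice key.
have /cvgrPdist_le/(_ e e0)[N _ /(_ N (leqnn N))] := h Ls (fun n => (hLs n).1).
by have [] := hLs N.
Qed.

(** For good [u] the coupled configurations agree with the limit on any finite set from some volume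
    on, so continuity gives pointwise convergence and dominated convergence applies. Both are
    bijections, where [f] is known to be bounded and continuous. *)
Lemma cvg_zeta_integral (f : Omega d -> R) (M : R) : measurable_fun setT f ->
  (forall s, bijective s -> `|f s| <= M) -> contS f ->
  \sum_(s <- SL L) f s * gp L [set s] @[L --> @fset_up E] -->
  fine (\int[mu]_s (f s)%:E)%E.
Proof.
move=> mf fM fc; apply: fset_up_cvg_seq => Ls hLs.
have intM : (unif R).-integrable [set: T] (EFin \o cst M).
  exact: finite_measure_integrable_cst.
have mz n : measurable_fun [set: T] (fun u => (f (zeta (Ls n) u))%:E).
  by apply/measurable_EFinP; apply: measurableT_comp mf (measurable_fun_zeta _).
have cz : {ae unif R, forall u, [set: T] u ->
    (f (zeta (Ls n) u))%:E @[n --> \oo] --> (f (zetaZ u))%:E}.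
  apply: (@filterS _ _ (ae_filter_ringOfSetsType (unif R)) _ _ _ ae_good) => u gu _.
  apply: cvg_EFin; first exact: nearW.
  apply/cvgrPdist_lt => e e0 /=.
  have [F hF] := fc (zetaZ u) (zetaZ_bij u) e e0.
  have /near_win[N hN] := zetaZ_near_agree F gu.
  exists N => // n /= Nn; rewrite distrC; apply: hF; first exact: SL_bij (zeta_SL _ _).
  by apply/agreeP; apply: hN; exact: fsubset_trans (win_mono _ Nn) (hLs n).
have bz : {ae unif R, forall u n, [set: T] u -> (`|(f (zeta (Ls n) u))%:E| <= (EFin \o cst M) u)%E}.
  apply: aeW => u n _ /=; rewrite lee_fin; apply: fM.
  exact: SL_bij (zeta_SL _ _).
have [_ _] := dominated_convergence measurableT mz (measurable_comp_zetaZ mf) cz intM bz.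
rewrite -(integral_mu mf fM) => h.
have fin : (\int[mu]_s (f s)%:E)%E \is a fin_num.
  rewrite (integral_mu mf fM); apply: integrable_fin_num => //.
  apply: (@le_integrable _ _ _ _ setT measurableT _ (EFin \o cst M)) => //.
  - exact: measurable_comp_zetaZ.
  - move=> u _ /=; rewrite lee_fin; apply: le_trans (ler_norm M).
    by apply: fM; exact: zetaZ_bij.
rewrite -(fineK fin) in h.
apply: cvg_trans (fine_cvg h); apply: near_eq_cvg; apply: nearW => n /=.
by rewrite integral_zeta.
Qed.

Lemma measurable_eval x y : measurable ([set s | s x = y] : set (Omega d)).
Proof. by apply: sub_sigma_algebra; exists x, y. Qed.

Lemma measurable_at x (P : set E) : measurable ([set s | P (s x)] : set (Omega d)).
Proof.
rewrite (_ : [set _ | _] = [set s | exists w, P w /\ s x = w]).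
  apply: (@measurable_exists _ _ _ (fun w => [set s : Omega d | P w /\ s x = w])) => w.
  by apply: measurable_and; exact: measurable_eval.
by apply/seteqP; split=> s /= => [h|[w [h ->]]]//; exists (s x).
Qed.

Lemma measurable_pset A t : measurable (pset A t).
Proof.
rewrite (_ : pset A t = [set s | forall x, x \in A -> s x = t x]).
  apply: (@measurable_forall _ _ _ (fun x => [set s : Omega d | x \in A -> s x = t x])) => x.
  by apply: measurable_imply => _; exact: measurable_eval.
by apply/seteqP; split=> s /agreeP.
Qed.

Lemma measurable_fincyc : measurable ([set s | fincyc s] : set (Omega d)).
Proof.
apply: (@measurable_forall _ _ _ (fun x => [set s | exists k, x \in (pat k).1 /\ bit k s])) => x.
apply: (@measurable_exists _ _ _ (fun k => [set s | x \in (pat k).1 /\ bit k s])) => k.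
by apply: measurable_and; exact: measurable_pset.
Qed.

Lemma contS_pset A t : contS (\1_(pset A t) : Omega d -> R).
Proof.
move=> s _ e e0; exists A => s' _ /agreeP h; rewrite !indicE.
rewrite (_ : (s' \in pset A t) = (s \in pset A t)) ?subrr ?normr0//.
apply/idP/idP; rewrite !inE /pset/= => h'; apply: agree_trans h' => //.
by rewrite agree_sym.
Qed.

(** A pattern indicator depends on finitely many sites, hence is continuous; weak convergence and
    [cvg_gp_pset] give two limits of the same net. *)
Lemma mu_pset A t : t \in SL A -> mu (pset A t) = (wt v A t * rho A)%:E.
Proof.
move=> tA; have mp := measurable_pset A t.
have h1 : forall s, bijective s -> `|\1_(pset A t) s : R| <= 1.
  by move=> s _; rewrite indicE; case: (_ \in _); rewrite ?normr1// normr0.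
have := cvg_zeta_integral (measurable_indic mp) h1 (@contS_pset A t).
rewrite integral_indic// setIT => hc.
have <- : fine (mu (pset A t)) = wt v A t * rho A.
  apply: cvg_unique hc _; first exact: Rhausdorff.
  apply: cvg_trans (cvg_gp_pset tA).
  apply: near_eq_cvg; apply: nearW => L.
  rewrite {1}/gp mulr_suml [LHS]big_mkcond/=; apply: eq_big_seq => s sL.
  by rewrite indicE gp1//; case: ifP; rewrite ?mul1r ?mul0r.
by rewrite fineK// fin_num_measure.
Qed.

Lemma mu_fincyc : mu [set s | fincyc s] = 1%E.
Proof.
rewrite muE (_ : _ @^-1` _ = setT) ?probability_setT//.
by apply/seteqP; split=> // u _; exact: zetaZ_fincyc.
Qed.

End FiniteVolume.

(** * Patterns as a generating pi-system on finite-cycle configurations *)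

Section PatternInduction.
Variable d : nat.
Local Notation E := (site d).
Implicit Types (L A B U : {fset E}) (s t : Omega d) (x y z : E) (C D : set (Omega d)).

Lemma fincyc_cover s L : fincyc s -> exists k, (L `<=` (pat d k).1)%fset /\ bit k s.
Proof.
move=> fs; move: L; apply: fset1U_rect => [|x L _ [k [Lk sk]]].
  have [k pk] := pat_surj (SL_id (@fset0 E)).
  by exists k; rewrite fsub0set; split=> //; rewrite /bit pk; apply/agreeP.
have [l [xl sl]] := fs x.
have [gS e2] := inter_pset (patP _ l) (patP _ k) sl sk.
have [m pm] := pat_surj gS; exists m; rewrite /bit pm/=; split.
  by rewrite fsubUset fsub1set in_fsetU xl (fsubset_trans Lk)// fsubsetUr.
have : (pset (pat d l).1 (pat d l).2 `&` pset (pat d k).1 (pat d k).2) s by [].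
by rewrite e2.
Qed.

Definition psets L : set (set (Omega d)) :=
  [set C | C = set0 \/ exists A t, [/\ (L `<=` A)%fset, t \in SL A & C = pset A t]].

Lemma psets_setI L : setI_closed (psets L).
Proof.
move=> C D [->|[A [t [LA tA ->]]]]; first by left; rewrite set0I.
move=> [->|[B [u [LB uB ->]]]]; first by left; rewrite setI0.
have [[s [sA sB]]|/forallNP h] := pselect (exists s, agree A s t /\ agree B s u).
  have [gS ->] := inter_pset tA uB sA sB; right; do 2 eexists; split; last reflexivity.
    exact: fsubset_trans (fsubsetUl _ _).
  exact: gS.
by left; apply/seteqP; split=> s //= [sA sB]; exact: (h s).
Qed.

Local Notation TL L := (g_sigma_algebraType (psets L)).

Lemma measurable_psets_fincyc L : measurable ([set s | fincyc s] : set (TL L)).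
Proof.
rewrite (_ : [set _ | _] = [set s | forall x, exists k,
    ((L `<=` (pat d k).1)%fset /\ x \in (pat d k).1) /\ bit k s]).
  apply: (@measurable_forall _ (TL L) _ (fun x => [set s | exists k,
    ((L `<=` (pat d k).1)%fset /\ x \in (pat d k).1) /\ bit k s])) => x.
  apply: (@measurable_exists _ (TL L) _ (fun k => [set s |
    ((L `<=` (pat d k).1)%fset /\ x \in (pat d k).1) /\ bit k s])) => k.
  have [h|h] := pselect ((L `<=` (pat d k).1)%fset /\ x \in (pat d k).1).
    apply: sub_sigma_algebra; right; exists (pat d k).1, (pat d k).2.
    split; [by case: h|exact: patP|].
    by apply/seteqP; split=> s /=; [case|].
  by rewrite (_ : [set _ | _] = set0)//; apply/seteqP; split=> s //= [].
apply/seteqP; split=> s /= fs x; last by have [k [[_ ?] ?]] := fs x; exists k.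
have [k [Lk sk]] := fincyc_cover (x |` L)%fset fs; exists k; split=> //.
by move: Lk; rewrite fsubUset fsub1set => /andP[].
Qed.

(** On a finite-cycle configuration [s x = y] holds exactly when one of countably many patterns
    containing [x] and [L] and sending [x] to [y] is satisfied. *)
Lemma measurable_psets_setI L C : measurable C -> measurable (C `&` [set s | fincyc s] : set (TL L)).
Proof.
have mF := @measurable_psets_fincyc L.
suff h : <<s @cylinders d >> `<=` [set C | measurable (C `&` [set s | fincyc s] : set (TL L))] by exact: h.
apply: smallest_sub.
  split=> [|D mD|F mF'] /=.
  - by rewrite set0I.
  - rewrite setTD (_ : ~` D `&` _ = [set s | fincyc s] `\` (D `&` [set s | fincyc s])).
      exact: measurableD.
    apply/seteqP; split=> s /= [h1 h2]; split=> //; first by case.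
    by move=> Ds; apply: h2.
  - by rewrite setI_bigcupl; apply: bigcupT_measurable => n; exact: mF'.
move=> _ [x [y ->]] /=.
rewrite (_ : _ `&` _ = [set s | fincyc s] `&` [set s | exists k,
    [/\ (L `<=` (pat d k).1)%fset, x \in (pat d k).1 & (pat d k).2 x = y] /\ bit k s]).
  apply: measurableI => //.
  apply: (@measurable_exists _ (TL L) _ (fun k => [set s |
    [/\ (L `<=` (pat d k).1)%fset, x \in (pat d k).1 & (pat d k).2 x = y] /\ bit k s])) => k.
  have [h|h] := pselect [/\ (L `<=` (pat d k).1)%fset, x \in (pat d k).1 & (pat d k).2 x = y].
    apply: sub_sigma_algebra; right; exists (pat d k).1, (pat d k).2.
    split; [by case: h|exact: patP|].
    by apply/seteqP; split=> s /=; [case|].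
  by rewrite (_ : [set _ | _] = set0)//; apply/seteqP; split=> s //= [].
apply/seteqP; split=> s /= [].
  move=> sxy fs; split=> //; have [k [Lk sk]] := fincyc_cover (x |` L)%fset fs; exists k; split=> //.
  move: Lk; rewrite fsubUset fsub1set => /andP[xk Lk]; split=> //.
  by rewrite -(agreeP _ _ _ sk).
by move=> fs [k [[_ xk <-] sk]]; split=> //; exact: (agreeP _ _ _ sk).
Qed.

(* Modulo the finite-cycle configurations, the patterns on sets containing [L] form a
   generating pi-system. *)
Lemma pset_induction L (H : set (Omega d) -> Prop) :
  H setT ->
  (forall C, measurable C -> H C -> H (~` C)) ->
  (forall F : (set (Omega d))^nat, (forall n, measurable (F n)) -> trivIset setT F ->
     (forall n, H (F n)) -> H (\bigcup_n F n)) ->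
  (forall A t, (L `<=` A)%fset -> t \in SL A -> H (pset A t)) ->
  (forall C, measurable C -> H (C `&` [set s | fincyc s]) -> H C) ->
  forall C, measurable C -> H C.
Proof.
move=> HT HC HU Hp HF C mC; apply: HF => //.
have sub : @measurable _ (TL L) `<=` @measurable _ (Omega d).
  apply: smallest_sub; first exact: sigma_algebra_measurable.
  by move=> _ [->//|[A [t [_ _ ->]]]]; exact: measurable_pset.
apply: (@dynkin_induction _ (TL L) (psets L) H) => //.
- exact: psets_setI.
- move=> _ [->|[A [t [LA tA ->]]]]; last exact: Hp.
  by rewrite -setCT; exact: HC.
- by move=> D /sub; exact: HC.
- by move=> F mF; apply: HU => n; apply: sub.
- exact: measurable_psets_setI.
Qed.

Lemma measurableI_fincyc C : measurable C -> measurable (C `&` [set s | fincyc s]).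
Proof. by move=> mC; apply: measurableI => //; exact: measurable_fincyc. Qed.

Variable R : realType.

Lemma probability_bigcup_eq (mu nu : probability (Omega d) R) (F : (set (Omega d))^nat) :
  (forall n, measurable (F n)) -> trivIset setT F -> (forall n, mu (F n) = nu (F n)) ->
  mu (\bigcup_n F n) = nu (\bigcup_n F n).
Proof.
move=> mF tF h; rewrite !measure_bigcup//.
by apply: eq_eseriesr => n _; exact: h.
Qed.

Lemma eq_probability_pset L (mu nu : probability (Omega d) R) :
  mu [set s | fincyc s] = 1%E -> nu [set s | fincyc s] = 1%E ->
  (forall A t, (L `<=` A)%fset -> t \in SL A -> mu (pset A t) = nu (pset A t)) ->
  forall C, measurable C -> mu C = nu C.
Proof.
move=> mu1 nu1 h; apply: (@pset_induction L) => //.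
- by rewrite !probability_setT.
- by move=> C mC e; rewrite !probability_setC// e.
- exact: probability_bigcup_eq.
- have mF := @measurable_fincyc d.
  by move=> C mC; rewrite !prob_setI_full.
Qed.

End PatternInduction.

(** * Invariance of the limit law under resampling in a finite set *)

Section Resampling.
Variables (R : realType) (d : nat) (v : site d -> R).
Hypotheses (v_ge0 : forall x, 0 <= v x) (v_le1 : forall x, v x <= 1) (v0 : v 0 = 1).
Local Notation E := (site d).
Implicit Types (L A B U : {fset E}) (s t xi : Omega d) (x y z : E) (C D : set (Omega d)).

Definition pinv s : Omega d := fun y => xget y [set x | s x = y].

Lemma pinvK s : bijective s -> cancel s (pinv s).
Proof.
move=> /bij_inj si x; rewrite /pinv; case: xgetP => [y _ /= /si//|/(_ x)].
by case.
Qed.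

Lemma pinvKV s : bijective s -> cancel (pinv s) s.
Proof.
by move=> bs y; have [g gs sg] := bs; rewrite -{1}(sg y) pinvK.
Qed.

Lemma pinv_SL L s : s \in SL L -> pinv s \in SL L.
Proof.
move=> sL; have bs := SL_bij sL; apply/SLP; split.
  by exists s; [exact: pinvKV|exact: pinvK].
by move=> x xL; rewrite -{1}(SL_out sL xL) pinvK.
Qed.

Lemma sum_SL_pinv L (F : Omega d -> R) : \sum_(s <- SL L) F (pinv s) = \sum_(s <- SL L) F s.
Proof.
have inj : {in SL L &, injective pinv}.
  move=> s t sL tL e; apply/funext => x.
  by apply: (can_inj (pinvK (SL_bij (pinv_SL tL)))); rewrite -{1}e !pinvK//; exact: SL_bij sL || exact: SL_bij tL.
transitivity (\sum_(s <- [fset pinv s | s in SL L]%fset) F s).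
  by rewrite big_imfset.
apply: eq_fbigl => s; apply/imfsetP/idP => [[t /= tL ->]|sL]; first exact: pinv_SL.
exists (pinv s); first exact: pinv_SL.
apply/funext => x; apply: (can_inj (pinvK (SL_bij (pinv_SL sL)))).
transitivity x; first exact: pinvK (SL_bij sL) x.
by apply/esym; exact: pinvKV (SL_bij (pinv_SL sL)) x.
Qed.

Lemma sum_SL_mul L t (F : Omega d -> R) : t \in SL L ->
  \sum_(s <- SL L) F (t \o s) = \sum_(s <- SL L) F s.
Proof.
move=> tL; have ti := SL_inj tL.
transitivity (\sum_(s <- [fset (t \o (s : Omega d) : Omega d) | s in SL L]%fset) F s).
  rewrite big_imfset//= => s s' _ _ e; apply/funext => x; apply: ti.
  exact: (congr1 (fun f => f x) e).
apply: eq_fbigl => s; apply/imfsetP/idP => [[s' /= s'L ->]|sL]; first exact: SL_comp.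
exists (pinv t \o s : Omega d); first by apply: SL_comp => //; exact: pinv_SL.
by apply/funext => x /=; rewrite pinvKV//; exact: SL_bij tL.
Qed.

(* For a bijection [xi] the configurations equal to [xi] outside [L] are the [xi \o p] with
   [p] a permutation of [L]. *)
Definition Zres L xi : R := \sum_(p <- SL L) wt v L (xi \o p).
Definition hres L (p : Omega d) xi : R := wt v L (xi \o p) / Zres L xi.
Definition gres L xi C : R := \sum_(p <- SL L | (xi \o p : Omega d) \in C) hres L p xi.

Lemma Zres_ge0 L xi : 0 <= Zres L xi.
Proof. by apply: sumr_ge0 => p _; exact: wt_ge0. Qed.

Lemma hres_ge0 L p xi : 0 <= hres L p xi.
Proof. by rewrite divr_ge0 ?wt_ge0 ?Zres_ge0. Qed.

Lemma wt_le_Zres L xi : wt v L xi <= Zres L xi.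
Proof.
rewrite /Zres (big_fsetD1 _ (SL_id L))/= lerDl.
by apply: sumr_ge0 => p _; exact: wt_ge0.
Qed.

Lemma agree_comp L s t (p : Omega d) : p \in SL L -> agree L s t -> agree L (s \o p) (t \o p).
Proof. by move=> pL /agreeP h; apply/agreeP => x xL /=; apply: h; rewrite (SL_stable _ pL). Qed.

Lemma eq_Zres L s t : agree L s t -> Zres L s = Zres L t.
Proof. by move=> h; apply: eq_big_seq => p pL; apply: eq_wt; exact: agree_comp. Qed.

Lemma eq_hres L p s t : p \in SL L -> agree L s t -> hres L p s = hres L p t.
Proof.
by move=> pL h; rewrite /hres (eq_Zres h) (eq_wt _ (agree_comp pL h)).
Qed.

(** The restriction to [L], recorded as the list of its values, ranges over a countable type; a
    preimage is a countable union of sets [pset L t]. *)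
Lemma measurable_local L (dT : measure_display) (T : measurableType dT) (f : Omega d -> T) :
  (forall s t, agree L s t -> f s = f t) -> measurable_fun setT f.
Proof.
move=> hf _ C _; rewrite setTI.
rewrite (_ : _ @^-1` _ = [set s | exists r : seq E, (exists2 t, f t \in C & map t (enum_fset L) = r)
   /\ map s (enum_fset L) = r]).
  apply: (@measurable_exists _ _ _ (fun r : seq E => [set s : Omega d |
   (exists2 t, f t \in C & map t (enum_fset L) = r) /\ map s (enum_fset L) = r])) => r.
  have [h|h] := pselect (exists2 t, f t \in C & map t (enum_fset L) = r); last first.
    by rewrite (_ : [set _ | _] = set0)//; apply/seteqP; split=> s //= [].
  have [t _ tr] := h; rewrite (_ : [set _ | _] = pset L t); first exact: measurable_pset.
  apply/seteqP; split=> s /=.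
    by move=> [_ e]; apply/agreeP => x xL; move: e; rewrite -tr => /eq_in_map; exact.
  by move=> /agreeP e; split=> //; rewrite -tr; apply/eq_in_map => x; exact: e.
apply/seteqP; split=> s /=.
  by move=> Cs; eexists; split; last reflexivity; exists s => //; rewrite inE.
move=> [r [[t Ct tr] sr]]; suff -> : f s = f t by rewrite inE in Ct.
apply: hf; apply/agreeP => x xL; have /eq_in_map : map s (enum_fset L) = map t (enum_fset L).
  by rewrite sr tr.
exact.
Qed.

Lemma measurable_compr (p : Omega d) : measurable_fun setT (fun s : Omega d => s \o p : Omega d).
Proof. by apply: measurable_fun_Omega => x y; exact: measurable_eval. Qed.

Lemma fincyc_comp L p s : p \in SL L -> fincyc s -> fincyc (s \o p : Omega d).
Proof.
move=> pL fs x; have [k [Lk sk]] := fincyc_cover (x |` L)%fset fs.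
move: Lk; rewrite fsubUset fsub1set => /andP[xk Lk].
have [m pm] := pat_surj (SL_comp (patP _ k) (SLS Lk pL)).
exists m; rewrite pm; split=> //; rewrite /bit pm/=.
by apply: agree_comp; [exact: SLS pL|].
Qed.

Section Measure.
Variables (mu : probability (Omega d) R) (rho : {fset E} -> R).
Hypotheses (mu_fin : mu [set s | fincyc s] = 1%E)
  (mu_pat : forall A t, t \in SL A -> mu (pset A t) = (wt v A t * rho A)%:E).

Lemma mu_full C : measurable C -> mu (C `&` [set s | fincyc s]) = mu C.
Proof. by move=> mC; apply: prob_setI_full => //; exact: measurable_fincyc. Qed.

Lemma mu_null C : measurable C -> C `<=` ~` [set s | fincyc s] -> mu C = 0%E.
Proof.
move=> mC h; rewrite -mu_full// (_ : _ `&` _ = set0) ?measure0//.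
by apply/seteqP; split=> s //= [/h].
Qed.

Lemma measurable_wt0 L : measurable [set s | wt v L s = 0].
Proof.
have mw : measurable_fun setT (wt v L) by apply: (@measurable_local L _ (measurableTypeR R)) => s t; exact: eq_wt.
by rewrite -[X in measurable X]setTI; exact: (mw measurableT [set 0]).
Qed.

(** Zero weight on [L] persists on every pattern covering [L], and there are countably many such
    patterns, each of measure 0. Hence [Zres] is almost surely positive and the [hres] sum to 1. *)
Lemma mu_wt0 L : mu [set s | wt v L s = 0] = 0%E.
Proof.
rewrite -mu_full; last exact: measurable_wt0.
pose F k := if (L `<=` (pat d k).1)%fset && (wt v (pat d k).1 (pat d k).2 == 0)
  then pset (pat d k).1 (pat d k).2 else set0.
have mF k : measurable (F k) by rewrite /F; case: ifP => // _; exact: measurable_pset.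
apply/negligibleP.
  by apply: measurableI; [exact: measurable_wt0|exact: measurable_fincyc].
apply: (@negligibleS _ _ _ _ (\bigcup_k F k)).
  move=> s [/= ws fs]; have [k [Lk sk]] := fincyc_cover L fs; exists k => //.
  by rewrite /F Lk -(eq_wt _ sk) (wtU _ _ Lk) ws mul0r eqxx.
apply: negligible_bigcup => k; apply/negligibleP; first exact: mF.
rewrite /F; case: ifP => [/andP[_ /eqP w0]|_]; last exact: measure0.
by have := mu_pat (patP _ k); rewrite w0 mul0r.
Qed.

Lemma measurable_hres L p : measurable_fun setT (fun s => (hres L p s)%:E).
Proof.
apply/measurable_EFinP.
apply: (@measurable_local (L `|` [fset p x | x in L])%fset _ _ (hres L p)) => s t.
rewrite agreeU => /andP[h1 /agreeP h2]; rewrite /hres (eq_Zres h1); congr (_ / _).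
by apply: eq_wt; apply/agreeP => x xL /=; apply: h2; apply/imfsetP; exists x.
Qed.

Local Notation act p := (fun s : Omega d => s \o p : Omega d).

(** The resampled law: draw [xi] from [mu], then [p] with probability [hres L p xi], and keep
    [xi \o p]. *)
Definition mres L C : \bar R := (\sum_(p <- SL L) \int[mu]_(xi in act p @^-1` C) (hres L p xi)%:E)%E.

Lemma measurable_act p C : measurable C -> measurable (act p @^-1` C).
Proof. by move=> mC; rewrite -[X in measurable X]setTI; exact: measurable_compr. Qed.

Lemma integral_gres L C D : measurable C -> measurable D ->
  (\int[mu]_(xi in D) (gres L xi C)%:E =
   \sum_(p <- SL L) \int[mu]_(xi in D `&` act p @^-1` C) (hres L p xi)%:E)%E.
Proof.
move=> mC mD.
transitivity (\int[mu]_(xi in D) \sum_(p <- SL L)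
   (((fun xi => (hres L p xi)%:E) \_ (act p @^-1` C)) xi))%E.
  apply: eq_integral => xi _; rewrite /gres -sumEFin big_mkcond/=.
  by apply: eq_bigr => p _; rewrite patchE; congr (if _ then _ else _); apply/idP/idP; rewrite !inE.
rewrite ge0_integral_sum//.
- by apply: eq_bigr => p _; rewrite integral_mkcondr.
- move=> p; apply: measurable_funTS; apply/(measurable_restrictT _ (measurable_act p mC)).
  by apply: measurable_funTS; exact: measurable_hres.
- by move=> p xi _; apply: erestrict_ge0 => s _; rewrite lee_fin hres_ge0.
Qed.

Lemma mresT L : mres L setT = 1%E.
Proof.
have gE := @integral_gres L setT setT measurableT measurableT.
rewrite /mres -[RHS](probability_setT mu) -[RHS]mul1e -integral_cst//.
transitivity (\int[mu]_(xi in setT) (gres L xi setT)%:E)%E.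
  by rewrite gE; apply: eq_bigr => p _; rewrite setTI.
apply: ae_eq_integral => //.
  apply/measurable_EFinP; apply: (@measurable_local L _ _ (fun xi => gres L xi setT)) => s t st.
  rewrite /gres big_seq_cond [RHS]big_seq_cond; apply: eq_big => [p|p /andP[pL _]].
    by rewrite !in_setT.
  exact: eq_hres.
apply: (@negligibleS _ _ _ _ [set s | wt v L s = 0]); last first.
  by apply/negligibleP; [exact: measurable_wt0|exact: mu_wt0].
move=> s /= h; apply: contrapT => /eqP ws; apply: h => _ /=.
rewrite /gres (eq_bigl xpredT) => [|p]; last by rewrite in_setT.
rewrite /hres -mulr_suml divff// lt0r_neq0// (lt_le_trans _ (wt_le_Zres _ _))//.
by rewrite lt0r ws wt_ge0.
Qed.

Lemma eq_integral_full (f : Omega d -> \bar R) C D : measurable C -> measurable D ->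
  measurable_fun setT f -> (forall s, (0 <= f s)%E) ->
  C `&` [set s | fincyc s] = D `&` [set s | fincyc s] ->
  (\int[mu]_(xi in C) f xi = \int[mu]_(xi in D) f xi)%E.
Proof.
move=> mC mD mf f0 e; have mF := @measurable_fincyc d.
suff key C' : measurable C' ->
    (\int[mu]_(xi in C') f xi = \int[mu]_(xi in C' `&` [set s | fincyc s]) f xi)%E.
  by rewrite key// [RHS]key// e.
move=> mC'; have mCc := measurableC mF.
rewrite -[in LHS](setIT C') -(setUv [set s | fincyc s]) setIUr ge0_integral_setU//; last 4 first.
- exact: measurableI.
- exact: measurableI.
- exact: measurable_funTS.
- by rewrite disj_set2E setIACA setICr setI0.
rewrite [X in (_ + X = _)%E]null_set_integral ?adde0//.
- exact: measurableI.
- exact: measurable_funTS.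
- by apply: mu_null; [exact: measurableI|apply: subIsetr].
Qed.

Lemma mresU L C : measurable C -> (mres L C + mres L (~` C) = 1)%E.
Proof.
move=> mC; rewrite -(mresT L) /mres -big_split/=; apply: eq_bigr => p _.
rewrite -ge0_integral_setU//.
- by rewrite -preimage_setU setUv.
- exact: measurable_act.
- by apply: measurable_act; exact: measurableC.
- by apply: measurable_funTS; exact: measurable_hres.
- by move=> s _; rewrite lee_fin hres_ge0.
- by rewrite disj_set2E -preimage_setI setICr preimage_set0.
Qed.

Lemma mres_ge0 L C : (0 <= mres L C)%E.
Proof. by apply: sume_ge0 => p _; apply: integral_ge0 => s _; rewrite lee_fin hres_ge0. Qed.

Lemma mres_setC L C : measurable C -> mres L (~` C) = (1 - mres L C)%E.
Proof.
move=> mC; have h := mresU L mC; rewrite -h [X in (X - _)%E]addeC addeK// ge0_fin_numE ?mres_ge0//.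
by rewrite (@le_lt_trans _ _ 1%E) ?ltry// -h leeDl// mres_ge0.
Qed.

Lemma mres_bigcup L (F : (set (Omega d))^nat) : (forall n, measurable (F n)) -> trivIset setT F ->
  (mres L (\bigcup_n F n) = \sum_(n <oo) mres L (F n))%E.
Proof.
move=> mF tF; rewrite /mres nneseries_sum; last first.
  by move=> p n _; apply: integral_ge0 => s _; rewrite lee_fin hres_ge0.
apply: eq_bigr => p _; rewrite preimage_bigcup ge0_integral_bigcup//.
- by move=> n; exact: measurable_act.
- by apply: measurable_funTS; exact: measurable_hres.
- by move=> s _; rewrite lee_fin hres_ge0.
- by move=> i j _ _ [s [/= h1 h2]]; apply: tF => //; exists (s \o p).
Qed.

Lemma act_pset L A t p : (L `<=` A)%fset -> p \in SL L ->
  act p @^-1` pset A t = pset A (t \o pinv p).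
Proof.
move=> LA pL; have pA := SLS LA pL; have bp := SL_bij pL.
apply/seteqP; split=> s; rewrite /pset/= => /agreeP h; apply/agreeP => x xA /=.
  by rewrite -h/= ?pinvKV// (SL_stable _ (pinv_SL pA)).
by rewrite h ?(SL_stable _ pA)//= pinvK.
Qed.

(** After resampling by [p], pattern [t] comes from pattern [t \o pinv p], where [hres] is constant
    with value [wt v L t / Zres L t]. The factor [rho A] and the weight off [L] do not depend on
    [p], and the remaining weights sum to [Zres L t]. *)
Lemma mres_pset L A t : (L `<=` A)%fset -> t \in SL A -> mres L (pset A t) = mu (pset A t).
Proof.
move=> LA tA; rewrite mu_pat// /mres.
transitivity (\sum_(p <- SL L) (wt v L t / Zres L t * (wt v L (t \o pinv p) *
   wt v (A `\` L)%fset t * rho A))%:E)%E.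
  apply: eq_big_seq => p pL; rewrite (act_pset _ LA pL).
  have pA := SLS LA pL; have uA : (t \o pinv p : Omega d) \in SL A.
    by apply: SL_comp => //; exact: pinv_SL.
  have bp := SL_bij pL.
  transitivity (\int[mu]_(xi in pset A (t \o pinv p)) (cst (wt v L t / Zres L t)%:E xi))%E.
    apply: eq_integral => xi; rewrite inE /pset/= => xiA.
    rewrite (eq_hres pL (agreeS LA xiA)) /hres; congr (_ / _)%:E.
      by congr (wt v L _); apply/funext => x /=; rewrite pinvK.
    rewrite /Zres -(sum_SL_mul (fun q => wt v L (t \o q)) (pinv_SL pL)).
    by apply: eq_bigr.
  rewrite integral_cst; last exact: measurable_pset.
  rewrite [X in (_ * X)%E](mu_pat uA) -EFinM (wtU _ _ LA); congr (_ * (_ * _ * _))%:E.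
  apply: eq_wt; apply/agreeP => x; rewrite in_fsetD => /andP[xL _] /=.
  by rewrite (SL_out (pinv_SL pL)).
rewrite sumEFin; congr EFin; rewrite -mulr_sumr -!mulr_suml.
rewrite (sum_SL_pinv L (fun q => wt v L (t \o q))) -/(Zres L t) (wtU _ _ LA).
(* If the normalization vanishes, so does [wt v L t], which it dominates; both sides are then 0. *)
have [Z0|Z0] := eqVneq (Zres L t) 0; last by rewrite -[X in _ * X]mulrA mulrA divfK// mulrA.
have -> : wt v L t = 0; last by rewrite !mul0r.
by apply/eqP; rewrite eq_le wt_ge0// andbT -Z0 wt_le_Zres.
Qed.

Lemma mu_mres L C : measurable C -> mu C = mres L C.
Proof.
move: C; apply: (@pset_induction _ L) => //.
- by rewrite mresT probability_setT.
- by move=> C mC e; rewrite mres_setC// probability_setC// e.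
- move=> F mF tF e; rewrite mres_bigcup// measure_bigcup//.
  rewrite (eq_eseriesl (Q := xpredT)) => [|n]; last by rewrite in_setT.
  by apply: eq_eseriesr => n _; exact: e.
- by move=> A t LA tA; rewrite mres_pset.
- move=> C mC; rewrite mu_full// => ->; apply: eq_big_seq => p pL.
  have mf := measurable_hres L p.
  apply: eq_integral_full => //.
  - by apply: measurable_act; exact: measurableI_fincyc.
  - exact: measurable_act.
  - by move=> s; rewrite lee_fin hres_ge0.
  apply/seteqP; split=> s /= [h fs]; first by case: h.
  by do 2 split=> //; exact: fincyc_comp pL fs.
Qed.

(* Resampling inside [L] leaves events of the exterior sigma-algebra unchanged. *)
Lemma dlr L C (B : set (Omega d)) : measurable C -> measurable B ->
  (forall s p, p \in SL L -> B (s \o p) <-> B s) ->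
  (mu (C `&` B) = \int[mu]_(xi in B) (gres L xi C)%:E)%E.
Proof.
move=> mC mB hB; rewrite (mu_mres L); last exact: measurableI.
rewrite integral_gres// /mres; apply: eq_big_seq => p pL.
congr (integral _ _ _); apply/seteqP; split=> s /= [h1 h2]; split=> //.
  exact/(hB s p pL).
exact/(hB s p pL).
Qed.

End Measure.
End Resampling.

(** * The DLR condition for the limit law *)

Section GibbsProperty.
Variables (R : realType) (d : nat) (V : site d -> \bar R) (a : R).
Hypotheses (V_ge0 : forall x, (0 <= V x)%E) (V0 : V 0 = 0%E) (a_gt0 : 0 < a).
Local Notation E := (site d).
Implicit Types (L A B U : {fset E}) (s t xi : Omega d) (x y z : E) (C D : set (Omega d)).
Local Notation v := (bw V a).

Lemma SLx_bij L xi : bijective xi ->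
  SLx L xi = [set` [fset (xi \o (p : Omega d) : Omega d) | p in SL L]%fset].
Proof.
move=> bx; apply/seteqP; split=> s /=.
  move=> [bs h]; apply/imfsetP; exists (pinv xi \o s : Omega d).
    apply/SLP; split.
      apply: bij_comp bs; exists xi; [exact: pinvKV|exact: pinvK].
    by move=> x xL /=; rewrite h// pinvK.
  by apply/funext => x /=; rewrite pinvKV.
move=> /imfsetP[p /= pL ->]; split; first exact: bij_comp bx (SL_bij pL).
by move=> x xL /=; rewrite (SL_out pL).
Qed.

Lemma SLx_trans L xi s : SLx L xi s -> SLx L xi = SLx L s.
Proof.
move=> [bs h]; apply/seteqP; split=> t [bt h']; split=> // x xL.
  by rewrite h' ?h.
by rewrite h' ?h.
Qed.

Lemma finite_SLx L xi : finite_set (SLx L xi).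
Proof.
have [[s hs]|/forallNP h] := pselect (exists s, SLx L xi s).
  by rewrite (SLx_trans hs) SLx_bij; [exact: finite_fset|case: hs].
by rewrite (_ : SLx L xi = set0)//; apply/seteqP; split=> s //= /h.
Qed.

Lemma Gspec_bij L xi C : bijective xi -> Gspec V a L xi C = gres v L xi C.
Proof.
move=> bx; have inj : {in SL L &, injective (fun p : Omega d => xi \o p : Omega d)}.
  move=> p q _ _ e; apply/funext => x; apply: (bij_inj bx).
  exact: (congr1 (fun f => f x) e).
rewrite /Gspec /gres /hres -mulr_suml /Zpart; congr (_ / _).
  rewrite fsbig_finite; last by apply: finite_setIl; exact: finite_SLx.
  have -> : fset_set (SLx L xi `&` C) =
    [fset s in [fset (xi \o (p : Omega d) : Omega d) | p in SL L] | s \in C]%fset.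
    apply/fsetP => s; rewrite in_fset_set; last by apply: finite_setIl; exact: finite_SLx.
    by rewrite in_setI SLx_bij// mem_setE !inE.
  rewrite big_fset/= big_mkcond big_imfset//= [RHS]big_mkcond/=.
  by apply: eq_bigr => p _; rewrite wHE.
rewrite fsbig_finite; last exact: finite_SLx.
rewrite SLx_bij// set_fsetK big_imfset//=.
by apply: eq_bigr => p _; rewrite wHE.
Qed.

Lemma Gspec_ext L xi s C : SLx L xi s -> Gspec V a L xi C = gres v L s C.
Proof.
move=> h; rewrite -Gspec_bij; last by case: h.
by rewrite /Gspec /Zpart (SLx_trans h).
Qed.

Lemma Gspec_none L xi C : (forall s, ~ SLx L xi s) -> Gspec V a L xi C = 0.
Proof.
move=> h; rewrite /Gspec (_ : SLx L xi `&` C = set0) ?fsbig_set0 ?mul0r//.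
by apply/seteqP; split=> s //= [/h].
Qed.

Lemma GspecE L C : Gspec V a L idfun C = gp v L C.
Proof.
rewrite Gspec_bij; last by exists idfun.
by rewrite /gres /hres -mulr_suml.
Qed.

Lemma measurable_Sperm : measurable (@Sperm d).
Proof.
rewrite (_ : @Sperm d = [set s | forall x y, s x = s y -> x = y] `&`
    [set s | forall y, exists x, s x = y]).
  apply: measurableI.
    apply: (@measurable_forall _ _ _ (fun x => [set s : Omega d | forall y, s x = s y -> x = y])) => x.
    apply: (@measurable_forall _ _ _ (fun y => [set s : Omega d | s x = s y -> x = y])) => y.
    have [->|xy] := eqVneq x y.
      by rewrite (_ : [set _ | _] = setT)//; apply/seteqP; split.
    rewrite (_ : [set _ | _] = ~` [set s | exists z, s x = z /\ s y = z]).
      apply: measurableC.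
      apply: (@measurable_exists _ _ _ (fun z => [set s : Omega d | s x = z /\ s y = z])) => z.
      exact: (measurableI _ _ (measurable_eval x z) (measurable_eval y z)).
    apply/seteqP; split=> s /= h.
      by move=> [z [e1 e2]]; move/eqP: xy; apply; apply: h; rewrite e1 e2.
    by move=> e; exfalso; apply: h; exists (s y).
  apply: (@measurable_forall _ _ _ (fun y => [set s : Omega d | exists x, s x = y])) => y.
  apply: (@measurable_exists _ _ _ (fun x => [set s : Omega d | s x = y])) => x.
  exact: measurable_eval.
apply/seteqP; split=> s /=.
  by move=> [g gs sg]; split=> [x y e|y]; [rewrite -(gs x) e gs|exists (g y)].
move=> [si ss]; apply: inj_surj_bij => [x y|y]; first exact: si.
by have [x <-] := ss y; exists x.
Qed.

(** Overwriting the values on [L] by a list gives a map that only reads [xi] outside [L], hence is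
    measurable for the exterior sigma-algebra; lists are countable. *)
Definition extL L (r : seq E) xi : Omega d :=
  fun x => if x \in L then nth 0 r (index x (enum_fset L)) else xi x.

Local Notation TO L := (g_sigma_algebraType (@outcyl d L)).

Lemma measurable_extL L r : measurable_fun setT (extL L r : TO L -> Omega d).
Proof.
apply: measurable_fun_Omega => x y; have [xL|xL] := boolP (x \in L).
  rewrite (_ : [set _ | _] = [set _ | nth 0 r (index x (enum_fset L)) = y]); last first.
    by apply/seteqP; split=> s /=; rewrite /extL xL.
  exact: measurable_prop.
apply: sub_sigma_algebra; exists x, y; split=> //.
by apply/seteqP; split=> s /=; rewrite /extL (negbTE xL).
Qed.

Lemma measurable_gres L C : measurable C -> measurable_fun setT (fun xi => gres v L xi C).
Proof.
move=> mC.
have -> : (fun xi => gres v L xi C) =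
    (fun xi => \sum_(p <- SL L) hres v L p xi * \1_C (xi \o p : Omega d)).
  apply/funext => xi; rewrite /gres big_mkcond/=; apply: eq_bigr => p _.
  by rewrite indicE; case: ifP; rewrite ?mulr1 ?mulr0.
apply: measurable_sum => p; apply: measurable_funM.
  by apply/measurable_EFinP; apply: measurable_hres.
exact: (measurableT_comp (measurable_indic mC) (measurable_compr p)).
Qed.

(** [Gspec] at [xi] equals [gres] at any bijection that coincides with [xi] outside [L], and is 0 if
    there is none. Searching for such a bijection among the [extL L r xi] uses exterior information
    only. *)
Lemma Gspec_out_measurable L C (U : set R) : measurable C -> measurable U ->
  <<s outcyl L >> ((fun xi => Gspec V a L xi C) @^-1` U).
Proof.
move=> mC mU; suff h : measurable ((fun xi => Gspec V a L xi C) @^-1` U : set (TO L)) by exact: h.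
pose bijr r : set (TO L) := extL L r @^-1` @Sperm d.
have mb r : measurable (bijr r).
  rewrite -[X in measurable X]setTI; apply: measurable_extL => //.
  exact: measurable_Sperm.
have extS r xi : bijective (extL L r xi) -> SLx L xi (extL L r xi).
  by move=> b; split=> // x /negbTE xL; rewrite /extL xL.
have extE xi s : SLx L xi s -> s = extL L (map s (enum_fset L)) xi.
  move=> [bs h]; apply/funext => x; rewrite /extL; case: ifPn => xL; last exact: h.
  by rewrite (nth_map x) ?index_mem// nth_index.
rewrite (_ : _ @^-1` U =
  [set xi | exists r, (bijr r `&` ((fun xi => gres v L (extL L r xi) C) @^-1` U)) xi] `|`
  ([set xi | forall r, (~` bijr r) xi] `&` [set xi | U 0])); last first.
  apply/seteqP; split=> xi /=.
    have [[s hs]|/forallNP h] := pselect (exists s, SLx L xi s).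
      rewrite (Gspec_ext _ hs) => Us; left; exists (map s (enum_fset L)).
      by rewrite /bijr /preimage/= -(extE _ _ hs); split=> //; case: hs.
    rewrite Gspec_none// => U0; right; split=> // r br; exact: (h _ (extS r xi br)).
  move=> [[r [br Ur]]|[nb U0]]; first by rewrite (Gspec_ext _ (extS r xi br)).
  rewrite Gspec_none// => s hs; apply: (nb (map s (enum_fset L))).
  by rewrite /bijr /preimage/= -(extE _ _ hs); case: hs.
apply: measurableU.
  apply: (@measurable_exists _ (TO L) _
    (fun r => bijr r `&` ((fun xi => gres v L (extL L r xi) C) @^-1` U))) => r.
  apply: measurableI => //; rewrite -[X in measurable X]setTI.
  have mG : measurable ((fun xi => gres v L xi C) @^-1` U : set (Omega d)).
    by rewrite -[X in measurable X]setTI; exact: measurable_gres.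
  exact: (measurable_extL r measurableT mG).
apply: measurableI; first by apply: (@measurable_forall _ (TO L) _ (fun r => ~` bijr r)) => r; exact: measurableC.
exact: measurable_prop.
Qed.

Lemma outcyl_sub L (B' : set (Omega d)) : <<s @outcyl d L >> B' -> measurable (B' : set (Omega d)).
Proof.
move: B'; apply: smallest_sub; first exact: sigma_algebra_measurable.
by move=> _ [x [y [_ ->]]]; exact: measurable_eval.
Qed.

Lemma outcyl_inv L (B' : set (Omega d)) s t : <<s @outcyl d L >> B' ->
  (forall x, x \notin L -> s x = t x) -> B' s <-> B' t.
Proof.
move=> hB st; move: B' hB.
suff h : <<s @outcyl d L >> `<=` [set C | C s <-> C t] by exact: h.
apply: smallest_sub.
  split=> [|C hC|F hF] //=.
    by split=> -[_ h1]; split=> // h2; apply: h1; apply/hC.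
  by split=> -[n _ h]; exists n => //; apply/(hF n).
by move=> _ [x [y [xL ->]]] /=; rewrite st.
Qed.

Section Measure.
Variables (mu : probability (Omega d) R) (rho : {fset E} -> R).
Hypotheses (mu_fin : mu [set s | fincyc s] = 1%E)
  (mu_pat : forall A t, t \in SL A -> mu (pset A t) = (wt v A t * rho A)%:E).

Lemma mu_Gibbs : mu (@Sperm d) = 1%E -> Gibbs V a mu.
Proof.
move=> muS; split=> // L C mC; split=> [U mU|B hB]; first exact: Gspec_out_measurable.
have mB := outcyl_sub hB.
rewrite (dlr (bw_ge0 V a) mu_fin mu_pat (L := L) mC mB); last first.
  by move=> s p pL; apply: outcyl_inv hB _ => x xL /=; rewrite (SL_out pL).
apply: ae_eq_integral => //.
- by apply: measurable_funTS; apply/measurable_EFinP; exact: measurable_gres.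
- apply: measurable_funTS; apply/measurable_EFinP => _ U mU; rewrite setTI.
  by apply: outcyl_sub; exact: Gspec_out_measurable.
- apply: (@negligibleS _ _ _ _ (~` [set s | fincyc s])).
    by move=> s /= h fs; apply: h => _; rewrite Gspec_bij//; exact: fincyc_bij.
  apply/negligibleP; first by apply: measurableC; exact: measurable_fincyc.
  exact: prob_setC_full (@measurable_fincyc d) mu_fin.
Qed.

End Measure.
End GibbsProperty.

(** * Mixing of patterns and ergodicity *)

Section Ergodicity.
Variables (R : realType) (d : nat) (v : site d -> R).
Hypotheses (v_ge0 : forall x, 0 <= v x) (v_le1 : forall x, v x <= 1) (v0 : v 0 = 1).
Local Notation E := (site d).
Local Notation shift := (@Defs.shift d).
Implicit Types (L A B U : {fset E}) (s t : Omega d) (x y z : E) (C D : set (Omega d)).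
Variable b : R.
Hypotheses (b_ge0 : 0 <= b) (b_lt1 : b < 1).
Hypothesis cyc_bound : forall x U,
  \sum_(A <- fpowerset U | nontriv x A) #|` A|%:R * cyc v x A <= b.
Hypothesis cyc_tail : forall e : R, 0 < e -> exists K, forall x U,
  \sum_(A <- fpowerset U | nontriv x A && ~~ within x K A) cyc v x A <= e.
Hypothesis d_gt0 : (0 < d)%N.
Local Notation rho := (rho v).

Lemma ratio_tr z L A : ratio v (tr z L) (tr z A) = ratio v L A.
Proof. by rewrite /ratio -trD !Z_tr. Qed.

Lemma cvg_ratioE A : ratio v L A @[L --> @fset_up E] --> rho A.
Proof. exact: (cvg_ratio v_ge0 v0 b_ge0 b_lt1 cyc_bound cyc_tail). Qed.

Lemma rho_tr z A : rho (tr z A) = rho A.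
Proof.
have h : ratio v (tr z L) (tr z A) @[L --> @fset_up E] --> rho (tr z A).
  apply: (@cvg_comp _ _ _ (tr z) (fun L => ratio v L (tr z A))); last exact: cvg_ratioE.
  move=> P /near_fset_up[L0 hL0]; apply/near_fset_up; exists (tr (- z) L0) => L L0L.
  by apply: hL0; rewrite -(trNK z L0) tr_sub.
apply: (cvg_unique (@Rhausdorff R) h).
rewrite (_ : (fun L => _) = (fun L => ratio v L A)); first exact: cvg_ratioE.
by apply/funext => L; rewrite ratio_tr.
Qed.

(** By [ratioU] the defect is [ratio v L A] times the change in the ratio of the translate of [B]
    when [A] is deleted from the volume. Translating back by [z], [ratio_close] for [B] makes this
    small as soon as [A] is away from a window around the translate. *)
Lemma rho_mixing A B (e : R) : 0 < e -> exists W : {fset E}, forall z,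
  (forall w, w \in W -> w + z \notin A) -> `|rho (A `|` tr z B)%fset - rho A * rho B| <= e.
Proof.
move=> e0; have [K hK] := ratio_close v_ge0 v0 b_ge0 b_lt1 cyc_bound cyc_tail B e0.
exists (B `|` [fset (x + k)%R | x in B, k in K])%fset => z hz.
have hA : (ratio v L A @[L --> @fset_up E] --> rho A) by exact: cvg_ratioE.
have hB : (ratio v L (tr z B) @[L --> @fset_up E] --> rho B).
  by rewrite -(rho_tr z B); exact: cvg_ratioE.
have hAB : ratio v L (A `|` tr z B)%fset @[L --> @fset_up E] --> rho (A `|` tr z B)%fset.
  exact: cvg_ratioE.
have h : `|ratio v L (A `|` tr z B)%fset - ratio v L A * ratio v L (tr z B)|
    @[L --> @fset_up E] --> `|rho (A `|` tr z B)%fset - rho A * rho B|.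
  by apply: cvg_norm; apply: cvgB => //; exact: cvgM.
apply: (closed_cvg [set y : R | y <= e] (@closed_le R e) _ _ h); apply: filterS (fset_up_sub (A `|` tr z B)%fset) => L.
rewrite fsubUset => /andP[AL BL] /=.
rewrite ratioU// -mulrBr normrM; apply: le_trans (ler_piMl _ _) _ => //.
  by rewrite ger0_norm ?ratio_ge0 ?ratio_le1.
have back M : ratio v M (tr z B) = ratio v (tr (- z) M) B by rewrite -(ratio_tr (- z)) trK.
rewrite !back trD; apply: hK.
- rewrite -(tr_sub z) trD !trNK; apply/fsubsetP => x xB; rewrite in_fsetD (fsubsetP BL)// andbT.
  rewrite -(subrK z x); apply: hz; rewrite in_fsetU -in_tr.
  by rewrite xB.
- by rewrite -(tr_sub z) trNK.
- move=> x xB k kK; rewrite in_fsetD !in_tr opprK (_ : _ + z \notin A)//.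
  apply: hz; rewrite in_fsetU; apply/orP; right.
  by apply/imfset2P; exists x => //; exists k.
Qed.

Definition far (n : nat) : E := - const_mx n%:Z.

(** Only the first coordinate is watched: [n] beyond the sums of its absolute values over [A] and
    [W] is too large a displacement. *)
Lemma far_avoid A (W : {fset E}) : exists N, forall n, (N <= n)%N -> forall w, w \in W -> w + far n \notin A.
Proof.
pose c (x : E) : int := x ord0 (Ordinal d_gt0).
exists (\sum_(x <- A) absz (c x) + \sum_(x <- W) absz (c x)).+1%N => n hn w wW; apply/negP => wA.
have e : c (w + far n) = c w - n%:Z by rewrite /c /far !mxE.
have h1 : (absz (c (w + far n)%R) <= \sum_(x <- A) absz (c x))%N.
  by rewrite (big_fsetD1 _ wA)/= leq_addr.
have h2 : (absz (c w) <= \sum_(x <- W) absz (c x))%N by rewrite (big_fsetD1 _ wW)/= leq_addr.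
by rewrite e in h1; lia.
Qed.

Lemma measurable_shift z : measurable_fun setT (shift z).
Proof.
apply: measurable_fun_Omega => x y.
rewrite (_ : [set _ | _] = [set s | s (x - z) = y - z]); first exact: measurable_eval.
apply/seteqP; split=> s; rewrite /Defs.shift/=; first by move=> <-; rewrite addrK.
by move=> ->; rewrite subrK.
Qed.

Lemma fincyc_shift z s : fincyc s -> fincyc (shift z s).
Proof.
move=> fs x; have [k [xk sk]] := fs (x - z).
have [m pm] := pat_surj (shift_SL z (patP _ k)).
by exists m; rewrite /bit pm/= in_tr; split=> //; rewrite agree_shift.
Qed.

Lemma shift_preimage_pset z A t : shift z @^-1` pset A t = pset (tr (- z) A) (shift (- z) t).
Proof.
have h s : agree A (shift z s) t = agree (tr (- z) A) s (shift (- z) t).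
  by rewrite -(agree_shift (- z)) shiftK.
by apply/seteqP; split=> s; rewrite /pset/= h.
Qed.

Section Measure.
Variable mu : probability (Omega d) R.
Hypotheses (mu_fin : mu [set s | fincyc s] = 1%E)
  (mu_pat : forall A t, t \in SL A -> mu (pset A t) = (wt v A t * rho A)%:E).

Definition shift_mfun z : {mfun Omega d >-> Omega d} :=
  @mfun_Sub _ _ (Omega d) (Omega d) (shift z) (mem_set (measurable_shift z)).

Lemma mu_shift z C : measurable C -> mu (shift z @^-1` C) = mu C.
Proof.
have mS := measurable_shift z.
have mF := @measurable_fincyc d.
move: C; apply: (@eq_probability_pset _ _ fset0 (distribution mu (shift_mfun z)) mu) => //.
  apply/eqP; rewrite eq_le probability_le1//= -[in X in (X <= _)%E]mu_fin.
  apply: le_measure; rewrite ?inE//; last by move=> s; exact: fincyc_shift.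
  by rewrite -[X in measurable X]setTI; exact: mS.
move=> A t _ tA; transitivity (mu (shift z @^-1` pset A t)) => //; rewrite shift_preimage_pset.
by rewrite mu_pat ?mu_pat ?shift_SL// rho_tr wt_shift.
Qed.

Local Notation pr C := (fine (mu C)).

Lemma prE C : measurable C -> mu C = (pr C)%:E.
Proof. by move=> mC; rewrite fineK// fin_num_measure. Qed.

Lemma inter_pset_disjoint A B t u : [disjoint A & B]%fset -> t \in SL A -> u \in SL B ->
  exists w, [/\ w \in SL (A `|` B)%fset, pset A t `&` pset B u = pset (A `|` B)%fset w &
    wt v (A `|` B)%fset w = wt v A t * wt v B u].
Proof.
move=> dAB tA uB; have h1 : agree A (t \o u) t.
  apply/agreeP => x xA /=; rewrite (SL_out uB)//.
  exact: (fdisjointP dAB).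
have h2 : agree B (t \o u) u.
  apply/agreeP => x xB /=; rewrite (SL_out tA)//; apply: (fdisjointP_sym dAB).
  by rewrite (SL_stable _ uB).
have [gS e] := inter_pset tA uB h1 h2; eexists; split; [exact: gS|exact: e|].
rewrite (wtU _ _ (fsubsetUl A B)); congr (_ * _).
  apply: eq_wt; apply: agree_trans h1; apply: agreeS (agree_glue _ _ _); exact: fsubsetUl.
rewrite fsetDUl fsetDv fset0U (fsetDidPl _ _ _); last by rewrite fdisjoint_sym.
apply: eq_wt; apply: agree_trans h2; apply: agreeS (agree_glue _ _ _); exact: fsubsetUr.
Qed.

Definition mixes C D : Prop :=
  pr (C `&` (shift (- far n) @^-1` D)) @[n --> \oo] --> pr C * pr D.

Lemma mixes_pset A B t u : t \in SL A -> u \in SL B -> mixes (pset A t) (pset B u).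
Proof.
move=> tA uB; apply/cvgrPdist_le => e e0.
have [W hW] := rho_mixing A B e0.
have [N hN] := far_avoid A (B `|` W)%fset.
exists N => // n /= /hN hn; rewrite shift_preimage_pset opprK.
have dAB : [disjoint A & tr (far n) B]%fset.
  apply/fdisjointP_sym => x; rewrite in_tr => xB.
  by rewrite -(subrK (far n) x); apply: hn; rewrite in_fsetU xB.
have [w [wS -> ww]] := inter_pset_disjoint dAB tA (shift_SL (far n) uB).
rewrite mu_pat// mu_pat// mu_pat//= ww wt_shift mulrACA -mulrBr normrM distrC.
have w1 : `|wt v A t * wt v B u| <= 1.
  by rewrite ger0_norm ?mulr_ge0 ?wt_ge0// mulr_ile1 ?wt_ge0// wt_le1.
apply: le_trans (ler_piMl _ w1) _ => //; apply: hW => y yW.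
by apply: hn; rewrite in_fsetU yW orbT.
Qed.

Lemma mixes_set0 D : mixes set0 D.
Proof.
rewrite /mixes measure0 mul0r (_ : (fun n => _) = cst 0); first exact: cvg_cst.
by apply/funext => n; rewrite set0I measure0.
Qed.

Lemma measurable_far D n : measurable D -> measurable (shift (- far n) @^-1` D).
Proof. by move=> mD; rewrite -[X in measurable X]setTI; exact: measurable_shift. Qed.

Lemma pr_far n D : measurable D -> pr (shift (- far n) @^-1` D) = pr D.
Proof. by move=> mD; rewrite mu_shift. Qed.

Lemma prU C D : measurable C -> measurable D -> C `&` D = set0 ->
  pr (C `|` D) = pr C + pr D.
Proof. by move=> mC mD CD; rewrite measureU// fineD// fin_num_measure. Qed.

Lemma le_pr C D : measurable C -> measurable D -> C `<=` D -> pr C <= pr D.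
Proof. by move=> mC mD CD; rewrite fine_le ?fin_num_measure// le_measure// inE. Qed.

Lemma prD C D : measurable C -> measurable D -> D `<=` C -> pr (C `\` D) = pr C - pr D.
Proof.
move=> mC mD DC; rewrite -{2}(setDUK DC) prU//; first by rewrite addrAC subrr add0r.
  exact: measurableD.
by rewrite setDE setICA setICr setI0.
Qed.

Lemma mixes_setU C C' D : measurable C -> measurable C' -> measurable D -> C `&` C' = set0 ->
  mixes C D -> mixes C' D -> mixes (C `|` C') D.
Proof.
move=> mC mC' mD CC' hC hC'; rewrite /mixes prU// mulrDl.
rewrite (_ : (fun n => _) = (fun n => pr (C `&` (shift (- far n) @^-1` D)) +
  pr (C' `&` (shift (- far n) @^-1` D)))); first exact: cvgD.
apply/funext => n; have mDn := measurable_far n mD.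
by rewrite setIUl prU//; [exact: measurableI|exact: measurableI|rewrite setIACA CC' set0I].
Qed.

Lemma mixes_setC C D : measurable C -> measurable D -> mixes C D -> mixes (~` C) D.
Proof.
move=> mC mD hC; rewrite /mixes.
have prC : pr (~` C) = 1 - pr C by rewrite probability_setC// prE.
rewrite prC mulrBl mul1r.
rewrite (_ : (fun n => _) = (fun n => pr D - pr (C `&` (shift (- far n) @^-1` D)))).
  by apply: cvgB => //; exact: cvg_cst.
apply/funext => n; have mDn := measurable_far n mD.
rewrite -[in RHS](pr_far n mD) -[in X in _ = X - _](setIT (_ @^-1` _)) -(setUv C) setIUr prU//.
- by rewrite setIC addrAC [_ `&` C]setIC subrr add0r.
- exact: measurableI.
- by apply: measurableI => //; exact: measurableC.
- by rewrite setIACA setICr setI0.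
Qed.

(** The three errors get [e / 3] each. Replacing [C] by [C'] changes the probability of the
    intersection by at most [pr C - pr C'], uniformly in [n]. *)
Lemma mixes_approx C D : measurable C -> measurable D ->
  (forall e : R, 0 < e -> exists C', [/\ measurable C', mixes C' D, C' `<=` C & pr C - pr C' <= e]) ->
  mixes C D.
Proof.
move=> mC mD h; apply/cvgrPdist_le => e e0.
have [|C' [mC' hC' sub d1]] := h (e / 3); first by rewrite divr_gt0.
have /cvgrPdist_le/(_ (e / 3))[|N _ hN] := hC'; first by rewrite divr_gt0.
exists N => // n /= /hN; have mDn := measurable_far n mD.
set S := _ @^-1` _ in mDn *; have D1 : pr D <= 1 by rewrite -lee_fin -prE// probability_le1.
have D0 : 0 <= pr D by rewrite fine_ge0.
have e3 : e = e / 3 + e / 3 + e / 3 by lra.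
have mI C0 : measurable C0 -> measurable (C0 `&` S) by move=> ?; exact: measurableI.
have d2 : pr (C `&` S) - pr (C' `&` S) <= pr C - pr C'.
  rewrite -!prD//; [|exact: mI|exact: mI|exact: setSI].
  apply: le_pr; first (by apply: measurableD; exact: mI); first exact: measurableD.
  by move=> s [[Cs Ss] nC]; split=> // C's; exact: nC.
have d3 : pr (C' `&` S) <= pr (C `&` S) by apply: le_pr; [exact: mI|exact: mI|exact: setSI].
have d4 : pr C' <= pr C by exact: le_pr.
rewrite !ler_norml => /andP[h1 h2]; nra.
Qed.

Lemma mixes_bigsetU (F : (set (Omega d))^nat) D N : measurable D ->
  (forall n, measurable (F n)) -> trivIset setT F ->
  (forall n, mixes (F n) D) -> mixes (\big[setU/set0]_(k < N) F k) D.
Proof.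
move=> mD mF tF h; elim: N => [|N IH]; first by rewrite big_ord0; exact: mixes_set0.
rewrite big_ord_recr/=; apply: mixes_setU => //; first exact: bigsetU_measurable.
rewrite -bigcup_mkord; apply/seteqP; split=> // s [[k /= kN Fk] FN].
have e := tF _ _ I I (ex_intro _ s (conj Fk FN)).
by move: kN; rewrite e ltnn.
Qed.

Lemma mixes_bigcup (F : (set (Omega d))^nat) D : measurable D ->
  (forall n, measurable (F n)) -> trivIset setT F ->
  (forall n, mixes (F n) D) -> mixes (\bigcup_n F n) D.
Proof.
move=> mD mF tF h; have mU : measurable (\bigcup_n F n) by exact: bigcup_measurable.
apply: mixes_approx => // e e0.
have c : pr (\big[setU/set0]_(k < n) F k) @[n --> \oo] --> pr (\bigcup_n F n).
  apply: fine_cvg; rewrite -prE// [X in _ --> mu X](_ : _ = \bigcup_n \big[setU/set0]_(k < n) F k).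
    apply: nondecreasing_cvg_mu => // [n||]; first exact: bigsetU_measurable.
      by apply: bigcup_measurable => n _; exact: bigsetU_measurable.
    by move=> m n mn; apply/subsetPset; exact: subset_bigsetU.
  apply/seteqP; split=> s.
    by move=> [n _ Fn]; exists n.+1 => //; rewrite -bigcup_mkord; exists n => /=.
  by move=> [n _]; rewrite -bigcup_mkord => -[k _ Fk]; exists k.
have /cvgrPdist_le/(_ _ e0)[N _ /(_ N (leqnn N)) hN] := c.
exists (\big[setU/set0]_(k < N) F k); split.
- exact: bigsetU_measurable.
- exact: mixes_bigsetU.
- by rewrite -bigcup_mkord => s [k _ Fk]; exists k.
- exact: le_trans (ler_norm _) hN.
Qed.

Lemma mixes_pset_r B u C : u \in SL B -> measurable C -> mixes C (pset B u).
Proof.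
move=> uB; have mB := measurable_pset B u; move: C.
apply: (pset_induction (L := fset0)).
- by rewrite -(setCK setT) setCT; apply: mixes_setC => //; exact: mixes_set0.
- by move=> D mD; exact: mixes_setC.
- by move=> F mF tF; exact: mixes_bigcup.
- by move=> A t _ tA; exact: mixes_pset.
move=> D mD; rewrite /mixes prob_setI_full//; last exact: measurable_fincyc.
apply: cvg_trans; apply: near_eq_cvg; apply: nearW => n.
have mBn := measurable_far n mB.
by rewrite setIAC prob_setI_full//; [exact: measurableI|exact: measurable_fincyc].
Qed.

(** For an invariant [I] the intersection with a translate of [D] has constant probability, so
    mixing with patterns becomes independence from patterns, then from every event. Taking [D = I]
    gives p = p^2. *)
Lemma mu_ergodic : ergodic mu.
Proof.
split=> [z C|I mI inv]; first exact: mu_shift.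
have indep D : measurable D -> mu (I `&` D) = (mu I * mu D)%E.
  move: D; apply: (pset_induction (L := fset0)).
  - by rewrite setIT probability_setT mule1.
  - move=> D mD e; rewrite probability_setC// -setDE measureD//; last by rewrite ltey_eq fin_num_measure.
    by rewrite [X in (_ - X)%E]e muleBr ?mule1 ?fin_num_measure// fin_num_adde_defr// fin_num_measure.
  - move=> F mF tF h; rewrite setI_bigcupr !measure_bigcup//.
    + rewrite [mu I]prE// -nneseriesZl//.
      rewrite -prE//; apply: eq_eseriesr => n _; exact: h.
    + by move=> n _; exact: measurableI.
    + by apply: trivIset_setIl.
  - move=> A t _ tA; have h := mixes_pset_r tA mI.
    have mA := measurable_pset A t.
    rewrite (prE (measurableI _ _ mI mA)) (prE mI) (prE mA).
    rewrite -EFinM; congr EFin.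
    have c : pr (I `&` shift (- far n) @^-1` pset A t) @[n --> \oo] --> pr (I `&` pset A t).
      rewrite (_ : (fun n => _) = cst (pr (I `&` pset A t))); first exact: cvg_cst.
      apply/funext => n; rewrite -{1}(inv (- far n)) -preimage_setI mu_shift//.
      exact: measurableI.
    exact: (cvg_unique (@Rhausdorff R) c h).
  - move=> D mD; rewrite setIA prob_setI_full//; [|exact: measurableI|exact: measurable_fincyc].
    by rewrite (prob_setI_full mD (@measurable_fincyc d) mu_fin).
have := indep I mI; rewrite setIid prE// -EFinM => -[].
move/eqP; rewrite -subr_eq0 -{1}[pr I]mulr1 -mulrBr mulf_eq0 subr_eq0.
by move=> /orP[/eqP->|/eqP<-]; [left|right].
Qed.

End Measure.
End Ergodicity.

(** * Uniqueness among Gibbs measures on finite-cycle permutations *)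

Section Uniqueness.
Variables (R : realType) (d : nat) (V : site d -> \bar R) (a : R).
Hypotheses (V_ge0 : forall x, (0 <= V x)%E) (V0 : V 0 = 0%E) (a_gt0 : 0 < a).
Local Notation E := (site d).
Implicit Types (L A U D K : {fset E}) (s t xi : Omega d) (x y z : E) (C : set (Omega d)).
Local Notation v := (bw V a).

Lemma stable_iter (P : pred E) s x n : (forall y, P y -> P (s y)) -> P x -> P (iter n s x).
Proof. by move=> h; elim: n => //= n IH /IH/h. Qed.

Lemma bij_stable D s : bijective s -> (forall x, x \notin D -> s x \notin D) ->
  forall x, (s x \in D) = (x \in D).
Proof.
move=> [g sg gs] h; have hg x : x \in D -> g x \in D.
  by apply: contraTT => /h; rewrite gs.
have gi : {in D &, injective g} by move=> x y _ _ e; rewrite -(gs x) e gs.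
move=> x; apply/idP/idP; first by apply: contraTT; exact: h.
by move=> /(stable_surj gi hg)[y yD ->]; rewrite gs.
Qed.

(* [xi] preserves [D], and every point of [L] outside [D] has an orbit leaving [L]:
   [D] is the largest invariant subset of [L], and whether this holds is decided by the
   values of [xi] outside [D]. *)
Definition core L D : set (Omega d) :=
  [set s | (forall x, x \notin D -> s x \notin D) /\
           forall x, x \in (L `\` D)%fset -> exists n, iter n s x \notin L].

Lemma measurable_iter n x y : measurable [set s : Omega d | iter n s x = y].
Proof.
elim: n y => [|n IH] y /=.
  exact: measurable_prop.
rewrite (_ : [set _ | _] = [set s | exists z, iter n s x = z /\ s z = y]).
  apply: (@measurable_exists _ _ _ (fun z => [set s : Omega d | iter n s x = z /\ s z = y])) => z.
  exact: (measurableI _ _ (IH z) (measurable_eval z y)).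
by apply/seteqP; split=> s /= => [<-|[z [<- <-]]]//; exists (iter n s x).
Qed.

(** An orbit that starts outside [D] never enters it, so its iterates can be computed after
    overwriting the values on [D], here by the default 0 of [extL D [::]]. *)
Lemma core_outcyl L D : <<s @outcyl d D >> (core L D).
Proof.
pose TD : measurableType _ := g_sigma_algebraType (@outcyl d D).
suff h : measurable (core L D : set TD) by exact: h.
have -> : core L D = [set s : TD | forall x y, x \notin D -> y \in D -> s x <> y] `&`
    [set s : TD | forall x, x \in (L `\` D)%fset -> exists n, iter n (extL D [::] s) x \notin L].
  apply/seteqP; split=> s /=.
    move=> [h1 h2]; split=> [x y xD yD e|x xLD].
      by have := h1 x xD; rewrite e yD.
    have [n hn] := h2 x xLD; exists n; rewrite (_ : iter _ _ _ = iter n s x)//.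
    move: xLD; rewrite in_fsetD => /andP[xD _].
    elim: n {hn} => //= n ->; rewrite /extL ifN//.
    by apply: (@stable_iter (fun y => y \notin D)).
  move=> [h1 h2]; have h3 x : x \notin D -> s x \notin D.
    by move=> xD; apply/negP => sxD; exact: (h1 x (s x)).
  split=> // x xLD; have [n hn] := h2 x xLD; exists n.
  rewrite (_ : iter _ _ _ = iter n (extL D [::] s) x)//.
  move: xLD; rewrite in_fsetD => /andP[xD _].
  elim: n {hn} => //= n <-; rewrite /extL ifN//.
  by apply: (@stable_iter (fun y => y \notin D)).
apply: measurableI.
  apply: (@measurable_forall _ TD _ (fun x => [set s : TD | forall y, x \notin D -> y \in D -> s x <> y])) => x.
  apply: (@measurable_forall _ TD _ (fun y => [set s : TD | x \notin D -> y \in D -> s x <> y])) => y.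
  apply: measurable_imply => xD; apply: measurable_imply => _; apply: measurableC.
  by apply: sub_sigma_algebra; exists x, y.
apply: (@measurable_forall _ TD _ (fun x => [set s : TD | x \in (L `\` D)%fset ->
  exists n, iter n (extL D [::] s) x \notin L])) => x.
apply: (@measurable_imply _ TD _ [set s : TD | exists n, iter n (extL D [::] s) x \notin L]) => _.
rewrite (_ : [set _ | _] = (extL D [::]) @^-1`
   [set s | exists n, exists y, iter n s x = y /\ y \notin L]).
  rewrite -[X in measurable X]setTI; apply: measurable_extL => //.
  apply: (@measurable_exists _ _ _ (fun n => [set s : Omega d | exists y, iter n s x = y /\ y \notin L])) => n.
  apply: (@measurable_exists _ _ _ (fun y => [set s : Omega d | iter n s x = y /\ y \notin L])) => y.
  by apply: measurableI; [exact: measurable_iter|exact: measurable_prop].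
apply/seteqP; split=> s /= [n]; last by move=> [y [<- hn]]; exists n.
by exists n; eexists; split; first reflexivity.
Qed.

Lemma measurable_core L D : measurable (core L D).
Proof. exact: (outcyl_sub (@core_outcyl L D)). Qed.

(** A point of [D] keeps its orbit in [L], while a point of [L] outside [D'] must leave it. Used in
    both directions, so that the core events for distinct sets are disjoint on bijections. *)
Lemma core_disjoint L D D' s : (D `<=` L)%fset -> bijective s -> core L D s -> core L D' s ->
  (D `<=` D')%fset.
Proof.
move=> DL bs [h1 _] [_ h2]; apply/fsubsetP => x xD; apply: contraT => xD'.
have [|n] := h2 x; first by rewrite in_fsetD xD' (fsubsetP DL).
apply: contraNT => _; apply: (fsubsetP DL).
by apply: (@stable_iter (fun y => y \in D)) => // y; rewrite (bij_stable bs h1).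
Qed.

(** [D] consists of the sites whose forward orbit stays in [L]. The complement is preserved because
    a finite cycle returns: if all later iterates of [x] are in [L], so is [x]. Patterns inside [L]
    are invariant, hence in [D]. *)
Lemma core_exists L s : fincyc s -> exists2 D, (D `<=` L)%fset & core L D s /\
  forall k, ((pat d k).1 `<=` L)%fset -> bit k s -> ((pat d k).1 `<=` D)%fset.
Proof.
move=> fs; pose D := [fset x in L | `[< forall n, iter n s x \in L >]]%fset.
exists D; first by apply/fsubsetP => x; rewrite !inE => /andP[].
split; last first.
  move=> k kL bk; apply/fsubsetP => x xk; rewrite !inE (fsubsetP kL)//=.
  apply/asboolP => n; apply: (fsubsetP kL).
  apply: (@stable_iter (fun y => y \in (pat d k).1)) => // y.
  exact: (agree_SL_stable (patP _ k) bk).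
split=> [x|x]; last first.
  rewrite !inE => /andP[h xL]; move: h; rewrite xL/= => /asboolP/existsNP[n /negP hn].
  by exists n.
apply: contra; rewrite !inE => /andP[_ /asboolP h].
have hx n : (0 < n)%N -> iter n s x \in L by case: n => // n _; rewrite iterSr.
have [n [n0 e]] := (fincycP s).1 fs x.
have xL : x \in L by rewrite -e hx.
by rewrite xL/=; apply/asboolP => -[|m]//; exact: hx.
Qed.

(** Here [xi] maps [D] onto itself, so its restriction [q] is a permutation of [D] and [q \o p] runs
    over all of them: the boundary condition acts as the identity. *)
Lemma Gspec_core L D xi A t : (A `<=` D)%fset -> t \in SL A -> bijective xi -> core L D xi ->
  Gspec V a D xi (pset A t) = wt v A t * ratio v D A.
Proof.
move=> AD tA bx [h _]; rewrite Gspec_bij//.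
have st := bij_stable bx h.
have qD : glue D xi idfun \in SL D.
  by apply: glue_SL => [x y _ _|x xD]; [exact: bij_inj bx _ _|rewrite st].
set q := glue D xi idfun in qD.
have xq p : p \in SL D -> agree D (xi \o p) (q \o p).
  by move=> pD; apply: agree_comp pD _; rewrite agree_sym; exact: agree_glue.
rewrite -(gp_pset v AD tA) /gp /gres.
transitivity ((\sum_(p <- SL D | (q \o p : Omega d) \in pset A t) wt v D (q \o p)) / Z v D).
  rewrite mulr_suml big_seq_cond [RHS]big_seq_cond; apply: eq_big => [p|p /andP[pD _]].
    case pD: (p \in SL D) => //=; apply/idP/idP; rewrite !inE /pset/= => h1.
      by apply: agree_trans h1; rewrite agree_sym; exact: agreeS (xq _ pD).
    by apply: agree_trans h1; exact: agreeS (xq _ pD).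
  rewrite /hres (eq_wt _ (xq _ pD)); congr (_ / _).
  rewrite (@eq_Zres _ _ _ _ _ q); last by rewrite agree_sym; exact: agree_glue.
  by rewrite /Zres (sum_SL_mul (wt v D) qD).
congr (_ / _); rewrite big_mkcond [RHS]big_mkcond/=.
exact: (sum_SL_mul (fun s => if s \in pset A t then wt v D s else 0) qD).
Qed.

Variable rho : {fset E} -> R.
Hypothesis cvg_rho : forall A, ratio v L A @[L --> @fset_up E] --> rho A.

Lemma Gibbs_core nu L D A t : Gibbs V a nu -> nu [set s | fincyc s] = 1%E ->
  (A `<=` D)%fset -> t \in SL A ->
  nu (pset A t `&` core L D) = ((wt v A t * ratio v D A)%:E * nu (core L D))%E.
Proof.
move=> [_ hG] nuf AD tA; have mA := measurable_pset A t; have mC := measurable_core L D.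
have [hU ->] := hG D (pset A t) mA; last exact: core_outcyl.
rewrite -integral_cst//; apply: ae_eq_integral => //.
  apply: measurable_funTS; apply/measurable_EFinP => _ U mU; rewrite setTI.
  by apply: outcyl_sub; exact: hU.
apply: (@negligibleS _ _ _ _ (~` [set s | fincyc s])).
  by move=> s /= h fs; apply: h => cs; rewrite (@Gspec_core L)//; exact: fincyc_bij.
apply/negligibleP; first by apply: measurableC; exact: measurable_fincyc.
exact: prob_setC_full (@measurable_fincyc d) nuf.
Qed.

Definition cover K n : set (Omega d) :=
  [set s | exists k, ((k < n)%N /\ (K `<=` (pat d k).1)%fset) /\ bit k s].

Lemma measurable_cover K n : measurable (cover K n).
Proof.
apply: (@measurable_exists _ _ _ (fun k => [set s : Omega d |
  ((k < n)%N /\ (K `<=` (pat d k).1)%fset) /\ bit k s])) => k.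
by apply: measurable_and; exact: measurable_pset.
Qed.

Lemma cover_prob (nu : probability (Omega d) R) K (e : R) : 0 < e -> nu [set s | fincyc s] = 1%E ->
  exists n, 1 - e <= fine (nu (cover K n)).
Proof.
move=> e0 nuf; pose F n := cover K n.
have mF n : measurable (F n) by exact: measurable_cover.
have mU : measurable (\bigcup_n F n) by exact: bigcup_measurable.
have U1 : nu (\bigcup_n F n) = 1%E.
  apply/eqP; rewrite eq_le probability_le1//= -[in X in (X <= _)%E]nuf.
  apply: le_measure; rewrite ?inE//; first exact: measurable_fincyc.
  by move=> s /= /(fincyc_cover K)[k [h1 h2]]; exists k.+1 => //=; exists k.
have c : fine (nu (F n)) @[n --> \oo] --> (1 : R).
  apply: fine_cvg; rewrite -U1; apply: nondecreasing_cvg_mu => // m n mn; apply/subsetPset.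
  by move=> s /= [k [[km ?] ?]]; exists k; split=> //; split=> //; exact: leq_trans km mn.
have /cvgrPdist_le/(_ _ e0)[N _ /(_ N (leqnn N)) hN] := c.
exists N; have := le_trans (ler_norm _) hN; rewrite -/(F N); lra.
Qed.

(** The core is a random volume with identity boundary conditions. With probability at least [1 - e]
    it contains [L0], beyond which the ratio is within [e] of [rho A]; summing [Gibbs_core] over the
    possible cores gives the pattern probability up to small errors. *)
Lemma Gibbs_pset nu A t : Gibbs V a nu -> nu [set s | fincyc s] = 1%E -> t \in SL A ->
  nu (pset A t) = (wt v A t * rho A)%:E.
Proof.
move=> Gnu nuf tA; set c := wt v A t * rho A.
have mA := measurable_pset A t; have mF := @measurable_fincyc d.
(* One [e] comes from the ratios inside the cores, one from the part of the pattern outside [G], and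
   [|c| * e] from the missing mass of [G]. *)
suff key (e : R) : 0 < e -> `|fine (nu (pset A t)) - c| <= e * (2 + `|c|).
  rewrite (prE nu mA); congr EFin; apply/eqP; rewrite -subr_eq0 -normr_le0.
  apply/ler_addgt0Pr => e e0; rewrite add0r.
  have c0 : 0 < 2 + `|c| by rewrite ltr_wpDr.
  by have := key (e / (2 + `|c|)) (divr_gt0 e0 c0); rewrite divfK ?gt_eqF.
move=> e0; have /cvgrPdist_le/(_ _ e0)/near_fset_up[L0 hL0] := @cvg_rho A.
have [n hn] := @cover_prob nu (A `|` L0)%fset e e0 nuf.
(* [L] contains the first [n] patterns, so whenever one of them covers [A] and [L0], the core of [L]
   does too. *)
pose L := (\big[fsetU/fset0]_(k < n) (pat d k).1)%fset.
pose DD := [fset D in fpowerset L | (A `|` L0 `<=` D)%fset]%fset.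
pose F D := core L D `&` [set s | fincyc s].
have mFD D : measurable (F D) by apply: measurableI => //; exact: measurable_core.
have tF : trivIset [set` DD] F.
  move=> D D'; rewrite /= !inE !fpowersetE => /andP[DL _] /andP[DL' _] [s [[c1 fs] [c2 _]]].
  have bs := fincyc_bij fs.
  by apply/eqP; rewrite eqEfsubset (core_disjoint DL bs c1 c2) (core_disjoint DL' bs c2 c1).
pose G := \big[setU/set0]_(D <- DD) F D.
have mG : measurable G by apply: bigsetU_measurable.
have prG : fine (nu G) = \sum_(D <- DD) fine (nu (F D)).
  rewrite /G measure_fbigsetU//; apply: EFin_inj; rewrite -sumEFin fineK.
    by apply: eq_bigr => D _; exact: prE.
  by apply/sum_fin_numP => D _ _; exact: fin_num_measure.
have prAG : fine (nu (pset A t `&` G)) = \sum_(D <- DD) fine (nu (pset A t `&` F D)).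
  have mAF D : measurable (pset A t `&` F D) by exact: measurableI.
  rewrite /G big_distrr/= measure_fbigsetU//; last exact: trivIset_setIl.
  apply: EFin_inj; rewrite -sumEFin fineK.
    by apply: eq_bigr => D _; exact: prE.
  by apply/sum_fin_numP => D _ _; exact: fin_num_measure.
have mE : measurable (cover (A `|` L0)%fset n) by exact: measurable_cover.
have G1 : 1 - e <= fine (nu G).
  apply: (le_trans hn); rewrite -(mu_full nuf mE).
  apply: le_pr => //; first exact: measurableI.
  move=> s [[k [[kn kK] bk]] fs].
  have [D DL [cD hD]] := core_exists L fs.
  rewrite /G -bigcup_fset; exists D => //=.
  rewrite !inE fpowersetE DL/=; apply: (fsubset_trans kK); apply: hD => //.
  by apply: (@bigfcup_sup _ _ (index_enum _) (Ordinal kn) xpredT (fun k : 'I_n => (pat d k).1)); rewrite ?mem_index_enum.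
have d1 : `|fine (nu (pset A t `&` G)) - c * fine (nu G)| <= e * fine (nu G).
  rewrite prAG prG !mulr_sumr -sumrB; apply: (le_trans (ler_norm_sum _ _ _)).
  rewrite !big_seq; apply: ler_sum => D; rewrite !inE fpowersetE => /andP[_].
  rewrite fsubUset => /andP[AD L0D].
  rewrite /F setIA (mu_full nuf); last by apply: measurableI => //; exact: measurable_core.
  rewrite (mu_full nuf); last exact: measurable_core.
  rewrite (Gibbs_core _ Gnu nuf AD tA) (prE nu (measurable_core L D)) -EFinM/=.
  rewrite -mulrBl normrM [X in _ * X]ger0_norm ?fine_ge0// ler_wpM2r ?fine_ge0//.
  rewrite /c -mulrBr normrM; apply: le_trans (ler_piMl _ _) _ => //.
    by rewrite ger0_norm ?wt_ge0 ?wt_le1//; [exact: bw_ge0|exact: bw_le1|exact: bw_ge0].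
  by rewrite distrC; exact: hL0.
have G2 : fine (nu G) <= 1 by rewrite -lee_fin -prE// probability_le1.
have d2 : fine (nu (pset A t `&` G)) <= fine (nu (pset A t)).
  by apply: le_pr => //; exact: measurableI.
have d3 : fine (nu (pset A t)) - fine (nu (pset A t `&` G)) <= e.
  have mAG : measurable (pset A t `&` G) by exact: measurableI.
  rewrite -prD//; apply: (@le_trans _ _ (fine (nu (~` G)))).
    apply: le_pr; [exact: measurableD|exact: measurableC|].
    by move=> s [As nG] Gs; exact: nG.
  by rewrite probability_setC// prE//=; lra.
have d4 : `|c * fine (nu G) - c| <= `|c| * e.
  rewrite -{2}[c]mulr1 -mulrBr normrM ler_wpM2l// ler_norml; lra.
have d5 := ler_wpM2l (ltW e0) G2.
move: d1 d4; rewrite !ler_norml => /andP[? ?] /andP[? ?].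
by apply/andP; split; lra.
Qed.

End Uniqueness.

(** * Bounded sublevel sets of an even convex function *)

Section ConvexGrowth.
Variables (R : realType) (d : nat) (D : set 'rV[R]_d) (g : 'rV[R]_d -> R).
Hypothesis D_conv : forall u w (t : R), D u -> D w -> 0 <= t <= 1 ->
  D (t *: u + (1 - t) *: w) /\ g (t *: u + (1 - t) *: w) <= t * g u + (1 - t) * g w.

(** The weights are not normalized; a vanishing partial sum is treated apart because it cannot be
    divided by. *)
Lemma jensen (I : eqType) (r : seq I) (t : I -> R) (u : I -> 'rV[R]_d) :
  (forall i, 0 <= t i) -> (forall i, D (u i)) -> 0 < \sum_(i <- r) t i ->
  D ((\sum_(i <- r) t i)^-1 *: \sum_(i <- r) t i *: u i) /\
  (\sum_(i <- r) t i) * g ((\sum_(i <- r) t i)^-1 *: \sum_(i <- r) t i *: u i) <=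
  \sum_(i <- r) t i * g (u i).
Proof.
move=> t0 Du; elim: r => [|i r IH]; first by rewrite big_nil ltxx.
rewrite !big_cons; set s' := \sum_(j <- r) t j; set S := \sum_(j <- r) t j *: u j.
have s'0 : 0 <= s' by exact: sumr_ge0.
have [e s0|s'n s0] := eqVneq s' 0.
  have tz j : j \in r -> t j = 0.
    have : s' == 0 by rewrite e.
    by rewrite /s' psumr_eq0// => /allP h /h/= /eqP.
  have -> : S = 0 by rewrite /S big_seq big1// => j /tz ->; rewrite scale0r.
  rewrite [X in _ <= _ + X]big_seq [X in _ <= _ + X]big1 => [|j /tz ->]; last by rewrite mul0r.
  move: s0; rewrite e !addr0 => /lt0r_neq0 s0.
  by rewrite scalerA mulVf// scale1r; split.
have s'p : 0 < s' by rewrite lt0r s'n.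
have [DS gS] := IH s'p; set s := t i + s'.
have t1 : 0 <= t i / s <= 1.
  apply/andP; split; first by rewrite divr_ge0// ltW.
  by rewrite ler_pdivrMr// mul1r lerDl.
have et : 1 - t i / s = s' / s.
  by rewrite -[X in X - _](@divff _ s) ?gt_eqF// -mulrBl /s addrAC subrr add0r.
have eS : s^-1 *: (t i *: u i + S) = (t i / s) *: u i + (1 - t i / s) *: (s'^-1 *: S).
  rewrite et scalerA mulrAC divff// mul1r scalerDr scalerA; congr (_ *: _ + _).
  by rewrite mulrC.
have [D1 g1] := D_conv (Du i) DS t1.
rewrite eS; split=> //; apply: (le_trans (ler_wpM2l (ltW s0) g1)).
have e1 x : s * (x / s) = x by rewrite mulrC divfK// gt_eqF.
rewrite -/s et mulrDr (mulrA s (t i / s)) (mulrA s (s' / s)) !e1.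
by rewrite lerD2l.
Qed.

Hypotheses (D0 : D 0) (g0 : g 0 = 0) (DN : forall u, D u -> D (- u))
  (gN : forall u, D u -> g (- u) = g u) (g_gt0 : forall u, D u -> u != 0 -> 0 < g u).

Lemma g_ge0 u : D u -> 0 <= g u.
Proof.
move=> Du; have [->|u0] := eqVneq u 0; first by rewrite g0.
by rewrite ltW// g_gt0.
Qed.

Lemma g_scale (t : R) u : D u -> 0 <= t <= 1 -> D (t *: u) /\ g (t *: u) <= t * g u.
Proof.
move=> Du t1; have := D_conv Du D0 t1.
by rewrite scaler0 addr0 g0 mulr0 addr0.
Qed.

(** Signs are moved from the coefficients to the rows, which [g] does not notice, and a total weight
    below 1 is completed at the origin, where [g] vanishes. *)
Lemma g_comb (k : nat) (M : 'M[R]_(k, d)) (th : 'rV[R]_k) :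
  (forall j, D (row j M)) -> \sum_j `|th 0 j| <= 1 ->
  D (th *m M) /\ g (th *m M) <= \sum_j `|th 0 j| * g (row j M).
Proof.
move=> DM th1; pose u j := Num.sg (th 0 j) *: row j M.
have Du j : D (u j).
  rewrite /u; case: sgrP => _; rewrite ?scale0r ?scale1r//.
  by rewrite scaleN1r; exact: DN.
have gu j : `|th 0 j| * g (u j) = `|th 0 j| * g (row j M).
  rewrite /u; case: sgrP => _; rewrite ?mul0r ?scale1r//.
  by rewrite scaleN1r gN.
have e : th *m M = \sum_j `|th 0 j| *: u j.
  by rewrite mulmx_sum_row; apply: eq_bigr => j _; rewrite /u scalerA mulrC -numEsg.
have [s0|s0] := eqVneq (\sum_j `|th 0 j|) 0.
  have -> : th *m M = 0.
    rewrite e big1// => j _; have : \sum_j `|th 0 j| == 0 by rewrite s0.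
    by rewrite psumr_eq0// => /allP/(_ j (mem_index_enum j))/= /eqP ->; rewrite scale0r.
  by rewrite g0; split=> //; apply: sumr_ge0 => j _; rewrite mulr_ge0// g_ge0.
have sp : 0 < \sum_j `|th 0 j| by rewrite lt0r s0 sumr_ge0.
have [D1 g1] := jensen (fun j => normr_ge0 (th 0 j)) Du sp.
have [|D2 g2] := g_scale D1 (t := \sum_j `|th 0 j|); first by rewrite ltW.
rewrite e; move: D2 g2; rewrite scalerA divff// scale1r => D2 g2; split=> //.
apply: (le_trans g2); apply: (le_trans g1).
by apply: ler_sum => j _; rewrite gu.
Qed.

(** An independent family of maximal size inside [D] spans [D]. Taking the rows from [D] itself
    puts, by [g_comb], a neighbourhood of 0 in the span into [D]. *)
Lemma basis_of_set : exists k (M : 'M[R]_(k, d)),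
  row_free M /\ (forall j, D (row j M)) /\ forall u, D u -> exists th : 'rV[R]_k, u = th *m M.
Proof.
pose P k := `[< exists M : 'M[R]_(k, d), row_free M /\ forall j, D (row j M) >].
have P0 : exists k, P k.
  exists 0; apply/asboolP; exists 0; split=> [|[]//].
  by rewrite -row_leq_rank.
have Pd k : P k -> (k <= d)%N.
  by move=> /asboolP[M [fM _]]; rewrite -(eqP fM); exact: rank_leq_col.
have [k /asboolP[M [fM DM]] kmax] := ex_maxnP P0 Pd.
exists k, M; split=> //; split=> // u Du.
have [/submxP[th ->]|uM] := boolP (u <= M)%MS; first by exists th.
have : (k + 1 <= k)%N; last by rewrite addn1 ltnn.
apply: kmax; apply/asboolP; exists (col_mx M u); split.
  rewrite -row_leq_rank -(addsmxE M u) addn1 -[X in (X < _)%N](eqP fM).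
  apply: rank_ltmx; rewrite ltmxE addsmxSl/=; apply: contra uM => h.
  exact: submx_trans (addsmxSr M u) h.
move=> j; case: (split_ordP j) => l ->; first by rewrite rowKu.
by rewrite rowKd (_ : row l u = u)//; apply/rowP => i; rewrite !mxE ord1.
Qed.

Lemma coord_le_norm (k : nat) (th : 'rV[R]_k.+1) j : `|th 0 j| <= `|th|.
Proof.
rewrite [leRHS]mx_normrE.
exact: (le_bigmax 0 (fun ij : 'I_1 * 'I_k.+1 => `|th ij.1 ij.2|) (0, j)).
Qed.

Lemma norm_const_rV (k : nat) (c : R) : 0 <= c -> `|const_mx c : 'rV[R]_k.+1| = c.
Proof.
move=> c0; apply/eqP; rewrite eq_le; apply/andP; split.
  by rewrite [leLHS]mx_normrE; apply: bigmax_le => // ij _; rewrite mxE ger0_norm.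
have := coord_le_norm (const_mx c : 'rV[R]_k.+1) ord0.
by rewrite mxE ger0_norm.
Qed.

(* In coordinates with respect to a basis of the span of [D] taken inside [D], [g] is
   Lipschitz on a small sphere, hence has a positive minimum there, and convexity makes it
   grow at least linearly beyond. *)
Lemma sublevel_bounded : exists r : R, 0 <= r /\
  forall u, D u -> g u <= 1 -> forall i, `|u 0 i| <= r.
Proof.
have [[|k] [M [fM [DM spanD]]]] := basis_of_set.
  exists 0; split=> // u /spanD[th ->] _ i.
  by rewrite mxE big_ord0 normr0.
(* Chosen so that a sup norm at most [2c] forces the sum of absolute coordinates to be at most 1.
   The sphere of radius [c] leaves room to move by [c] within the domain. *)
pose c : R := (k.+1%:R *+ 2)^-1.
have c0 : 0 < c by rewrite invr_gt0 pmulrn_lgt0.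
have k2c : k.+1%:R * (c *+ 2) = 1.
  by rewrite mulrnAr -mulrnAl /c divff// lt0r_neq0// pmulrn_lgt0.
pose m := \sum_j g (row j M).
have mge0 : 0 <= m by apply: sumr_ge0 => j _; exact: g_ge0.
pose phi (th : 'rV[R]_k.+1) := g (th *m M).
have sum_coord (th : 'rV[R]_k.+1) : `|th| <= c *+ 2 -> \sum_j `|th 0 j| <= 1.
  move=> h; apply: (@le_trans _ _ (\sum_(j < k.+1) (c *+ 2))).
    by apply: ler_sum => j _; exact: le_trans (coord_le_norm _ _) h.
  by rewrite sumr_const card_ord -mulr_natl k2c.
have phiP (th : 'rV[R]_k.+1) : `|th| <= c *+ 2 -> D (th *m M) /\ phi th <= m.
  move=> /sum_coord h; have [h1 h2] := g_comb DM h; split=> //.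
  apply: (le_trans h2); apply: ler_sum => j _; rewrite ler_piMl ?g_ge0//.
  by apply: le_trans h; rewrite (bigD1 j)//= lerDl sumr_ge0.
have c2c : c <= c *+ 2 by rewrite mulr2n lerDl ltW.
pose A := [set th : 'rV[R]_k.+1 | `|th| = c].
have cA : compact A.
  apply: bounded_closed_compact.
    by exists c; split=> [|x cx y /= ->]; [exact: gtr0_real|exact: ltW].
  by apply: (preimage_closed (f := fun th : 'rV[R]_k.+1 => `|th|) (D := [set x | x = c])); [move=> x _; exact: norm_continuous|exact: closed_eq].
have A0 : A !=set0 by exists (const_mx c); rewrite /A/= norm_const_rV// ltW.
(* Prolong the segment from [th] through [th'] to length [c]: the endpoint [w] has norm at most
   [2c], where [phi] is at most [m], and [th'] is a convex combination of [w] and [th] with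
   coefficient [s]. *)
have lip (th th' : 'rV[R]_k.+1) : A th -> A th' -> `|th' - th| <= c ->
    phi th' <= phi th + `|th' - th| / c * m.
  rewrite /A/= => Ath Ath' hc; have [e|n0] := eqVneq th' th.
    by rewrite e subrr normr0 mul0r mul0r addr0.
  have np : 0 < `|th' - th| by rewrite normr_gt0 subr_eq0.
  pose s := `|th' - th| / c.
  have s01 : 0 <= s <= 1.
    by apply/andP; split; [rewrite divr_ge0// ltW|rewrite ler_pdivrMr// mul1r].
  have sp : 0 < s by rewrite divr_gt0.
  pose w := th + s^-1 *: (th' - th).
  have [|Dw pw] := phiP w.
    apply: (le_trans (ler_normD _ _)); rewrite Ath normrZ gtr0_norm ?invr_gt0//.
    by rewrite /s invf_div divfK ?gt_eqF// mulr2n.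
  have [|Dth _] := phiP th; first by rewrite Ath.
  have [_] := D_conv Dw Dth s01.
  have -> : s *: (w *m M) + (1 - s) *: (th *m M) = th' *m M.
    rewrite !scalemxAl -mulmxDl; congr (_ *m _).
    rewrite /w scalerDr scalerA divff ?gt_eqF// scale1r scalerBl scale1r.
    by rewrite addrC addrA subrK addrC subrK.
  move=> h; apply: (le_trans h); rewrite -/(phi th) -/s addrC; apply: lerD.
    by rewrite ler_piMl ?g_ge0//; move: s01; lra.
  by rewrite ler_wpM2l// ltW.
have cont : {within A, continuous phi}.
  apply/subspace_continuousP => th Ath; apply/cvgrPdist_le => e e0.
  have e' : 0 < Num.min c (e * c / (m + 1)).
    by rewrite lt_min c0/= divr_gt0 ?mulr_gt0// ltr_wpDl.
  rewrite near_withinE; near=> th' => Ath'.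
  have : `|th - th'| <= Num.min c (e * c / (m + 1)) by near: th'; apply: cvgr_dist_le.
  rewrite le_min => /andP[h1 h2].
  have h3 : `|th - th'| / c * m <= e.
    rewrite mulrAC ler_pdivrMr//; apply: le_trans (_ : `|th - th'| * (m + 1) <= _).
      by rewrite ler_wpM2l// lerDl.
    by rewrite -ler_pdivlMr// ltr_wpDl.
  have l1 := lip _ _ Ath' Ath h1.
  have l2 : phi th' <= phi th + `|th - th'| / c * m.
    by rewrite distrC; apply: lip => //; rewrite distrC.
  change (`|phi th - phi th'| <= e); apply/ler_normlP; split.
    by rewrite opprB lerBlDl; apply: (le_trans l2); rewrite lerD2l.
  by rewrite lerBlDl; apply: (le_trans l1); rewrite lerD2l.
have [w wA wmin] := EVT_min_rV A0 cA cont.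
have m0 : 0 < phi w.
  rewrite inE /A/= in wA; have [|Dw _] := phiP w; first by rewrite wA.
  apply: g_gt0 => //; rewrite mulmx_free_eq0//; apply: contraTneq c0 => w0.
  by rewrite -wA w0 normr0 ltxx.
have r0 : 0 <= c + c / phi w by rewrite addr_ge0 ?divr_ge0// ltW.
(* Beyond radius [c], scaling [th] back to the sphere leaves a value at most [c / |th|] by convexity
   and at least the minimum [phi w], so [|th|] is at most [c / phi w]. The entries of [M] convert
   coordinates back to components. *)
exists ((c + c / phi w) * \sum_i \sum_j `|M j i|); split.
  by rewrite mulr_ge0// sumr_ge0// => i _; rewrite sumr_ge0.
move=> u Du gu i; have [th e] := spanD u Du.
have th_le : `|th| <= c + c / phi w.
  have [h|h] := leP `|th| c; first by apply: (le_trans h); rewrite lerDl divr_ge0 ?ltW.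
  have th0 : 0 < `|th| := lt_trans c0 h.
  have t1 : 0 <= c / `|th| <= 1.
    by apply/andP; split; [rewrite divr_ge0// ltW|rewrite ler_pdivrMr// mul1r ltW].
  have [_] := g_scale Du t1; rewrite e scalemxAl -/(phi _).
  have cth : (c / `|th|) *: th \in A.
    by rewrite inE /A/= normrZ ger0_norm ?divfK ?gt_eqF//; case/andP: t1.
  move=> h1; have h2 := le_trans (wmin _ cth) h1.
  have h3 : phi w <= c / `|th|.
    by apply: (le_trans h2); rewrite ler_piMr//; [case/andP: t1|rewrite -e].
  apply: ler_wpDl; first exact: ltW.
  by rewrite ler_pdivlMr// mulrC -ler_pdivlMr.
rewrite e mxE; apply: (le_trans (ler_norm_sum _ _ _)).
apply: (@le_trans _ _ (\sum_j (c + c / phi w) * `|M j i|)).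
  by apply: ler_sum => j _; rewrite normrM ler_wpM2r//; exact: le_trans (coord_le_norm _ _) th_le.
rewrite -mulr_sumr ler_wpM2l//.
by rewrite (bigD1 i)//= lerDl sumr_ge0// => ? _; rewrite sumr_ge0.
Unshelve. all: by end_near.
Qed.

End ConvexGrowth.

(** * Jumps bounded by the length and the energy of their cycle *)

Section JumpEnergy.
Variables (R : realType) (d : nat) (V : site d -> \bar R).
Hypotheses (V_ge0 : forall x, (0 <= V x)%E) (V0 : V 0 = 0%E) (V_conv : strictly_convex_pot V).
Local Notation E := (site d).
Implicit Types (A : {fset E}) (s t : Omega d) (x y z : E).

Local Notation real x := (map_mx (fun z : int => z%:~R : R) x).

(* The jumps of [t] sum to zero.  If [w] is the jump at [x] divided by [n - 1], where [n] is
   the size of [A], Jensen's inequality for the other jumps bounds [(n - 1) (f w + f (- w))]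
   by the total energy; the even function [f w + f (- w)] has bounded sublevel sets. *)
Lemma energy_bound : exists r : R, 0 <= r /\ forall A t x i, t \in SL A -> x \in A ->
  (forall z, z \in A -> (V (t z - z)%R < +oo)%E) ->
  `|((t x - x) 0 i)%:~R| <= r * (#|` A|%:R + \sum_(z <- A) fine (V (t z - z))).
Proof.
have [f [Vf fN f_le f_lt]] := V_conv.
pose F u := fine (f u); pose Df := [set u | (f u < +oo)%E].
have fE u : Df u -> f u = (F u)%:E.
  by rewrite /F => fu; rewrite fineK// fin_numE fN lt_eqF.
have F_conv u w (t : R) : Df u -> Df w -> 0 <= t <= 1 ->
    Df (t *: u + (1 - t) *: w) /\ F (t *: u + (1 - t) *: w) <= t * F u + (1 - t) * F w.
  move=> Du Dw t1; have := f_le u w t t1; rewrite (fE u)// (fE w)// -!EFinM -EFinD => h.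
  have D1 : Df (t *: u + (1 - t) *: w) by exact: le_lt_trans h (ltry _).
  by split=> //; rewrite -lee_fin -fE.
have f0 : f 0%R = 0%E.
  by rewrite -V0 Vf; congr f; apply/rowP => i; rewrite !mxE.
have Df0 : Df 0 by rewrite /Df/= f0.
have F0 : F 0 = 0 by rewrite /F f0.
pose D := [set u | Df u /\ Df (- u)]; pose g u := F u + F (- u).
have D_conv u w (t : R) : D u -> D w -> 0 <= t <= 1 ->
    D (t *: u + (1 - t) *: w) /\ g (t *: u + (1 - t) *: w) <= t * g u + (1 - t) * g w.
  move=> [u1 u2] [w1 w2] t1; have [h1 h2] := F_conv u w t u1 w1 t1.
  have [] := F_conv (- u) (- w) t u2 w2 t1; rewrite !scalerN -opprD => h3 h4.
  by split=> //; rewrite /g !mulrDr addrACA lerD.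
have D0 : D 0 by split; rewrite ?oppr0.
have g0 : g 0 = 0 by rewrite /g oppr0 F0 addr0.
have DN u : D u -> D (- u) by move=> [? ?]; split; rewrite ?opprK.
have gN u : D u -> g (- u) = g u by rewrite /g opprK addrC.
(* Strict convexity at 0, the midpoint of [u] and [- u], together with [f 0 = 0]. *)
have g_gt0 u : D u -> u != 0 -> 0 < g u.
  move=> [u1 u2] un0; have := @f_lt u (- u) 2^-1.
  rewrite scalerN (_ : 1 - 2^-1 = 2^-1 :> R); last by lra.
  rewrite subrr f0 (fE u)// (fE (- u))// -!EFinM -EFinD lte_fin -mulrDr => h.
  rewrite -(pmulr_rgt0 _ (_ : 0 < 2^-1 :> R)) ?invr_gt0//; apply: h => //.
  - by rewrite -subr_eq0 opprK -mulr2n -scaler_nat scaler_eq0 negb_or un0 andbT pnatr_eq0.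
  - by apply/andP; split; lra.
  - by rewrite -fE.
  - by rewrite -fE.
have [r [r0 hr]] := sublevel_bounded D_conv D0 g0 DN gN g_gt0.
exists r; split=> // A t x i tA xA Vfin.
pose u z := real (t z - z).
have Fu z : fine (V (t z - z)) = F (u z) by rewrite Vf.
have Du z : z \in A -> Df (u z) by move=> /Vfin; rewrite Vf.
have F_ge0 z : 0 <= F (u z) by rewrite -Fu fine_ge0.
have ue z : u z = real (t z) - real z by apply/rowP => j; rewrite !mxE rmorphB.
have sum0 : \sum_(z <- A) u z = 0.
  under eq_bigr do rewrite ue.
  rewrite sumrB; apply/eqP; rewrite subr_eq0; apply/eqP.
  have -> : \sum_(z <- A) real z = \sum_(z <- [fset t z | z in A]%fset) real z.
    apply: eq_fbigl => z; apply/idP/imfsetP => [zA|[y /= yA ->]]; last by rewrite (SL_stable _ tA).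
    have st y : y \in A -> t y \in A by rewrite (SL_stable _ tA).
    have [y yA ->] := @stable_surj _ A t (in2W (SL_inj tA)) st z zA.
    by exists y.
  by rewrite big_imfset//= => y z _ _; exact: SL_inj tA _ _.
have H0 : 0 <= \sum_(z <- A) fine (V (t z - z)) by apply: sumr_ge0 => z _; rewrite Fu.
have [N0|Np] := posnP #|` (A `\ x)%fset|.
  have tx : t x = x.
    have := SL_stable x tA; rewrite xA => txA; apply/eqP; apply: contraT => txx.
    by move/cardfs0_eq: N0 => /fsetP/(_ (t x)); rewrite in_fset0 in_fsetD1 txx txA.
  by rewrite tx subrr mxE normr0 mulr_ge0// addr_ge0.
set N := #|` (A `\ x)%fset| in Np; have NR : 0 < N%:R :> R by rewrite ltr0n.
have N1 : 1 <= N%:R :> R by rewrite ler1n.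
pose w := N%:R^-1 *: u x.
set H := \sum_(z <- A) fine (V (t z - z)) in H0 *.
have HE : H = F (u x) + \sum_(z <- (A `\ x)%fset) F (u z).
  rewrite /H (big_fsetD1 _ xA)/= Fu; congr (_ + _).
  by apply: eq_bigr => z _; rewrite Fu.
have [Dw Fw] : Df w /\ F w <= N%:R^-1 * F (u x).
  have N01 : 0 <= (N%:R^-1 : R) <= 1 by rewrite invr_ge0 ler0n/= invf_le1.
  have := F_conv (u x) 0 _ (Du x xA) Df0 N01.
  by rewrite scaler0 addr0 F0 mulr0 addr0.
have [DNw FNw] : Df (- w) /\ N%:R * F (- w) <= \sum_(z <- (A `\ x)%fset) F (u z).
  pose u' z := if z \in A then u z else 0.
  have Du' z : Df (u' z) by rewrite /u'; case: ifP => // /Du.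
  have c1 : \sum_(z <- (A `\ x)%fset) (1 : R) = N%:R.
    by rewrite /N card_fset_sum1 natr_sum.
  have := jensen F_conv (r := enum_fset (A `\ x)%fset) (fun _ => ler01) Du'.
  rewrite c1 => /(_ NR); rewrite (_ : _ *: _ = - w).
    move=> [h1 h2]; split=> //; apply: (le_trans h2).
    rewrite big_seq [leRHS]big_seq; apply: ler_sum => z; rewrite in_fsetD1 => /andP[_ zA].
    by rewrite mul1r /u' zA.
  rewrite /w -scalerN; congr (_ *: _).
  transitivity (\sum_(z <- (A `\ x)%fset) u z).
    by apply: eq_big_seq => z; rewrite in_fsetD1 => /andP[_ zA]; rewrite scale1r /u' zA.
  by move: sum0; rewrite (big_fsetD1 _ xA)/= => /eqP; rewrite addr_eq0 => /eqP ->; rewrite opprK.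
have Dww : D w by [].
have gw : N%:R * g w <= H.
  rewrite /g mulrDr HE lerD//; apply: (le_trans (ler_wpM2l (ltW NR) Fw)).
  by rewrite mulrA divff ?mul1r ?gt_eqF.
have ux : `|((t x - x) 0 i)%:~R| = N%:R * `|w 0 i|.
  by rewrite /w !mxE normrM ger0_norm ?invr_ge0// mulrA divff ?gt_eqF// mul1r.
have NA : N%:R <= #|` A|%:R :> R by rewrite ler_nat [leqRHS](cardfsD1 x) leq_addl.
(* If the energy is at most [N], then [w] itself lies in the sublevel set. Otherwise [w] is shrunk
   by [N / H], and the bound obtained is proportional to [H]. *)
rewrite ux; have [HN|HN] := leP H N%:R.
  have g1 : g w <= 1 by rewrite -(ler_pM2l NR) mulr1 (le_trans gw).
  have h := hr _ Dww g1 i.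
  apply: (@le_trans _ _ (N%:R * r)); first by rewrite ler_wpM2l// ltW.
  by rewrite mulrC ler_wpM2l// (le_trans NA)// lerDl.
have Hp : 0 < H := lt_trans NR HN.
have t1 : 0 <= N%:R / H <= 1.
  by apply/andP; split; [rewrite divr_ge0// ltW|rewrite ler_pdivrMr// mul1r ltW].
have [D1 g1] := D_conv w 0 _ Dww D0 t1.
rewrite scaler0 addr0 in D1; rewrite scaler0 addr0 g0 mulr0 addr0 in g1.
have g2 : g ((N%:R / H) *: w) <= 1.
  by apply: (le_trans g1); rewrite mulrAC ler_pdivrMr// mul1r.
have := hr _ D1 g2 i; rewrite mxE normrM ger0_norm; last by case/andP: t1.
rewrite mulrAC ler_pdivrMr// => h; apply: (le_trans h).
by rewrite ler_wpM2l// lerDr.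
Qed.

(** With H the energy, H exp(-(a - a0) H) is at most 1 / (a - a0), and the rest of the weight is the
    one at parameter [a0]. This gives [C = r (1 + 1 / (a - a0))]; an infinite energy makes the
    weight 0. *)
Lemma jump_weight (a a0 : R) : 0 < a0 -> a0 < a -> exists C : R, 0 <= C /\
  forall A t x i, t \in SL A -> x \in A ->
  `|((t x - x) 0 i)%:~R| * wt (bw V a) A t <= C * (#|` A|%:R * wt (bw V a0) A t).
Proof.
move=> a00 a0a; have [r [r0 hr]] := energy_bound.
have da : 0 < a - a0 by rewrite subr_gt0.
have C0 : 0 <= r * (1 + (a - a0)^-1) by rewrite mulr_ge0// addr_ge0 ?invr_ge0// ltW.
exists (r * (1 + (a - a0)^-1)); split=> //.
move=> A t x i tA xA.
have [[z zA]|/forallNP h] := pselect (exists z, z \in A /\ V (t z - z) = +oo%E).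
  rewrite [X in _ * X](_ : _ = 0) ?mulr0; last first.
    by rewrite /wt (big_fsetD1 _ zA.1)/= /bw zA.2/= mul0r.
  by rewrite mulr_ge0// mulr_ge0//; apply: wt_ge0 => ?; exact: bw_ge0.
have Vfin z : z \in A -> (V (t z - z)%R < +oo)%E.
  by move=> zA; rewrite ltey; apply/eqP => e; exact: (h z).
set H := \sum_(z <- A) fine (V (t z - z)).
have H0 : 0 <= H by apply: sumr_ge0 => z _; rewrite fine_ge0.
have wE b : wt (bw V b) A t = expR (- (b * H)).
  rewrite /wt /H mulr_sumr -sumrN expR_sum; apply: eq_big_seq => z zA.
  by rewrite /bw -[in LHS](@fineK _ (V _))//= ge0_fin_numE// Vfin.
rewrite !wE; apply: (le_trans (ler_wpM2r (expR_ge0 _) (hr A t x i tA xA Vfin))).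
rewrite -/H -!mulrA ler_wpM2l//.
have n1 : 1 <= #|` A|%:R :> R by rewrite ler1n cardfs_gt0; apply/fset0Pn; exists x.
have -> : - (a * H) = - ((a - a0) * H) - a0 * H by rewrite mulrBl opprB addrAC subrr add0r.
rewrite expRD !mulrA ler_wpM2r ?expR_ge0//.
set dH := (a - a0) * H; have dH0 : 0 <= dH by rewrite mulr_ge0// ltW.
have e1 : H = dH / (a - a0) by rewrite /dH mulrC mulKf// gt_eqF.
have e2 : dH * expR (- dH) <= 1.
  rewrite expRN ler_pdivrMr ?expR_gt0// mul1r.
  by apply: le_trans (expR_ge1Dx dH); rewrite lerDr.
have e3 : expR (- dH) <= 1 by rewrite expR_le1 oppr_le0.
rewrite mulrDl mulrDl; apply: lerD; first by rewrite mul1r ler_piMr.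
rewrite e1 mulrAC [leRHS]mulrC; apply: ler_pM => //.
- by rewrite mulr_ge0// expR_ge0.
- by rewrite invr_ge0 ltW.
- exact: le_trans e2 n1.
Qed.

End JumpEnergy.

(** * Integrability and vanishing mean of the jumps *)

Section MeanJump.
Variables (R : realType) (d : nat) (V : site d -> \bar R) (a a0 : R).
Hypotheses (V_ge0 : forall x, (0 <= V x)%E) (V0 : V 0 = 0%E) (V_conv : strictly_convex_pot V).
Hypotheses (a0_gt0 : 0 < a0) (a0_lt : a0 < a) (beta_fin : (beta V a0 < +oo)%E).
Variable mu : probability (Omega d) R.
Hypotheses (mu_fin : mu [set s | fincyc s] = 1%E)
  (mu_le : forall A t, t \in SL A -> (mu (pset A t) <= (wt (bw V a) A t)%:E)%E)
  (mu_inv : forall z C, measurable C -> mu (@Defs.shift d z @^-1` C) = mu C).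
Local Notation shift := (@Defs.shift d).
Local Notation E := (site d).
Implicit Types (L A U K : {fset E}) (s t : Omega d) (x y z : E) (C : set (Omega d)).

Definition jump x i s : R := ((s x - x) ord0 i)%:~R.

Lemma measurable_jump x i : measurable_fun setT (fun s => (jump x i s)%:E).
Proof.
apply/measurable_EFinP; apply: (@measurable_local d [fset x]%fset _ (measurableTypeR R)) => s t.
by move=> /agreeP h; rewrite /jump h// inE.
Qed.

(** The jump at [x] is read off the cycle through [x], which is one of the finitely many cycles
    inside the first [n] patterns; a fixed site does not jump. *)
Lemma jump_cover_le x i n s : cover [fset x]%fset n s ->
  (`|(jump x i s)%:E| <= \sum_(t <- cycles_in xpredT x (\big[fsetU/fset0]_(k < n) (pat d k).1)%fset)
     (`|jump x i t| * \1_(pset (orb t x) t) s)%:E)%E.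
Proof.
move=> [k [[kn]]]; rewrite fsub1set => xk bk; rewrite sumEFin /= lee_fin.
have nn (r : seq (Omega d)) : 0 <= \sum_(t <- r) `|jump x i t| * \1_(pset (orb t x) t) s.
  by apply: sumr_ge0 => t _; rewrite mulr_ge0.
have [sx|sx] := eqVneq (s x) x; first by rewrite /jump sx subrr mxE normr0.
set U := (\big[fsetU/fset0]_(k < n) (pat d k).1)%fset.
have kU : ((pat d k).1 `<=` U)%fset.
  by apply: (@bigfcup_sup _ _ (index_enum _) (Ordinal kn) xpredT (fun k : 'I_n => (pat d k).1)); rewrite ?mem_index_enum.
set p := (pat d k).2 in bk; have pS : p \in SL (pat d k).1 := patP _ k.
have st y : y \in (pat d k).1 -> p y \in (pat d k).1 by rewrite (SL_stable _ pS).
have pi := SL_inj pS; have xo := orb_self st xk; have oA := orb_sub st xk.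
pose t := glue (orb p x) p idfun.
have tS : t \in SL (orb p x) := restr_orb_SL pi st xk.
have ot : orb t x = orb p x := orb_glue pi st xk.
have px : s x = p x by apply: (agreeP _ _ _ bk).
have tx : t x = s x by rewrite /t /glue xo.
have tX : t \in cycles_in xpredT x U.
  rewrite !inE ot tS andbT (fsubset_trans oA kU) !andbT.
  rewrite (SLS (fsubset_trans oA kU) tS)/= /nontriv xo/=; apply: contra sx => /eqP o1.
  by have := orb_stable st xk xo; rewrite o1 inE -px.
have sU : agree (orb t x) s t.
  rewrite ot; apply: (agree_trans (agreeS oA bk)).
  by rewrite agree_sym agree_glue.
rewrite (big_fsetD1 _ tX)/= indicE mem_set// mulr1 /jump tx lerDl.
exact: nn.
Qed.

(** On the configurations covered by the first [n] patterns, [mu_le] and [jump_weight] bound the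
    integral by [C] times a subsum of [beta] at [a0]. The bound is uniform in [n], and these events
    exhaust the finite-cycle configurations. *)
Lemma integrable_jump x i : mu.-integrable setT (fun s => (jump x i s)%:E).
Proof.
have [C [C0 hC]] := jump_weight V_ge0 V0 V_conv a0_gt0 a0_lt.
pose b0 := fine (beta V a0).
have mJ := measurable_jump x i.
have mJn : measurable_fun setT (fun s => `|(jump x i s)%:E|%E) by exact: measurableT_comp.
pose F n := cover [fset x]%fset n.
have mF n : measurable (F n) by exact: measurable_cover.
have le1 n : (\int[mu]_(s in F n) `|(jump x i s)%:E| <= (C * b0)%:E)%E.
  pose X := cycles_in xpredT x (\big[fsetU/fset0]_(k < n) (pat d k).1)%fset.
  pose h t s := (`|jump x i t| * \1_(pset (orb t x) t) s)%:E.
  have mh t : measurable_fun setT (h t).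
    apply/measurable_EFinP; apply: measurable_funM => //.
    by apply: measurable_indic; exact: measurable_pset.
  have h0 t s : (0 <= h t s)%E by rewrite lee_fin mulr_ge0.
  apply: (@le_trans _ _ (\int[mu]_(s in F n) \sum_(t <- X) h t s)%E).
    apply: ge0_le_integral => //.
    - exact: measurable_funTS.
    - by apply: measurable_funTS; apply: emeasurable_sum => t.
    - by move=> s; exact: jump_cover_le.
  apply: (@le_trans _ _ (\int[mu]_s \sum_(t <- X) h t s)%E).
    apply: ge0_subset_integral => //.
    - by apply: emeasurable_sum => t.
    - by move=> s _; apply: sume_ge0.
  rewrite ge0_integral_sum//.
  apply: (@le_trans _ _ (\sum_(t <- X) (C * (#|` orb t x|%:R * wt (bw V a0) (orb t x) t))%:E)%E).
    rewrite big_seq [leRHS]big_seq; apply: lee_sum => t /cycles_inP[/andP[xo _] _ _ tS].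
    rewrite /h; under eq_integral do rewrite EFinM.
    rewrite ge0_integralZl//; last first.
      by apply/measurable_EFinP; apply: measurable_indic; exact: measurable_pset.
    rewrite integral_indic//; last exact: measurable_pset.
    rewrite setIT; apply: (le_trans (lee_wpmul2l _ (mu_le tS))); first by rewrite lee_fin.
    by rewrite -EFinM lee_fin; exact: hC.
  rewrite sumEFin lee_fin -mulr_sumr ler_wpM2l//.
  rewrite -(sum_cycles_in xpredT (fun A t => #|` A|%:R * wt (bw V a0) A t)).
  rewrite (eq_bigl (fun A => nontriv x A)) => [|A]; last by rewrite andbT.
  under eq_bigr do rewrite -mulr_sumr.
  exact: cyc_bound_beta.
apply/integrableP; split=> //.
apply: (@le_lt_trans _ _ (C * b0)%:E); last exact: ltry.
have -> : (\int[mu]_s `|(jump x i s)%:E| = \int[mu]_(s in \bigcup_n F n) `|(jump x i s)%:E|)%E.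
  apply: eq_integral_full => //; first exact: bigcup_measurable.
  apply/seteqP; split=> s /= [_ fs]; split=> //.
  by have [k [h1 h2]] := fincyc_cover [fset x]%fset fs; exists k.+1 => //; exists k.
have cv : (\int[mu]_(s in F n) `|(jump x i s)%:E|)%E @[n --> \oo] -->
    (\int[mu]_(s in \bigcup_n F n) `|(jump x i s)%:E|)%E.
  apply: ge0_nondecreasing_set_cvg_integral => //.
    move=> m n mn; apply/subsetPset => s [k [[km ?] ?]].
    by exists k; split=> //; split=> //; exact: leq_trans km mn.
  by move=> n; exact: measurable_funTS.
rewrite -(cvg_lim (@ereal_hausdorff R) cv); apply: lime_le; first by apply/cvg_ex; eexists; exact: cv.
by apply: nearW => n; exact: le1.
Qed.

(* The law is invariant under recentering at the image of [x], and along a cycle of length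
   [n] the jumps at [x] of the [n] successive recenterings sum to zero. *)
Definition recenter x s : Omega d := shift (x - s x) s.

Lemma measurable_recenter x : measurable_fun setT (recenter x).
Proof.
apply: measurable_fun_Omega => y z.
rewrite (_ : [set _ | _] = [set s | exists w, s x = w /\ s (y - (x - w)) = z - (x - w)]).
  apply: (@measurable_exists _ _ _ (fun w => [set s : Omega d | s x = w /\ s (y - (x - w)) = z - (x - w)])) => w.
  exact: (measurableI _ _ (measurable_eval x w) (measurable_eval (y - (x - w)) (z - (x - w)))).
apply/seteqP; split=> s /=.
  by move=> <-; exists (s x); split=> //; rewrite /recenter /Defs.shift addrK.
by move=> [w [<- h]]; rewrite /recenter /Defs.shift h subrK.
Qed.

(** On [s x = w] recentering is the fixed translation by [x - w], which carries this event to
    [s (x + (x - w)) = x]. As [w] varies, these images partition the finite-cycle configurations,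
    since [x] has exactly one preimage. *)
Lemma mu_recenter x C : measurable C -> mu (recenter x @^-1` C) = mu C.
Proof.
move=> mC; have mR : measurable (recenter x @^-1` C).
  by rewrite -[X in measurable X]setTI; exact: measurable_recenter.
have mFc := @measurable_fincyc d.
pose F n := [set s : Omega d | choice.pickle (s x) = n] `&` recenter x @^-1` C.
pose G n := [set s : Omega d | exists w, choice.pickle w = n /\ s (x + (x - w)) = x] `&`
  (C `&` [set s | fincyc s]).
have mF n : measurable (F n).
  apply: measurableI => //.
  exact: (measurable_at x [set w | choice.pickle w = n]).
have mG n : measurable (G n).
  apply: measurableI; last exact: measurableI.
  apply: (@measurable_exists _ _ _ (fun w => [set s : Omega d | choice.pickle w = n /\ s (x + (x - w)) = x])) => w.
  by apply: measurable_and; exact: measurable_eval.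
have pinj := pcan_inj (@choice.pickleK E).
have FG n : mu (F n) = mu (G n).
  have [[w ew]|/forallNP h] := pselect (exists w : E, choice.pickle w = n); last first.
    rewrite (_ : F n = set0); last by apply/seteqP; split=> s //= [/h].
    by rewrite (_ : G n = set0)//; apply/seteqP; split=> s //= [[w [/h]]].
  have eG : G n = ([set s : Omega d | s (x + (x - w)) = x] `&` C) `&` [set s | fincyc s].
    rewrite /G setIA; congr (_ `&` _ `&` _); apply/seteqP; split=> s /=; last by exists w.
    by move=> [w' [ew' h]]; have <- : w' = w by apply: pinj; rewrite ew ew'.
  have mS : measurable ([set s : Omega d | s (x + (x - w)) = x] `&` C).
    by apply: measurableI => //; exact: measurable_eval.
  rewrite eG (mu_full mu_fin)// -(mu_inv (x - w) mS); congr (mu _).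
  apply/seteqP; split=> s /=.
    move=> [e]; have sw : s x = w by apply: pinj; rewrite e.
    by rewrite /recenter/= sw => Cs; split=> //; rewrite /Defs.shift addrK sw addrC subrK.
  rewrite {1}/Defs.shift addrK => -[e Cs].
  have sw : s x = w by apply: (addIr (x - w)); rewrite e addrC subrK.
  by split; [rewrite /= sw|rewrite /= /recenter sw].
have FU : \bigcup_n F n = recenter x @^-1` C.
  apply/seteqP; split=> s; first by move=> [n _ []].
  by move=> Cs; exists (choice.pickle (s x)).
have GU : \bigcup_n G n = C `&` [set s | fincyc s].
  apply/seteqP; split=> s; first by move=> [n _ []].
  move=> [Cs fs]; have [g _ gK] := fincyc_bij fs.
  exists (choice.pickle (x + (x - g x))) => //; split=> //.
  by exists (x + (x - g x)); split=> //; rewrite [- (x + (x - _))]opprD [x + (- x - _)]addrA subrr sub0r opprB addrC subrK gK.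
rewrite -FU -(mu_full mu_fin mC) -GU !measure_bigcup//.
- by apply: eq_eseriesr => n _; exact: FG.
- move=> m n _ _ [s [[[w [ew hw]] [_ fs]] [[w' [ew' hw']] _]]].
  have e : x + (x - w) = x + (x - w') by apply: (fincyc_inj fs); rewrite hw hw'.
  by rewrite -ew -ew'; congr choice.pickle; apply: oppr_inj; apply: (addrI x); apply: (addrI x).
- by move=> m n _ _ [s [[/= <- _] [/= <- _]]].
Qed.

Lemma integrable_recenter x (phi : Omega d -> \bar R) : mu.-integrable setT phi ->
  mu.-integrable setT (phi \o recenter x) /\
  (\int[mu]_s phi (recenter x s) = \int[mu]_s phi s)%E.
Proof.
move=> /[dup] hphi /integrableP[mphi iphi].
have mR := measurable_recenter x.
have eqm (f : Omega d -> \bar R) : (\int[pushforward mu (recenter x)]_s f s = \int[mu]_s f s)%E.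
  by apply: eq_measure_integral => C mC _; exact: mu_recenter.
have ic : mu.-integrable setT (phi \o recenter x).
  apply/integrableP; split; first exact: measurableT_comp.
  have := @ge0_integral_pushforward _ _ _ _ _ _ mR mu setT (fun s => `|phi s|%E) measurableT.
  rewrite eqm => <-//; exact: measurableT_comp.
split=> //; rewrite -[RHS]eqm.
by rewrite (integral_pushforward mR mphi ic measurableT).
Qed.

Lemma shift_shift z w s : shift z (shift w s) = shift (z + w) s.
Proof. by apply/funext => y; rewrite /Defs.shift opprD !addrA addrAC. Qed.

Lemma iter_recenter x s k : iter k (recenter x) s = shift (x - iter k s x) s.
Proof.
elim: k => [|k IH] /=.
  by apply/funext => y; rewrite subrr /Defs.shift subr0 addr0.
rewrite IH /recenter shift_shift; congr (shift _ s).
by rewrite {1}/Defs.shift subKr opprD [x + (- _ - _)]addrA subrK.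
Qed.

(** The exact period is [n.+1], so index 0 stands for fixed points. *)
Definition period x n : set (Omega d) :=
  [set s | (iter n.+1 s x = x /\ forall m, (m < n)%N -> iter m.+1 s x <> x) /\ fincyc s].

Lemma measurable_period x n : measurable (period x n).
Proof.
apply: measurableI; last exact: measurable_fincyc.
apply: measurableI; first exact: measurable_iter.
apply: (@measurable_forall _ _ _ (fun m => [set s : Omega d | (m < n)%N -> iter m.+1 s x <> x])) => m.
by apply: measurable_imply => _; apply: measurableC; exact: measurable_iter.
Qed.

Lemma fincyc_recenter x s : fincyc (recenter x s) <-> fincyc s.
Proof.
split; last exact: fincyc_shift.
by move=> h; rewrite -(shiftK (x - s x) s); exact: fincyc_shift.
Qed.

Lemma period_recenter x n s : period x n (recenter x s) <-> period x n s.
Proof.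
have h m : fincyc s -> iter m (recenter x s) x = x <-> iter m s x = x.
  move=> fs; have e : iter m (recenter x s) x = iter m s (s x) + (x - s x).
    by rewrite /recenter -iter_shift [s x + _]addrC subrK.
  rewrite e -iterSr /=; split=> [h1|->]; last by rewrite addrC subrK.
  by apply: (fincyc_inj fs); apply: (addIr (x - s x)); rewrite h1 addrC subrK.
split=> -[[h1 h2] fs].
  have fs' := (fincyc_recenter x s).1 fs.
  split=> //; split; first exact/h.
  by move=> m mn /(h _ fs'); exact: h2.
split; last exact/fincyc_recenter.
split; first exact/h.
by move=> m mn /(h _ fs); exact: h2.
Qed.

Lemma integral_period x i n : (\int[mu]_(s in period x n) (jump x i s)%:E = 0)%E.
Proof.
have mP := measurable_period x n.
rewrite integral_mkcond; set g := _ \_ _.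
have ig : mu.-integrable setT g.
  apply/(integrable_mkcond _ mP).
  by apply: integrableS (integrable_jump x i).
have hk k : mu.-integrable setT (fun s => g (iter k (recenter x) s)) /\
    (\int[mu]_s g (iter k (recenter x) s) = \int[mu]_s g s)%E.
  elim: k => [|k [i1 e1]]; first by split.
  have [i2 e2] := integrable_recenter x i1.
  have e3 : (fun s => g (iter k.+1 (recenter x) s)) = (fun s => g (iter k (recenter x) s)) \o recenter x.
    by apply/funext => s; rewrite iterSr.
  by rewrite e3; split=> //; rewrite -e1 -e2.
(* The k-th recentered jump is the displacement from the k-th to the next iterate of [x]; over a
   full period these telescope to 0. *)
have sum0 s : (\sum_(k < n.+1) g (iter k (recenter x) s) = 0)%E.
  have gk k : g (iter k (recenter x) s) = if s \in period x n then
      (((iter k.+1 s x - iter k s x) ord0 i)%:~R : R)%:E else 0%E.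
    have -> : g (iter k (recenter x) s) = if iter k (recenter x) s \in period x n then
       (jump x i (iter k (recenter x) s))%:E else 0%E by rewrite /g patchE.
    have -> : (iter k (recenter x) s \in period x n) = (s \in period x n).
      elim: k => //= k <-; apply/idP/idP; rewrite !inE => h; exact/period_recenter.
    case: ifP => // _; rewrite iter_recenter /jump {1}/Defs.shift subKr.
    by rewrite -addrA [x - _ - x]addrAC subrr sub0r.
  under eq_bigr do rewrite gk.
  have [|_] := boolP (s \in period x n); last by rewrite big1.
  rewrite inE => -[[e _] _]; rewrite sumEFin; congr EFin.
  rewrite -(big_mkord xpredT (fun k => (((iter k.+1 s x - iter k s x) ord0 i)%:~R : R))).
  under eq_bigr do rewrite !mxE rmorphB/=.
  by rewrite (telescope_sumr (fun k => (iter k s x ord0 i)%:~R : R))//= -iterS e subrr.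
have := integral_sum measurableT (fun k : 'I_n.+1 => (hk k).1) (index_enum _) xpredT.
under eq_integral do rewrite sum0.
rewrite integral0; under eq_bigr => k _ do rewrite (hk k).2.
have gf : (\int[mu]_s g s)%E \is a fin_num by exact: integrable_fin_num.
rewrite -(fineK gf) sumEFin sumr_const card_ord => -[/esym/eqP].
by rewrite mulrn_eq0 => /eqP ->.
Qed.

Lemma mean_jump x i : (\int[mu]_s (jump x i s)%:E = 0)%E.
Proof.
have iJ := integrable_jump x i.
have mFc := @measurable_fincyc d.
have mFN := prob_setC_full mFc mu_fin.
rewrite (negligible_integral _ _ iJ mFN)//; last exact: measurableC.
rewrite setTD setCK.
have -> : [set s | fincyc s] = \bigcup_n period x n.
  apply/seteqP; split=> s /=; last by move=> [n _ [_]].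
  move=> fs; have /fincycP/(_ x)[n0 [n00 e0]] := fs.
  have ex : exists n, iter n.+1 s x == x by exists n0.-1; rewrite prednK// e0.
  have [n /eqP en nmin] := ex_minnP ex; exists n => //; do 2 split=> //.
  by move=> m mn /eqP/nmin; rewrite leqNgt mn.
rewrite integral_bigcup.
- by apply: eseries0 => n _ _; exact: integral_period.
- move=> m n _ _ [s [[[e1 h1] _] [[e2 h2] _]]].
  by case: (ltngtP m n) => // [/h2|/h1].
- by move=> n; exact: measurable_period.
- apply: integrableS iJ => //; apply: bigcup_measurable => n _; exact: measurable_period.
Qed.

End MeanJump.

(** * Monotonicity of [beta] and the proof of the theorem *)

Section BetaMonotone.
Variables (R : realType) (d : nat) (V : site d -> \bar R).
Hypothesis V_ge0 : forall x, (0 <= V x)%E.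

Lemma le_expw (a a' : R) (h : \bar R) : a <= a' -> (0 <= h)%E -> expw a' h <= expw a h.
Proof.
case: h => //= r aa'; rewrite lee_fin => r0.
by rewrite ler_expR lerN2 ler_wpM2r.
Qed.

Lemma le_beta (a a' : R) : a <= a' -> (beta V a' <= beta V a)%E.
Proof.
move=> aa'; apply: le_esum => g _; apply: lee_wpmul2l; first exact: esum_ge0.
by rewrite lee_fin; apply: le_expw => //; apply: fsume_ge0 => x _.
Qed.

(** The strict gap below [a] serves twice: monotonicity carries [beta < 1] up to [a], and
    [jump_weight] spends the difference [a - a0]. *)
Lemma alpha_star_lt (a : R) : (alpha_star V < a%:E)%E ->
  exists a0, [/\ 0 < a0, a0 < a & (beta V a0 < 1)%E].
Proof.
by move=> /ereal_inf_lt[_ [a0 [a00 b0] <-]]; rewrite lte_fin => a0a; exists a0.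
Qed.

End BetaMonotone.

Unset Implicit Arguments.

Theorem theorem2p1 (R : realType) (d : nat) (V : site d -> \bar R) :
  (0 < d)%N ->
  (forall x, (0 <= V x)%E) -> V 0 = 0%E -> strictly_convex_pot V ->
  (alpha_star V < +oo)%E ->
  forall a : R, (alpha_star V < a%:E)%E ->
  exists (dT : measure_display) (T : measurableType dT) (P : probability T R)
         (zeta : {fset site d} -> T -> Omega d) (zetaZ : T -> Omega d)
         (mu : probability (Omega d) R),
    [/\ (* random permutations, zeta_Lambda in S_Lambda *)
        (forall L, measurable_fun setT (zeta L)) /\ measurable_fun setT zetaZ,
        (forall L t, SLx L idfun (zeta L t)) /\ (forall t, bijective (zetaZ t)),
        (* (i) zeta_Lambda ~ G_Lambda *)
        (forall L (A : set (Omega d)), measurable A ->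
           P (zeta L @^-1` A) = (Gspec V a L idfun A)%:E),
        (* (ii) a.s. convergence, mu = law of zeta_{Z^d}, weak convergence *)
        [/\ forall x : site d, {ae P, forall t, exists L0 : {fset site d},
               forall L : {fset site d}, fsubset L0 L -> zeta L t x = zetaZ t x},
            forall A : set (Omega d), measurable A -> mu A = P (zetaZ @^-1` A) &
            forall f : Omega d -> R, measurable_fun setT f ->
              (exists M : R, forall s, bijective s -> `|f s| <= M) -> contS f ->
              forall e : R, 0 < e -> exists L0 : {fset site d},
                forall L : {fset site d}, fsubset L0 L ->
                  `|Gint V a L f - fine (\int[mu]_s (f s)%:E)%E| < e] &
        (* (iii) Gibbs, ergodic, mean jump 0; (iv) uniqueness among
           finite-cycle-supported Gibbs measures *)
        [/\ Gibbs V a mu, ergodic mu,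
            forall (x : site d) (i : 'I_d),
              mu.-integrable setT (fun s : Omega d => (((s x - x) ord0 i)%:~R : R)%:E) /\
              (\int[mu]_s (((s x - x) ord0 i)%:~R : R)%:E = 0)%E,
            mu [set s | finite_cycle s] = 1%E &
            forall nu : probability (Omega d) R, Gibbs V a nu ->
              nu [set s | finite_cycle s] = 1%E ->
              forall A : set (Omega d), measurable A -> nu A = mu A]].
Proof.
move=> d0 V_ge0 V0 V_conv _ a /alpha_star_lt[a0 [a00 a0a b01]].
have a_gt0 : 0 < a := lt_trans a00 a0a.
have beta1 : (beta V a < 1)%E by apply: le_lt_trans b01; apply: le_beta => //; exact: ltW.
have boo : (beta V a < +oo)%E := lt_trans beta1 (ltry 1).
have boo0 : (beta V a0 < +oo)%E := lt_trans b01 (ltry 1).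
have beta0 : (0 <= beta V a)%E by rewrite betaE; apply: esum_ge0 => g _; exact: cycle_term_ge0.
have bE : beta V a = (fine (beta V a))%:E by rewrite fineK// ge0_fin_numE.
have b_ge0 : 0 <= fine (beta V a) by exact: fine_ge0.
have b_lt1 : fine (beta V a) < 1 by rewrite -lte_fin -bE.
have v_ge0 := bw_ge0 V a; have v0 : bw V a 0 = 1 := bw0 a V0.
have v_le1 : forall x, bw V a x <= 1 by move=> x; exact: bw_le1.
have cb x U := @cyc_bound_beta R d V a V_ge0 x U boo.
have ct e (e0 : 0 < e) := @cyc_tail_beta R d V a V_ge0 e boo e0.
pose m := mu v_ge0 v0.
have m_pat := @mu_pset R d _ v_ge0 v0 _ b_ge0 b_lt1 cb ct d0.
have m_fin : m [set s | fincyc s] = 1%E := mu_fincyc v_ge0 v0.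
have fcE : [set s : Omega d | finite_cycle s] = [set s | fincyc s].
  by apply/seteqP; split=> s /=; move/fincycP.
have rc A : ratio (bw V a) L A @[L --> @fset_up (site d)] --> rho (bw V a) A.
  exact: (cvg_ratioE v_ge0 v0 b_ge0 b_lt1 cb ct).
have m_inv := mu_shift v_ge0 v0 b_ge0 b_lt1 cb ct m_fin m_pat.
have m_le A t : t \in SL A -> (m (pset A t) <= (wt (bw V a) A t)%:E)%E.
  move=> tA; rewrite m_pat// lee_fin ler_piMr ?wt_ge0//.
  apply: (closed_cvg [set y : R | y <= 1] (@closed_le R 1) _ _ (rc A)).
  by apply: nearW => L; exact: ratio_le1.
exists _, (measurableTypeR R), (unif R), (zeta (bw V a)), (zetaZ (bw V a)), m; split.
- by split=> [L|]; [exact: measurable_fun_zeta|exact: measurable_fun_zetaZ].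
- split=> [L t|t]; last exact: zetaZ_bij.
  by have /SLP := zeta_SL (bw V a) L t.
- by move=> L A _; rewrite unif_zeta// GspecE.
- split.
  + move=> x; have := ae_good v_ge0 v0 b_ge0 b_lt1 cb ct d0; apply: negligibleS => u /= nQ gu.
    by apply: nQ; have /near_fset_up := zetaZ_near x gu.
  + by move=> A _; exact: muE.
  + move=> f mf [M hM] cf e e0.
    have /cvgrPdist_lt/(_ e e0)/near_fset_up[L0 hL0] :=
      cvg_zeta_integral (v_ge0 := v_ge0) (v0 := v0) b_ge0 b_lt1 cb ct d0 mf hM cf.
    exists L0 => L /hL0; rewrite distrC; congr (`|_ - _| < _).
    rewrite /Gint fsbig_finite; last exact: finite_SLx.
    by apply: eq_bigr => s _; rewrite GspecE.
split.
- apply: (mu_Gibbs V_ge0 m_fin m_pat).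
  rewrite -[RHS](@probability_setT _ _ _ (unif R)) muE; congr (unif R _).
  by apply/seteqP; split=> // u _; exact: zetaZ_bij.
- exact: (mu_ergodic v_ge0 v_le1 v0 b_ge0 b_lt1 cb ct d0 m_fin m_pat).
- move=> x i; split.
    exact: (integrable_jump V_ge0 V0 V_conv a00 a0a boo0 m_fin m_le).
  exact: (mean_jump V_ge0 V0 V_conv a00 a0a boo0 m_fin m_le m_inv).
- by rewrite fcE.
move=> nu Gnu; rewrite fcE => nuf A mA.
apply: (eq_probability_pset (L := fset0)) => // B t _ tB.
by rewrite (Gibbs_pset V_ge0 a_gt0 rc Gnu nuf tB) m_pat.
Qed.
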